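(* Let $b \in L^1_{\mathrm{loc}}(\mathbb{C})$, and suppose $p$ and $q$ satisfy $1 < p < 2 < q < \infty$ and $p' \neq q$, where $\frac1p + \frac1{p'} = 1$. Define $\beta$ by $$\frac{\beta}{2} = \frac{1}{p} - \frac{1}{q} - \frac{1}{2}.$$ Then $C_b : L^p(\mathbb{C}) \to L^q(\mathbb{C})$ if and only if one of the following holds: 1. $\beta > 1$ and $b$ is constant; 2. $\beta \in (0,1]$ and $b$ is H\''older continuous with exponent $\beta$; 3. $\beta = 0$ and $b \in BMO(\mathbb{C})$; 4. $\beta < 0$ and $b \in \mathscr{L}^{\phi,\lambda}(\mathbb{C})$, where $\phi = \max\{p', q\}$ and $\lambda$ is determined by $\frac{1}{\phi}\left(1 - \frac{\lambda}{2}\right) = -\frac{\beta}{2}$.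
   Context: The Cauchy transform is $C(f)(z) = \int_{\mathbb{C}} \frac{f(\zeta)}{z-\zeta}\,dA(\zeta)$, where $dA$ is Lebesgue area measure on $\mathbb{C} \cong \mathbb{R}^2$. For $b \in L^1_{\mathrm{loc}}(\mathbb{C})$ its commutator is $$C_b f(z) = b(z)\, C f(z) - C(bf)(z) = \int_{\mathbb{C}} \frac{b(z) - b(\zeta)}{z - \zeta} f(\zeta)\, dA(\zeta).$$ The notation $C_b : L^p(\mathbb{C}) \to L^q(\mathbb{C})$ means that there is a constant $K > 0$ such that $\left(\int_{\mathbb{C}} |C_b f|^q\, dA\right)^{1/q} \le K \left(\int_{\mathbb{C}} |f|^p\, dA\right)^{1/p}$ for all $f \in L^p(\mathbb{C})$. Functions in $L^1_{\mathrm{loc}}$ are identified when equal almost everywhere. ''H\''older continuous with exponent $\beta$'' means there is a constant $K$ with $|b(x) - b(y)| \le K|x-y|^\beta$ for all $x,y \in \mathbb{C}$. For $x \in \mathbb{C}$ and $r > 0$, $Q(x,r)$ denotes the square with sides parallel to the axes, center $x$ and side length $2r$; $f_Q = \frac{1}{|Q|}\int_Q f$ is the average of $f$ over $Q$. For $1 \le s < \infty$ and $\lambda \ge 0$, the Campanato space $\mathscr{L}^{s,\lambda}(\mathbb{C})$ is the set of $f \in L^1_{\mathrm{loc}}(\mathbb{C})$ with finite Campanato seminorm $$[f]_{\mathscr{L}^{s,\lambda}} = \sup_{x \in \mathbb{C},\, r > 0} \left( \frac{1}{r^\lambda} \int_{Q(x,r)} |f(y) - f_{Q(x,r)}|^s\,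 dA(y) \right)^{1/s}.$$ *)

(* Defs.v *)
From HB Require Import structures.
From mathcomp Require Import all_boot all_order all_algebra.
From mathcomp Require Import complex.
From mathcomp Require Import all_classical all_reals all_analysis.

Set Implicit Arguments.
Unset Strict Implicit.
Unset Printing Implicit Defensive.

Import Order.TTheory GRing.Theory Num.Theory.
Import numFieldNormedType.Exports.

Local Open Scope classical_set_scope.
Local Open Scope ring_scope.
Local Open Scope complex_scope.

(* The real-valued modulus; the generic norm on R[i] takes values in R[i]. *)
Notation cabs := ComplexField.Normc.normc.

(* The complex plane as a domain of integration: pairs of reals with the
   product of the Borel sigma-algebras. *)
Notation plane R := (measurableTypeR R * measurableTypeR R)%type.

Section cauchy_commutator.
Context {R : realType}.

(* Distances in the plane go through [pt]: the norm of R * R is the sup norm. *)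
Definition pt (z : plane R) : R[i] := (z.1 : R) +i* (z.2 : R).

Definition area : {measure set (plane R) -> \bar R} :=
  (@lebesgue_measure R \x @lebesgue_measure R)%E.

Definition cmeasurable (f : plane R -> R[i]) : Prop :=
  measurable_fun setT (fun z => complex.Re (f z)) /\
  measurable_fun setT (fun z => complex.Im (f z)).

Definition cintegrable (D : set (plane R)) (f : plane R -> R[i]) : Prop :=
  area.-integrable D (fun z => (complex.Re (f z))%:E) /\
  area.-integrable D (fun z => (complex.Im (f z))%:E).

Definition cintegral (D : set (plane R)) (f : plane R -> R[i]) : R[i] :=
  (\int[area]_(z in D) complex.Re (f z)) +i*
  (\int[area]_(z in D) complex.Im (f z)).

Definition L1loc (f : plane R -> R[i]) : Prop :=
  cmeasurable f /\
  forall K : set (plane R), @compact (R * R)%type K ->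
    (\int[area]_(z in K) (cabs (f z))%:E < +oo)%E.

Definition LpNorm (p : R) (f : plane R -> R[i]) : \bar R :=
  Lnorm area p%:E (fun z => (cabs (f z))%:E).

Definition in_Lp (p : R) (f : plane R -> R[i]) : Prop :=
  cmeasurable f /\ (LpNorm p f < +oo)%E.

(* On the null set w = z the value is the junk 0^-1 = 0. *)
Definition cauchy_integrand (f : plane R -> R[i]) (z w : plane R) : R[i] :=
  f w / (pt z - pt w).

Definition cauchy_converges (f : plane R -> R[i]) (z : plane R) : Prop :=
  cintegrable setT (cauchy_integrand f z).

Definition cauchy (f : plane R -> R[i]) (z : plane R) : R[i] :=
  cintegral setT (cauchy_integrand f z).

Definition commutator (b f : plane R -> R[i]) (z : plane R) : R[i] :=
  b z * cauchy f z - cauchy (fun w => b w * f w) z.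

Lemma commutatorE (b f : plane R -> R[i]) (z : plane R) :
  cauchy_converges f z -> cauchy_converges (fun w => b w * f w) z ->
  commutator b f z =
  cintegral setT (fun w => (b z - b w) / (pt z - pt w) * f w).
Proof.
rewrite /cauchy_converges /commutator /cauchy.
set g := cauchy_integrand f z; set h := cauchy_integrand _ z.
move=> [g1 g2] [h1 h2].
have -> : (fun w => (b z - b w) / (pt z - pt w) * f w) =
          (fun w => b z * g w - h w).
  apply/funext => w; rewrite /g /h /cauchy_integrand mulrBl mulrBl.
  congr (_ - _); last by rewrite mulrAC.
  by rewrite -mulrA [_^-1 * _]mulrC.
case: (b z) => u v.
have Z (c : R) (k : plane R -> R) : area.-integrable setT (fun w => (k w)%:E) ->
    area.-integrable setT (fun w => (c * k w)%:E).
  by move=> /(integrableZl measurableT c).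
have ReI : area.-integrable setT
    (fun w => (u * complex.Re (g w) - v * complex.Im (g w))%:E).
  exact: (integrableB measurableT (Z u _ g1) (Z v _ g2)).
have ImI : area.-integrable setT
    (fun w => (u * complex.Im (g w) + v * complex.Re (g w))%:E).
  exact: (integrableD measurableT (Z u _ g2) (Z v _ g1)).
transitivity (
  (\int[area]_(w in setT)
     ((u * complex.Re (g w) - v * complex.Im (g w)) - complex.Re (h w))) +i*
  (\int[area]_(w in setT)
     ((u * complex.Im (g w) + v * complex.Re (g w)) - complex.Im (h w)))).
  rewrite (RintegralB measurableT ReI h1) (RintegralB measurableT ImI h2).
  rewrite (RintegralB measurableT (Z u _ g1) (Z v _ g2)).
  rewrite (RintegralD measurableT (Z u _ g2) (Z v _ g1)).
  by rewrite !RintegralZl.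
by congr Complex; apply: eq_Rintegral => w _; case: (g w) => ? ?; case: (h w).
Qed.

(* [cauchy] is total, so the convergence of the integrals defining C_b f,
   almost everywhere, is part of the boundedness of C_b on L^p. *)
Definition commutator_bounded (b : plane R -> R[i]) (p q : R) : Prop :=
  exists K : R, 0 < K /\
    forall f : plane R -> R[i], in_Lp p f ->
      {ae area, forall z, cauchy_converges f z /\
                          cauchy_converges (fun w => b w * f w) z} /\
      (LpNorm q (commutator b f) <= K%:E * LpNorm p f)%E.

Definition square (x : plane R) (r : R) : set (plane R) :=
  [set y | `|(y.1 : R) - x.1| <= r /\ `|(y.2 : R) - x.2| <= r].

Lemma area_square (x : plane R) (r : R) :
  0 < r -> area (square x r) = ((2 * r) ^+ 2)%:E.
Proof.
move=> r0.
have -> : square x r = `[(x.1 : R) - r, (x.1 : R) + r]%classic `*`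
                       `[(x.2 : R) - r, (x.2 : R) + r]%classic.
  by apply/seteqP; split=> y; rewrite /square /= !in_itv /= !ler_distl => -[-> ->].
rewrite /area /= product_measure1E; [|exact: measurable_itv..].
have L (c : R) :
  lebesgue_measure (`[c - r, c + r]%classic : set (measurableTypeR R)) =
  (2 * r)%:E.
  have := @lebesgue_measure_itv R (Interval (BLeft (c - r)) (BRight (c + r))).
  rewrite /= lte_fin ltrBlDr -addrA ltrDl addr_gt0// => ->.
  rewrite -EFinD; congr EFin.
  by rewrite mulr_natl mulr2n opprD opprK addrACA subrr add0r.
by rewrite [X in (X * _)%E]L [X in (_ * X)%E]L -EFinM expr2.
Qed.

Definition average (Q : set (plane R)) (f : plane R -> R[i]) : R[i] :=
  ((fine (area Q))^-1)%:C * cintegral Q f.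

Definition campanato_seminorm (s lambda : R) (f : plane R -> R[i]) : \bar R :=
  ereal_sup [set t | exists (x : plane R) (r : R), (0 < r)%R /\
    t = (((r `^ lambda)^-1)%R%:E *
         \int[area]_(y in square x r)
           (cabs (f y - average (square x r) f) `^ s)%R%:E) `^ s^-1]%E.

Definition campanato (s lambda : R) (f : plane R -> R[i]) : Prop :=
  L1loc f /\ (campanato_seminorm s lambda f < +oo)%E.

Definition bmo_seminorm (f : plane R -> R[i]) : \bar R :=
  ereal_sup [set t | exists (x : plane R) (r : R), (0 < r)%R /\
    t = ((fine (area (square x r)))^-1)%R%:E *
        \int[area]_(y in square x r)
          (cabs (f y - average (square x r) f))%R%:E]%E.

Definition bmo (f : plane R -> R[i]) : Prop :=
  L1loc f /\ (bmo_seminorm f < +oo)%E.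

(* Elements of L^1_loc are classes modulo equality almost everywhere: a
   pointwise property holds for a class when some representative has it. *)
Definition ae_constant (f : plane R -> R[i]) : Prop :=
  exists c : R[i], {ae area, forall z, f z = c}.

Definition holder (beta : R) (f : plane R -> R[i]) : Prop :=
  exists K : R, forall x y : plane R,
    cabs (f x - f y) <= K * (cabs (pt x - pt y)) `^ beta.

Definition ae_holder (beta : R) (f : plane R -> R[i]) : Prop :=
  exists g : plane R -> R[i],
    holder beta g /\ {ae area, forall z, f z = g z}.

End cauchy_commutator.

(* Main.v *)
Require Import Defs.
From HB Require Import structures.
From mathcomp Require Import all_boot all_order all_algebra.
From mathcomp Require Import complex.
From mathcomp Require Import all_classical all_reals all_analysis measurable_realfun.
From mathcomp Require Import ring lra zify.
Import Defs.

(** The commutator has the kernel [(b z - b w) / (z - w)], and [1 / |z - w|] is of the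
    order of the sum of [1 / r] over the dyadic squares of half-side [r] that contain
    both points.  Both directions use only the size of [b] minus a constant on
    squares.  With [s] the exponent conjugate to [q], the number [beta] is such that
    the natural condition, in all cases, is that [b] deviates from its mean by
    [r ^ beta] on squares of half-side [r], in mean of order [q] and of order [p'].

    Necessity.  If [f] is supported in a square with centre [x], then
    [(z - w) / (z - w) = 1] turns the commutators of [f] and of [(w - x) f] into
    [b z * \int f - \int (b f)] ([cauchy_shift], [moment_bound]).  For [f] the
    indicator function of the square this bounds the mean deviation of [b] of order
    [q] ([oscillation_le_q]); by duality it also bounds the one of order [p']
    ([oscillation_le_conjugate]).  Hence the Campanato condition when [beta < 0] and
    [BMO] when [beta = 0].  When [beta > 0] the averages of [b] over shrinking squares
    converge to a Hoelder continuous function that equals [b] almost everywhere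
    ([ae_holder_of_mean_oscillation]).  Since [p > 1], always [beta < 1], so that the
    first alternative never occurs.

    Sufficiency.  On a square [S j] write [|b z - b w| <= A j z + A j w], where
    [A j = |b - c j|].  By duality the commutator is bounded as soon as two sums over
    the dyadic squares, of the products of [\int A j g / r] and [\int f], are bounded
    ([commutator_bounded_of_pairing]).  Young's inequality splits each sum into sums
    of powers, each of them bounded by the embedding [sum_carleson].  When
    [beta >= 0] the deviation of [b] is controlled in mean of arbitrarily large order,
    by Hoelder continuity or by [john_nirenberg], and a little room in the exponents
    is enough ([dyadic_pairing_osc]).  When [beta < 0] there is no such room, but the
    averages of [b] over large squares converge to a constant [c]
    ([average_limit_large]); with [c j = c] the weight is the same on all squares,
    and the embedding applies with this weight ([dyadic_pairing_morrey]).

    The John-Nirenberg inequality is proved for the means of [b] on the cells of the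
    [n]-th subdivision of a square, by induction on [n] and uniformly in [n]
    ([mean_power_bounded]), and passes to [b] because these means converge to [b] in
    [L^1] ([osc_mean_small]). *)

Set Implicit Arguments.
Unset Strict Implicit.
Unset Printing Implicit Defensive.

Import Order.TTheory GRing.Theory Num.Theory.
Import numFieldNormedType.Exports.

Local Open Scope classical_set_scope.
Local Open Scope ring_scope.
Local Open Scope complex_scope.

(** * Sums over dyadic scales *)

Lemma sum_geometric_le (R : realType) (q : R) (t : seq nat) :
  0 <= q < 1 -> uniq t -> \sum_(n <- t) q ^+ n <= (1 - q)^-1.
Proof.
move=> /andP[q0 q1] ut; set M := (\max_(n <- t) n).+1.
have tM n : n \in t -> (n < M)%N by move=> nt; rewrite ltnS; exact: leq_bigmax_seq.
have -> : \sum_(n <- t) q ^+ n = \sum_(n < M | val n \in t) q ^+ n.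
  rewrite -(big_mkord (fun n => n \in t) (fun n => q ^+ n)) -big_filter.
  apply: perm_big; apply: uniq_perm => //; first by rewrite filter_uniq ?iota_uniq.
  move=> n; rewrite mem_filter mem_index_iota /=.
  by case: (boolP (n \in t)) => //= nt; rewrite tM.
apply: (@le_trans _ _ (\sum_(n < M) q ^+ n)).
  rewrite [leRHS](bigID (fun n : 'I_M => val n \in t)) /= lerDl.
  by apply: sumr_ge0 => *; rewrite exprn_ge0.
have q1' : 0 < 1 - q by rewrite subr_gt0.
rewrite -[leRHS]mul1r ler_pdivlMr // mulrC.
have -> : (1 - q) * \sum_(i < M) q ^+ i = 1 - q ^+ M.
  by rewrite -opprB mulNr -subrX1 opprB.
by rewrite lerBlDr lerDl exprn_ge0.
Qed.

Lemma sum_geometric_int_le (R : realType) (q : R) (m : int) (t : seq int) :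
  0 <= q < 1 -> uniq t -> \sum_(k <- t) q ^+ `|k - m|%N <= 2 * (1 - q)^-1.
Proof.
move=> q01 ut; rewrite (bigID (fun k : int => m <= k)) /= mulr_natl mulr2n.
have H (P : pred int) : {in P &, injective (fun k : int => `|k - m|%N)} ->
    \sum_(k <- t | P k) q ^+ `|k - m|%N <= (1 - q)^-1.
  move=> inj; rewrite -big_filter -(big_map (fun k : int => `|k - m|%N) xpredT (fun n => q ^+ n)).
  apply: sum_geometric_le => //; rewrite map_inj_in_uniq ?filter_uniq //.
  by move=> x y; rewrite !mem_filter => /andP[Px _] /andP[Py _]; exact: inj.
by apply: lerD; apply: H => x y; rewrite -!topredE /= => xm ym /=; lia.
Qed.

(** Only boundedly many terms of the progression [2 ^ (delta k) v] are close to
    [1], and on both sides of them the summand decays geometrically; the bound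
    does not depend on [v] because [v] only shifts the progression. *)
Lemma sum_dyadic_bump (R : realType) (delta e : R) : 0 < delta -> 0 < e ->
  exists2 C : R, 0 < C & forall (v : R) (t : seq int), 0 < v -> uniq t ->
  \sum_(k <- t) (Num.min (2 `^ (delta * k%:~R) * v) (2 `^ (delta * k%:~R) * v)^-1) `^ e <= C.
Proof.
move=> d0 e0; have e2 : (1 : R) < 2 by rewrite ltr1n.
have l2 : 0 < ln (2 : R) by rewrite ln_gt0.
set c := e * delta * ln (2 : R); have c0 : 0 < c by rewrite !mulr_gt0.
set q := expR (- c).
have q01 : 0 <= q < 1 by rewrite expR_ge0 expR_lt1 oppr_lt0.
exists (expR c * (2 * (1 - q)^-1)).
  by case/andP: q01 => _ ?; rewrite !mulr_gt0 ?expR_gt0// invr_gt0 subr_gt0.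
move=> v t v0 ut.
set tau := ln v / (delta * ln 2); set m : int := Num.floor (- tau).
have mle : m%:~R <= - tau by exact: ge_floor.
have mgt : - tau < m%:~R + 1 by have := floorD1_gt (- tau); rewrite intrD.
have dl0 : 0 < delta * ln (2 : R) by rewrite mulr_gt0.
apply: (@le_trans _ _ (\sum_(k <- t) expR c * q ^+ `|k - m|%N)); last first.
  by rewrite -mulr_sumr ler_pM2l ?expR_gt0// sum_geometric_int_le.
apply: ler_sum => k _.
have -> : 2 `^ (delta * k%:~R) * v = expR (delta * ln 2 * (k%:~R + tau)) :> R.
  rewrite /powR pnatr_eq0 /= -[in LHS](lnK v0) -expRD; congr expR.
  by rewrite /tau; field; apply/andP; split; rewrite gt_eqF.
set y := k%:~R + tau.
have -> : Num.min (expR (delta * ln 2 * y)) (expR (delta * ln 2 * y))^-1 = expR (- (delta * ln 2 * `|y|)).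
  rewrite -expRN; have [y0|y0] := leP 0 y.
    have h : 0 <= delta * ln 2 * y by apply: mulr_ge0 => //; exact: ltW.
    by rewrite ger0_norm// min_r// ler_expR; lra.
  have h : delta * ln 2 * y <= 0 by rewrite pmulr_rle0// ltW.
  by rewrite ltr0_norm// mulrN opprK min_l// ler_expR; lra.
rewrite /powR gt_eqF ?expR_gt0// expRK -expRM_natl -expRD ler_expR.
have -> : e * - (delta * ln 2 * `|y|) = - c * `|y| by rewrite /c; ring.
have nE : (`|k - m|%N)%:R = `|k%:~R - m%:~R| :> R.
  by rewrite natr_absz intr_norm intrB.

suff: `|k - m|%N%:R <= `|y| + 1 :> R by move=> h; nra.
rewrite nE; have -> : k%:~R - m%:~R = y - (tau + m%:~R) :> R by rewrite /y; ring.
apply: (le_trans (ler_normB _ _)); rewrite lerD2l ler_norml; apply/andP; split; lra.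
Qed.

(** * An embedding for weights with power growth *)

Lemma powR_ln (R : realType) (x p : R) : 0 < x -> x `^ p = expR (p * ln x).
Proof. by move=> x0; rewrite /powR gt_eqF. Qed.

Lemma le_powRl (R : realType) (p x y : R) : 0 <= p -> 0 <= x -> x <= y ->
  x `^ p <= y `^ p.
Proof.
by move=> p0 x0 xy; apply: ge0_ler_powR => //; rewrite nnegrE// (le_trans x0).
Qed.

Lemma ln_inj_pos (R : realType) (x y : R) : 0 < x -> 0 < y -> ln x = ln y -> x = y.
Proof. by move=> x0 y0; apply: ln_inj; rewrite posrE. Qed.

Lemma conjugate_gt0 (R : realType) (s t : R) : 1 < s -> s^-1 + t^-1 = 1 -> t = s / (s - 1).
Proof.
move=> s1 st; have s0 : 0 < s by lra.
have : t^-1 = (s - 1) / s by rewrite mulrBl mul1r divff ?gt_eqF //; lra.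
by move=> /(congr1 GRing.inv); rewrite invrK invf_div.
Qed.

Section integrals.
Context d (T : measurableType d) (R : realType).
Variable mu : {measure set T -> \bar R}.
Implicit Types (D : set T) (f g : T -> R).

Lemma measurable_powRf f (p : R) : measurable_fun setT f ->
  measurable_fun setT (fun x => f x `^ p).
Proof. exact: (@measurableT_comp _ _ _ _ _ _ (@powR R ^~ p)). Qed.

Lemma measurable_EFinS D f : measurable_fun setT f -> measurable_fun D (EFin \o f).
Proof. by move=> mf; apply/measurable_EFinP; exact: measurable_funTS. Qed.

Lemma le_integral_EFin D f g : measurable D ->
  measurable_fun setT f -> measurable_fun setT g ->
  (forall x, D x -> 0 <= f x) -> (forall x, D x -> f x <= g x) ->
  (\int[mu]_(x in D) (f x)%:E <= \int[mu]_(x in D) (g x)%:E)%E.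
Proof.
move=> mD mf mg f0 fg; apply: ge0_le_integral => //.
- exact: measurable_EFinS.
- exact: measurable_EFinS.
Qed.

Lemma integralZ_EFin D f (c : R) : measurable D -> measurable_fun setT f ->
  (forall x, 0 <= f x) -> 0 <= c ->
  (\int[mu]_(x in D) (c * f x)%:E = c%:E * \int[mu]_(x in D) (f x)%:E)%E.
Proof.
move=> mD mf f0 c0; under eq_integral do rewrite EFinM.
by rewrite ge0_integralZl//; [exact: measurable_EFinS|move=> x _; rewrite lee_fin].
Qed.

Lemma integralD_EFin_ge0 D f g : measurable D -> measurable_fun setT f ->
  measurable_fun setT g -> (forall x, 0 <= f x) -> (forall x, 0 <= g x) ->
  (\int[mu]_(x in D) (f x + g x)%:E =
   \int[mu]_(x in D) (f x)%:E + \int[mu]_(x in D) (g x)%:E)%E.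
Proof.
move=> mD mf mg f0 g0; under eq_integral do rewrite EFinD.
by rewrite ge0_integralD//;
  [move=> x _; rewrite lee_fin|exact: measurable_EFinS
  |move=> x _; rewrite lee_fin|exact: measurable_EFinS].
Qed.

Lemma holder_integral D f g (p q : R) : measurable D ->
  measurable_fun setT f -> measurable_fun setT g ->
  (forall x, 0 <= f x) -> (forall x, 0 <= g x) ->
  0 < p -> 0 < q -> p^-1 + q^-1 = 1 ->
  (\int[mu]_(x in D) (f x * g x)%:E <=
   (\int[mu]_(x in D) (f x `^ p)%:E) `^ p^-1 *
   (\int[mu]_(x in D) (g x `^ q)%:E) `^ q^-1)%E.
Proof.
move=> mD mf mg f0 g0 p0 q0 pq.
have mfD : measurable_fun setT (f \_ D) by apply/(measurable_restrictT _ mD); exact: measurable_funTS.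
have mgD : measurable_fun setT (g \_ D) by apply/(measurable_restrictT _ mD); exact: measurable_funTS.
have := hoelder mu mfD mgD p0 q0 pq.
rewrite Lnorm1 unlock.
have N (h : T -> R) (r : R) : (forall x, 0 <= h x) -> 0 < r ->
    (\int[mu]_x `|(EFin \o (h \_ D)) x| `^ r = \int[mu]_(x in D) (h x `^ r)%:E)%E.
  move=> h0 r0; rewrite [RHS]integral_mkcond; apply: eq_integral => x _.
  rewrite /= !patchE; case: ifPn => _; first by rewrite ger0_norm.
  by rewrite normr0 powR0 ?gt_eqF.
rewrite !N//; apply: le_trans.
rewrite le_eqVlt; apply/orP; left; apply/eqP.
rewrite integral_mkcond; apply: eq_integral => x _ /=.
rewrite !patchE; case: ifPn => _; first by rewrite ger0_norm ?mulr_ge0.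
by rewrite mulr0 normr0.
Qed.

(** The pointwise bound, at the scale [rj], for a term of the sum in
    [sum_carleson]; its integral over the square dominates the term. *)
Definition carleson_bump (a g : T -> R) (s t dd A rho : R) (rj : R) (x : T) : R :=
  2 * rj `^ (- (dd / t)) * (a x * g x) *
  Num.min (A `^ t^-1) (2 * A * rj `^ (dd / s) * (g x * a x `^ (1 - t))) `^ (rho - 1).

(** The critical scale is the one where [z] below equals [1]. Under it the
    minimum is [z] and its power [rho - 1] beats [z ^ (1 - s)], as [rho > s];
    above it the minimum is constant and [z ^ (1 - s)] decays, as [s > 1]. *)
Lemma sum_carleson_bump (s t dd A rho : R) : 1 < s -> s^-1 + t^-1 = 1 -> s < rho ->
  0 < dd -> 0 < A ->
  exists2 C : R, 0 < C &
  forall (a g : T -> R) (x : T) (ms : seq int), 0 <= a x -> 0 <= g x -> uniq ms ->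
  \sum_(m <- ms) carleson_bump a g s t dd A rho (2 `^ m%:~R) x <= C * g x `^ s.
Proof.
move=> s1 st srho dd0 A0.
have s0 : 0 < s by lra.
pose e := Num.min (s - 1) (rho - s); have e0 : 0 < e.
  by rewrite lt_min !subr_gt0 s1 srho.
have [C C0 HC] := @sum_dyadic_bump R (dd / s) e (divr_gt0 dd0 s0) e0.
pose B := Num.max (A `^ t^-1) (2 * A).
have B0 : 0 < B by rewrite lt_max powR_gt0.
exists (2 * B `^ (rho - 1) * C); first by rewrite !mulr_gt0 ?powR_gt0.
move=> a g x ms a0 g0 ums.
have [ax0|ax0] := eqVneq (a x) 0.
  rewrite big1; first by rewrite !mulr_ge0 ?powR_ge0 ?ltW.
  by move=> m _; rewrite /carleson_bump ax0 mul0r mulr0 mul0r.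
have [gx0|gx0] := eqVneq (g x) 0.
  rewrite big1; first by rewrite !mulr_ge0 ?powR_ge0 ?ltW.
  by move=> m _; rewrite /carleson_bump gx0 mulr0 mulr0 mul0r.
have {}ax0 : 0 < a x by rewrite lt_neqAle eq_sym ax0 a0.
have {}gx0 : 0 < g x by rewrite lt_neqAle eq_sym gx0 g0.
set v := g x * a x `^ (1 - t); have v0 : 0 < v by rewrite mulr_gt0 ?powR_gt0.
apply: (@le_trans _ _ (\sum_(m <- ms) 2 * B `^ (rho - 1) * g x `^ s *
   Num.min (2 `^ (dd / s * m%:~R) * v) (2 `^ (dd / s * m%:~R) * v)^-1 `^ e)).
  apply: ler_sum => m _; rewrite /carleson_bump -/v.
  set z := 2 `^ (dd / s * m%:~R) * v.
  have z0 : 0 < z by rewrite mulr_gt0 ?powR_gt0.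
  have zE : (2 `^ m%:~R) `^ (dd / s) * v = z.
    by rewrite /z -powRrM [m%:~R * _]mulrC.
  rewrite -[2 * A * _ * v]mulrA zE.
  have E1 : (2 `^ m%:~R) `^ (- (dd / t)) * (a x * g x) = g x `^ s * z `^ (1 - s).
    apply: ln_inj_pos; rewrite ?mulr_gt0 ?powR_gt0//.
    rewrite /z /v !lnM ?posrE ?mulr_gt0 ?powR_gt0// !ln_powR !lnM ?posrE ?mulr_gt0 ?powR_gt0// !ln_powR.
    rewrite (conjugate_gt0 s1 st); field.
    by apply/andP; split; rewrite ?subr_eq0 gt_eqF.
  rewrite -[2 * _ * _]mulrA E1 -!mulrA ler_pM2l// [leRHS]mulrCA ler_wpM2l ?powR_ge0//.
  have M : Num.min (A `^ t^-1) (2 * (A * z)) <= B * Num.min 1 z.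
    have [z1|z1] := leP z 1.
      by rewrite ge_min mulrA ler_wpM2r ?(ltW z0)// ?orbT// /B le_max lexx orbT.
    by rewrite mulr1 ge_min /B le_max lexx.
  have Z : z `^ (1 - s) * Num.min 1 z `^ (rho - 1) <= Num.min z z^-1 `^ e.
    have [z1|z1] := leP z 1.
      rewrite min_l; last by rewrite (le_trans z1)// invf_ge1.
      rewrite -powRD; last by rewrite (gt_eqF z0) implybT.
      apply: ger_powR; first by rewrite z0 z1.
      have -> : 1 - s + (rho - 1) = rho - s by ring.
      by rewrite /e ge_min lexx orbT.
    rewrite powR1 mulr1 min_r; last by rewrite (le_trans _ (ltW z1))// invf_le1// ltW.
    rewrite -powR_inv1 ?(ltW z0)// -powRrM ler_powR ?(ltW z1)//.
    by rewrite mulN1r lerNr opprB /e ge_min lexx.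
  apply: le_trans (ler_wpM2l (powR_ge0 _ _) Z).
  rewrite [leRHS]mulrCA ler_wpM2l ?powR_ge0// -powRM ?le_min ?ler01 ?(ltW B0) ?(ltW z0)//.
  apply: le_powRl => //; first lra.
  by rewrite le_min powR_ge0 (mulr_ge0 (ler0n _ 2) (mulr_ge0 (ltW A0) (ltW z0))).
by rewrite -mulr_sumr [leRHS]mulrAC ler_wpM2l ?HC// !mulr_ge0 ?powR_ge0.
Qed.

Section carleson.
Variables (J : eqType) (S : J -> set T) (k : J -> int) (N : nat).
Hypothesis mS : forall j, measurable (S j).
Hypothesis overlap : forall (x : T) (m : int) (js : seq J), uniq js ->
  (count (fun j => (k j == m) && (x \in S j)) js <= N)%N.
Let r j : R := 2 `^ (k j)%:~R.

Lemma sum_scales_le (js : seq J) (x : T) (F : int -> R) : uniq js ->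
  (forall m, 0 <= F m) ->
  \sum_(j <- js | x \in S j) F (k j) <= N%:R * \sum_(m <- undup (map k js)) F m.
Proof.
move=> ujs F0; rewrite mulr_sumr.
have -> : \sum_(j <- js | x \in S j) F (k j) =
    \sum_(m <- undup (map k js)) \sum_(j <- js | (k j == m) && (x \in S j)) F m.
  rewrite (exchange_big_dep (fun j => x \in S j)) /=; last by move=> ? ? _ /andP[].
  rewrite big_seq_cond [RHS]big_seq_cond; apply: eq_bigr => j /andP[jjs xS].
  under eq_bigl => m do rewrite xS andbT eq_sym.
  rewrite -big_filter filter_pred1_uniq ?undup_uniq ?big_seq1 //.
  by rewrite mem_undup; apply: map_f.
apply: ler_sum => m _.
rewrite big_const_seq iter_addr_0 -[leLHS]mulr_natl ler_wpM2r// ler_nat.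
exact: overlap.
Qed.

(** The embedding on which the boundedness rests.  Let [r j = 2 ^ k j] be the
    scale of [S j].  A term [X j] below is bounded by splitting [g] at the
    height [theta * a ^ (t - 1)], with [theta] proportional to [X j] itself: the
    low part contributes at most half of [X j], so [X j] is controlled by the
    high part, on which [X j] is also bounded pointwise. Since [rho > s] the sum
    over the scales is geometric on both sides of the critical scale. *)
Theorem sum_carleson (a : T -> R) (s t dd A rho : R) :
  (forall x, 0 <= a x) -> measurable_fun setT a ->
  1 < s -> s^-1 + t^-1 = 1 -> s < rho -> 0 < dd -> 0 < A ->
  (forall j, (\int[mu]_(x in S j) (a x `^ t)%:E <= (A * r j `^ dd)%:E)%E) ->
  exists2 C : R, 0 < C & forall (g : T -> R) (js : seq J),
    (forall x, 0 <= g x) -> measurable_fun setT g ->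
    (\int[mu]_x (g x `^ s)%:E <= 1)%E -> uniq js ->
    (forall j, (\int[mu]_(x in S j) (a x * g x)%:E < +oo)%E) /\
    \sum_(j <- js) (r j `^ (- (dd / t)) *
       fine (\int[mu]_(x in S j) (a x * g x)%:E)) `^ rho <= C.
Proof.
move=> a0 ma s1 st srho dd0 A0 aS.
have s0 : 0 < s by lra.
have t0 : 0 < t by rewrite (conjugate_gt0 s1 st) divr_gt0// subr_gt0.
have [C C0 HC] := sum_carleson_bump s1 st srho dd0 A0.
exists (N%:R * C + 1) => [|g js g0 mg g1 ujs]; first by rewrite ltr_wpDl// mulr_ge0// ltW.
pose Phi j x := carleson_bump a g s t dd A rho (r j) x.
have r0 j : 0 < r j by rewrite powR_gt0.
have mPhi j : measurable_fun setT (Phi j).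
  have mag : measurable_fun setT (fun x => a x * g x) by exact: measurable_funM.
  apply: measurable_funM; first by apply: measurable_funM => //; exact: measurable_cst.
  apply: measurable_powRf; apply: measurable_minr; first exact: measurable_cst.
  apply: measurable_funM; first exact: measurable_cst.
  by apply: measurable_funM => //; exact: measurable_powRf.
have Phi0 j x : 0 <= Phi j x by rewrite !mulr_ge0 ?powR_ge0.
have mag : measurable_fun setT (fun x => a x * g x) by exact: measurable_funM.
have ag0 x : 0 <= a x * g x by rewrite mulr_ge0.
have X1 j : (\int[mu]_(x in S j) (a x * g x)%:E <= (A `^ t^-1 * r j `^ (dd / t))%:E)%E.
  have ts : t^-1 + s^-1 = 1 by rewrite addrC.
  have := holder_integral (mS j) ma mg a0 g0 t0 s0 ts; move/le_trans; apply.
  have h1 : ((\int[mu]_(x in S j) (a x `^ t)%:E) `^ t^-1 <= ((A * r j `^ dd) `^ t^-1)%:E)%E.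
    rewrite -poweR_EFin gt0_ler_poweR ?invr_ge0 ?(ltW t0)// ?in_itv/= ?leey ?andbT ?lee_fin ?mulr_ge0 ?powR_ge0 ?(ltW A0)//.
    by apply: integral_ge0 => x _; rewrite lee_fin powR_ge0.
  have h2 : ((\int[mu]_(x in S j) (g x `^ s)%:E) `^ s^-1 <= 1)%E.
    rewrite -[leRHS](@poweR1r _ s^-1) gt0_ler_poweR ?invr_ge0 ?(ltW s0)// ?in_itv/= ?leey ?andbT ?lee01//.
      by apply: integral_ge0 => x _; rewrite lee_fin powR_ge0.
    apply: le_trans g1; apply: ge0_subset_integral => //.
    by apply: measurable_EFinS; exact: measurable_powRf.
    by move=> x _; rewrite lee_fin powR_ge0.
  rewrite [dd / t]mulrC [t^-1 * dd]mulrC powRrM -powRM ?powR_ge0 ?(ltW A0)//.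
  by rewrite -[leRHS]mule1 lee_pmul// ?poweR_ge0.
have fI j : (\int[mu]_(x in S j) (a x * g x)%:E \is a fin_num)%E.
  rewrite ge0_fin_numE; first by apply: le_lt_trans (X1 j) _; rewrite ltry.
  by apply: integral_ge0 => x _; rewrite lee_fin.
have X2 j : (((r j `^ (- (dd / t)) *
       fine (\int[mu]_(x in S j) (a x * g x)%:E)) `^ rho)%:E <= \int[mu]_(x in S j) (Phi j x)%:E)%E.
  set I := fine _; set X := _ * I.
  have I0 : 0 <= I by rewrite fine_ge0// integral_ge0// => x _; rewrite lee_fin.
  have IE : (\int[mu]_(x in S j) (a x * g x)%:E = I%:E)%E by rewrite fineK.
  have XA : X <= A `^ t^-1.
    rewrite /X powRN mulrC ler_pdivrMr ?powR_gt0// -lee_fin -IE.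
    exact: X1.
  have [X0|X0] := eqVneq X 0.
    rewrite X0 powR0; last by rewrite gt_eqF//; lra.
    by apply: integral_ge0 => x _; rewrite lee_fin.
  have {}X0 : 0 < X by rewrite lt_neqAle eq_sym X0 mulr_ge0 ?powR_ge0.
  (* At this height the low part is at most half of the integral. *)
  pose th := X * r j `^ (- (dd / s)) / (2 * A).
  have th0 : 0 < th by rewrite /th divr_gt0// mulr_gt0 ?powR_gt0.
  pose c := 2 * X `^ (rho - 1) * r j `^ (- (dd / t)).
  have c0 : 0 < c by rewrite !mulr_gt0 ?powR_gt0.
  have pt x : c * (a x * g x) <= c * th * a x `^ t + Phi j x.
    have [ax0|ax0] := eqVneq (a x) 0.
      rewrite {1}ax0 mul0r mulr0 addr_ge0//; apply: mulr_ge0; rewrite ?powR_ge0//.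
      by apply: mulr_ge0; exact: ltW.
    have {}ax0 : 0 < a x by rewrite lt_neqAle eq_sym ax0 a0.
    have [gth|gth] := leP (g x) (th * a x `^ (t - 1)).
      rewrite -[leLHS]addr0 lerD// -mulrA ler_pM2l//.
      have -> : th * a x `^ t = a x * (th * a x `^ (t - 1)).
        by rewrite mulrCA mulr_powRB1 ?(ltW ax0).
      by rewrite ler_pM2l.
    rewrite -[leLHS]add0r; apply: lerD; first by rewrite mulr_ge0 ?powR_ge0// (mulr_ge0 (ltW c0) (ltW th0)).
    have -> : c * (a x * g x) = 2 * r j `^ (- (dd / t)) * (a x * g x) * X `^ (rho - 1).
      by rewrite /c; ring.
    rewrite ler_wpM2l ?mulr_ge0 ?powR_ge0//.
    have XB : X <= 2 * A * r j `^ (dd / s) * (g x * a x `^ (1 - t)).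
      have -> : X = 2 * A * r j `^ (dd / s) * th.
        rewrite /th powRN; field.
        by apply/andP; split; rewrite gt_eqF ?powR_gt0.
      rewrite ler_pM2l ?mulr_gt0 ?powR_gt0//.
      rewrite -opprB powRN ler_pdivlMr ?powR_gt0//; exact: ltW.
    by apply: le_powRl; [lra|exact: ltW|rewrite le_min XA XB].
  have cI : (\int[mu]_(x in S j) (c * (a x * g x))%:E = (c * I)%:E)%E.
    by rewrite integralZ_EFin ?(ltW c0)// IE.
  have mat : measurable_fun setT (fun x => a x `^ t) by exact: measurable_powRf.
  have H : ((c * I)%:E <= (c * I / 2)%:E + \int[mu]_(x in S j) (Phi j x)%:E)%E.
    rewrite -cI; apply: (@le_trans _ _ (\int[mu]_(x in S j) (c * th * a x `^ t + Phi j x)%:E)%E).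
      apply: le_integral_EFin => //.
      - exact: measurable_funM.
      - by apply: measurable_funD => //; exact: measurable_funM.
      - by move=> x _; rewrite mulr_ge0// ltW.
    have cth := mulr_ge0 (ltW c0) (ltW th0).
    rewrite integralD_EFin_ge0//; last 2 first.
    - exact: measurable_funM.
    - by move=> x; rewrite mulr_ge0 ?powR_ge0.
    rewrite leeD2r// integralZ_EFin//; last by move=> x; rewrite powR_ge0.
    apply: (le_trans (lee_wpmul2l _ (aS j))); first by rewrite lee_fin.
    rewrite -EFinM lee_fin le_eqVlt; apply/orP; left; apply/eqP.
    have -> : I = X * r j `^ (dd / t) by rewrite /X powRN; field; rewrite gt_eqF ?powR_gt0.
    rewrite /th; have -> : r j `^ (dd / t) = r j `^ (- (dd / s)) * r j `^ dd.
      rewrite -powRD; last by rewrite (gt_eqF (r0 j)) implybT.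
      have -> : t^-1 = 1 - s^-1 by lra.
      by congr (_ `^ _); ring.
    by field; rewrite gt_eqF.
  have -> : X `^ rho = c * I - c * I / 2.
    have -> : c * I - c * I / 2 = X `^ (rho - 1) * (r j `^ (- (dd / t)) * I) by rewrite /c; field.
    by rewrite -/X mulrC mulr_powRB1 ?ltW//; lra.
  by rewrite EFinB leeBlDl// -?EFinD.
split=> [j|]; first by apply: le_lt_trans (X1 j) _; rewrite ltry.
rewrite -lee_fin -sumEFin.
apply: (le_trans (lee_sum _ (fun j _ => X2 j))).
under eq_bigr do rewrite integral_mkcond.
rewrite -ge0_integral_sum//; last 2 first.
- by move=> j; apply/(measurable_restrictT _ (mS j)); exact: measurable_EFinS.
- by move=> j x _; rewrite patchE; case: ifP => //; rewrite lee_fin.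
apply: (@le_trans _ _ (\int[mu]_x ((N%:R * C)%:E * (g x `^ s)%:E))%E).
  apply: ge0_le_integral => //.
  - move=> x _; apply: sume_ge0 => j _; rewrite patchE; case: ifP => //; rewrite lee_fin//.
  - apply: emeasurable_sum => j; apply/(measurable_restrictT _ (mS j)); exact: measurable_EFinS.
  - by apply: emeasurable_funM => //; apply: measurable_EFinS; exact: measurable_powRf.
  move=> x _; have -> : (\sum_(j <- js) ((fun x => (Phi j x)%:E) \_ (S j)) x =
     (\sum_(j <- js | x \in S j) Phi j x)%:E)%E.
    rewrite -sumEFin [RHS]big_mkcond; apply: eq_bigr => j _.
    by rewrite patchE; case: ifP.
  rewrite -EFinM lee_fin -mulrA.
  apply: (le_trans (@sum_scales_le js x (fun m => carleson_bump a g s t dd A rho (2 `^ m%:~R) x) ujs _)).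
    by move=> m; rewrite !mulr_ge0 ?powR_ge0.
  by rewrite ler_wpM2l// HC// undup_uniq.
have gs : measurable_fun setT (fun x => (g x `^ s)%:E).
  by apply: measurable_EFinS; exact: measurable_powRf.
rewrite ge0_integralZl//; last 2 first.
- by move=> x _; rewrite lee_fin powR_ge0.
- by rewrite lee_fin mulr_ge0// ltW.
apply: (@le_trans _ _ ((N%:R * C)%:E * 1)%E); last by rewrite mule1 lee_fin lerDl.
by rewrite lee_wpmul2l// lee_fin mulr_ge0// ltW.
Qed.

End carleson.
End integrals.

(** * The converse of Hoelder's inequality *)

Section converse_holder.
Context d (T : measurableType d) (R : realType).
Variable mu : {measure set T -> \bar R}.

(** Bounded truncations of finite support are their own extremal test
    functions; they increase to [H]. *)
Lemma converse_holder (H : T -> \bar R) (s q C : R) :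
  sigma_finite setT mu ->
  measurable_fun setT H -> (forall x, 0 <= H x)%E -> 1 < q -> q^-1 + s^-1 = 1 -> 0 <= C ->
  (forall g : T -> R, measurable_fun setT g -> (forall x, 0 <= g x) ->
     (\int[mu]_x (g x `^ s)%:E <= 1)%E -> (\int[mu]_x (H x * (g x)%:E) <= C%:E)%E) ->
  (\int[mu]_x (H x `^ q) <= (C `^ q)%:E)%E.
Proof.
move=> mu_sigma mH H0 q1 qs C0 HC.
have q0 : 0 < q by lra.
have sE := conjugate_gt0 q1 qs.
have s0 : 0 < s by rewrite sE divr_gt0// subr_gt0.
have /sigma_finiteP [F [F_T F_nd F_oo]] := mu_sigma.
have mF n : measurable (F n) by case: (F_oo n).
pose h n x : R := fine (mine (H x) n%:R%:E) * \1_(F n) x.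
have fm n x : (mine (H x) n%:R%:E \is a fin_num)%E.
  rewrite ge0_fin_numE; first by rewrite (@le_lt_trans _ _ n%:R%:E) ?ltry// ge_min lexx orbT.
  by rewrite le_min H0 lee_fin ler0n.
have h0 n x : 0 <= h n x.
  by rewrite mulr_ge0// fine_ge0// le_min H0 lee_fin ler0n.
have hn n x : h n x <= n%:R * \1_(F n) x.
  rewrite ler_wpM2r// -lee_fin fineK//.
  by rewrite ge_min lexx orbT.
have hH n x : ((h n x)%:E <= H x)%E.
  rewrite /h indicE; case: (x \in F n); last by rewrite mulr0.
  by rewrite mulr1 fineK// ge_min lexx.
have mh n : measurable_fun setT (h n).
  apply: measurable_funM => //; apply: measurableT_comp => //.
  by apply: measurable_mine => //; exact: measurable_cst.
have mhq n (p : R) : measurable_fun setT (fun x => h n x `^ p) by exact: measurable_powRf.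
have finq n : (\int[mu]_x (h n x `^ q)%:E < +oo)%E.
  apply: (@le_lt_trans _ _ (\int[mu]_x (n%:R `^ q * \1_(F n) x)%:E)%E).
    apply: le_integral_EFin => //.
    - by apply: measurable_funM => //; exact: measurable_cst.
    - by move=> x _; rewrite powR_ge0.
    move=> x _; apply: (@le_trans _ _ ((n%:R * \1_(F n) x) `^ q)).
      by apply: le_powRl => //; exact: ltW.
    rewrite powRM// ler_wpM2l ?powR_ge0// indicE; case: (x \in F n); first by rewrite powR1.
    by rewrite powR0// gt_eqF.
  rewrite integralZ_EFin ?powR_ge0//.
  rewrite integral_indic// setIT lte_mul_pinfty ?lee_fin ?powR_ge0//.
  by case: (F_oo n).
have key n : (\int[mu]_x (h n x `^ q)%:E <= (C `^ q)%:E)%E.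
  have m0 : (0 <= \int[mu]_x (h n x `^ q)%:E)%E.
    by apply: integral_ge0 => x _; rewrite lee_fin powR_ge0.
  have mfin : (\int[mu]_x (h n x `^ q)%:E \is a fin_num)%E by rewrite ge0_fin_numE.
  rewrite -(fineK mfin) lee_fin; set m := fine _.
  have mE : (\int[mu]_x (h n x `^ q)%:E = m%:E)%E by rewrite fineK.
  have [->|mn0] := eqVneq m 0; first by rewrite powR_ge0.
  have {mn0}m0' : 0 < m by rewrite lt_neqAle eq_sym mn0 fine_ge0.
  pose g x := m `^ (- s^-1) * h n x `^ (q - 1).
  have g1 : (\int[mu]_x (g x `^ s)%:E <= 1)%E.
    have -> : (fun x => (g x `^ s)%:E) = (fun x => (m^-1 * h n x `^ q)%:E).
      apply/funext => x; congr EFin; rewrite /g powRM ?powR_ge0// -!powRrM.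
      congr (_ * _); first by rewrite mulNr mulVf ?gt_eqF// powR_inv1// ltW.
      by rewrite sE mulrCA divff ?mulr1// subr_eq0 gt_eqF.
    rewrite integralZ_EFin//; last 2 first.
    - by move=> x; rewrite powR_ge0.
    - by rewrite invr_ge0 ltW.
    by rewrite mE -EFinM mulVf ?gt_eqF.
  have mg : measurable_fun setT g by apply: measurable_funM => //; exact: measurable_cst.
  have := HC g mg (fun x => mulr_ge0 (powR_ge0 _ _) (powR_ge0 _ _)) g1.
  have : (\int[mu]_x (m `^ (- s^-1) * h n x `^ q)%:E <= \int[mu]_x (H x * (g x)%:E))%E.
    apply: ge0_le_integral => //.
    - by move=> x _; rewrite lee_fin mulr_ge0 ?powR_ge0.
    - by apply: measurable_EFinS; apply: measurable_funM => //; exact: measurable_cst.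
    - by apply: emeasurable_funM => //; exact: measurable_EFinS.
    move=> x _; rewrite -(mulr_powRB1 (h0 n x) q0) mulrCA EFinM lee_wpmul2r//.
    by rewrite lee_fin mulr_ge0 ?powR_ge0.
  move=> /le_trans /[apply].
  rewrite integralZ_EFin ?powR_ge0//; last by move=> x; rewrite powR_ge0.
  rewrite mE -EFinM lee_fin => hC.
  have : m `^ q^-1 <= C.
    apply: le_trans hC; rewrite -{3}(powRr1 (ltW m0')) -powRD; last by rewrite (gt_eqF m0') implybT.
    by have -> : - s^-1 + 1 = q^-1 by lra.
  move=> /(le_powRl (ltW q0) (powR_ge0 _ _)).
  by rewrite -powRrM mulVf ?gt_eqF// powRr1// ltW.
have cvgh x : ((h n x `^ q)%:E @[n --> \oo] --> H x `^ q)%E.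
  have [N _ xN] : (\bigcup_n F n) x by rewrite -F_T.
  have xF n : (N <= n)%N -> \1_(F n) x = 1 :> R.
    by move=> Nn; rewrite indicE mem_set//; move/subsetPset: (F_nd _ _ Nn); apply.
  move: (H0 x); case E : (H x) => [y| |] //; rewrite ?lee_fin => y0.
    apply: cvg_near_cst; near=> n.
    rewrite /h E xF; last by near: n; exact: nbhs_infty_ge.
    rewrite mulr1 /mine; case: ifPn => [_ //|]; rewrite lte_fin -leNgt => ny.
    congr (_ `^ _)%:E; apply/eqP; rewrite eq_le ny /=.
    by near: n; exact: nbhs_infty_ger.
  rewrite poweRyr ?gt_eqF//; apply/cvgeyPge => A; near=> n.
  rewrite /h E xF; last by near: n; exact: nbhs_infty_ge.
  rewrite mulr1 /mine ltNge leey /= lee_fin.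
  have [A0|A0] := leP A 0; first by rewrite (le_trans A0)// powR_ge0.
  rewrite -(@powRr1 _ A) ?(ltW A0)// -{1}(@mulVf _ q) ?gt_eqF// powRrM.
  apply: le_powRl; rewrite ?powR_ge0 ?(ltW q0)//.
  by near: n; exact: nbhs_infty_ger.
have ndh x : nondecreasing_seq (fun n => (h n x `^ q)%:E).
  move=> n n' nn'; rewrite lee_fin; apply: le_powRl => //; first exact: ltW.
  apply: ler_pM => //.
  - by rewrite fine_ge0// le_min H0 lee_fin ler0n.
  - rewrite -lee_fin !fineK// le_min ge_min lexx /= ge_min; apply/orP; right.
    by rewrite lee_fin ler_nat.
  rewrite !indicE ler_nat; move/subsetPset: (F_nd _ _ nn') => FF.
  by case: (boolP (x \in F n)) => //; rewrite inE => /FF /mem_set ->.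
have -> : (\int[mu]_x (H x `^ q) = limn (fun n => \int[mu]_x (h n x `^ q)%:E))%E.
  rewrite -monotone_convergence//.
  - by apply: eq_integral => x _; apply/esym/cvg_lim => //; exact: cvgh.
  - by move=> n; exact: measurable_EFinS.
  - by move=> n x _; rewrite lee_fin powR_ge0.
apply: lime_le; last by apply: nearW => n; exact: key.
apply: ereal_nondecreasing_is_cvgn => n n' nn'.
apply: le_integral_EFin => //.
- by move=> x _; rewrite powR_ge0.
- by move=> x _; rewrite -lee_fin; exact: ndh.
Unshelve. all: by end_near. Qed.

End converse_holder.

(** * Dyadic squares and the pairing conditions *)

Section plane_basics.
Variable R : realType.
Implicit Types (x z w : plane R) (r : R).

Lemma squareE x r : square x r = `[(x.1 : R) - r, (x.1 : R) + r]%classic `*`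
  `[(x.2 : R) - r, (x.2 : R) + r]%classic.
Proof.
by apply/seteqP; split=> y; rewrite /square /= !in_itv /= !ler_distl => -[-> ->].
Qed.

Lemma measurable_square x r : measurable (square x r).
Proof. by rewrite squareE; apply: measurableX; exact: measurable_itv. Qed.

Lemma area_sigma_finite : sigma_finite setT (@area R).
Proof.
exists (fun n : nat => square (0, 0) n.+1%:R).
  apply/esym; rewrite -subTset => -[x y] _.
  have [n _ [hx hy]] : exists2 n : nat, True & `|x| <= n.+1%:R /\ `|y| <= n.+1%:R.
    exists (Num.truncn (Num.max `|x| `|y|)) => //.
    have := truncnS_gt (Num.max `|x| `|y|); rewrite gt_max => /andP[h1 h2].
    by split; exact: ltW.
  by exists n => //; rewrite /square /= !subr0.
by move=> n; split; [exact: measurable_square|rewrite area_square// ltry].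
Qed.

Lemma cabs_ge0 (u : R[i]) : 0 <= cabs u.
Proof. by case: u => a b; exact: sqrtr_ge0. Qed.

Lemma cabs_ge_Re (u : R[i]) : `|complex.Re u| <= cabs u.
Proof. by case: u => a b /=; rewrite -sqrtr_sqr ler_wsqrtr// lerDl sqr_ge0. Qed.

Lemma cabs_ge_Im (u : R[i]) : `|complex.Im u| <= cabs u.
Proof. by case: u => a b /=; rewrite -sqrtr_sqr ler_wsqrtr// lerDr sqr_ge0. Qed.

Lemma cabs_le_ReIm (u : R[i]) : cabs u <= `|complex.Re u| + `|complex.Im u|.
Proof.
case: u => a b /=; rewrite -(ger0_norm (addr_ge0 (normr_ge0 a) (normr_ge0 b))).
rewrite -sqrtr_sqr ler_wsqrtr// sqrrD !real_normK ?num_real// lerD2r lerDl.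
by rewrite mulrn_wge0// mulr_ge0.
Qed.

(** The squares of half-side [2 ^ k] are centred on the lattice of mesh [2 ^ k], so
    that they overlap: any two points share a square of size comparable to their
    distance, which fails for a nested dyadic grid. *)
Definition dyadic_index := (int * (int * int))%type.
Definition dyadic_scale (j : dyadic_index) : R := 2 `^ (j.1)%:~R.
Definition dyadic_center (j : dyadic_index) : plane R :=
  (dyadic_scale j * (j.2.1)%:~R, dyadic_scale j * (j.2.2)%:~R).
Definition dyadic_square (j : dyadic_index) : set (plane R) := square (dyadic_center j) (dyadic_scale j).

Lemma dyadic_scale_gt0 j : 0 < dyadic_scale j.
Proof. by rewrite powR_gt0. Qed.

Lemma measurable_dyadic_square j : measurable (dyadic_square j).
Proof. exact: measurable_square. Qed.

Lemma area_dyadic_square j : area (dyadic_square j) = (4 * dyadic_scale j `^ 2)%:E.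
Proof.
rewrite area_square ?dyadic_scale_gt0// exprMn -natrX.
by rewrite powR_mulrn// ltW// dyadic_scale_gt0.
Qed.

Lemma dyadic_square_overlap (z : plane R) (m : int) (js : seq dyadic_index) : uniq js ->
  (count (fun j => (j.1 == m) && (z \in dyadic_square j)) js <= 9)%N.
Proof.
move=> ujs; rewrite -size_filter.
pose f (u : R) : int := Num.floor (u / 2 `^ m%:~R).
pose l (u : R) := [:: f u - 1; f u; f u + 1].
pose L := [seq (m, (a, b)) | a <- l z.1, b <- l z.2].
have -> : 9%N = size L by rewrite size_allpairs.
apply: uniq_leq_size; first by rewrite filter_uniq.
have near (u : R) (a : int) : `|u - 2 `^ m%:~R * a%:~R| <= 2 `^ m%:~R -> a \in l u.
  have s0 : (0 : R) < 2 `^ m%:~R by rewrite powR_gt0.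
  have -> : u - 2 `^ m%:~R * a%:~R = 2 `^ m%:~R * (u / 2 `^ m%:~R - a%:~R).
    by rewrite mulrBr mulrCA divff ?mulr1// gt_eqF.
  rewrite normrM gtr0_norm// -[leRHS]mulr1 ler_pM2l// ler_norml => /andP[h1 h2].
  have f1 : (f u)%:~R <= u / 2 `^ m%:~R by exact: ge_floor.
  have f2 : u / 2 `^ m%:~R < (f u)%:~R + 1 by have := floorD1_gt (u / 2 `^ m%:~R); rewrite intrD.
  have a1 : (a%:~R : R) < (f u + 2)%:~R by rewrite intrD; lra.
  have a2 : ((f u - 2)%:~R : R) < a%:~R by rewrite intrB; lra.
  move: a1 a2; rewrite !ltr_int => a1 a2.
  rewrite !inE; lia.
move=> [k [a b]]; rewrite mem_filter /= => /andP[/andP[/eqP -> zS] _].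
move: zS; rewrite inE /dyadic_square /square /dyadic_center /dyadic_scale /= => -[h1 h2].
by apply/allpairsP; exists (a, b); split=> //=; apply: near.
Qed.

Lemma dyadic_square_cover (z w : plane R) : z <> w ->
  exists j, [/\ dyadic_square j z, dyadic_square j w & (cabs (pt z - pt w))^-1 <= 4 / dyadic_scale j].
Proof.
move=> zw; pose D : R := Num.max `|(z.1 : R) - w.1| `|(z.2 : R) - w.2|.
have D0 : 0 < D.
  rewrite lt_max !normr_gt0 !subr_eq0; apply/orP.
  have [e1|e1] := eqVneq (z.1 : R) w.1; [right|by left].
  apply/eqP => e2; apply: zw; case: z w e1 e2 {D} => z1 z2 [w1 w2] /= -> ->//.
pose k : int := Num.ceil (ln D / ln 2) + 1.
have l2 : 0 < ln (2 : R) by rewrite ln_gt0// ltr1n.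
have Dk : D <= 2 `^ (k - 1)%:~R.
  rewrite -[leLHS]lnK ?posrE// powR_ln// ler_expR -ler_pdivrMr//.
  by rewrite /k addrK; exact: ceil_ge.
have kD : 2 `^ (k - 2)%:~R < D.
  rewrite -[ltRHS]lnK ?posrE// powR_ln// ltr_expR -ltr_pdivlMr//.
  have -> : k - 2 = Num.ceil (ln D / ln 2) - 1 by rewrite /k -addrA; congr (_ + _).
  exact: ceilB1_lt.
pose s : R := 2 `^ k%:~R.
have s0 : 0 < s by rewrite powR_gt0.
have s1 : 2 `^ (k - 1)%:~R = s / 2.
  by rewrite intrB powRB ?pnatr_eq0 ?implybT// powRr1.
have s2 : 2 `^ (k - 2)%:~R = s / 4.
  rewrite intrB powRB ?pnatr_eq0 ?implybT// (_ : 2%:~R = 2%:R)// powR_mulrn//.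
  by rewrite -natrX.
pose rd (u : R) : int := Num.floor (u / s + 2^-1).
have rdP (u : R) : `|u - s * (rd u)%:~R| <= s / 2.
  have -> : u - s * (rd u)%:~R = s * (u / s - (rd u)%:~R).
    by rewrite mulrBr mulrCA divff ?mulr1// gt_eqF.
  rewrite normrM gtr0_norm// ler_pM2l// ler_norml.
  have := ge_floor (u / s + 2^-1); have := floorD1_gt (u / s + 2^-1).
  rewrite intrD -/(rd u) => h1 h2; apply/andP; split; lra.
exists (k, (rd z.1, rd z.2)); rewrite /dyadic_square /square /dyadic_center /dyadic_scale /= -/s; split.
- by split; apply: (le_trans (rdP _)); rewrite ler_pdivrMr// ler_peMr// ?ltW// ltr1n.
- split.
    have -> : w.1 - s * (rd z.1)%:~R = (z.1 - s * (rd z.1)%:~R) - (z.1 - w.1) :> R by ring.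
    apply: (le_trans (ler_normB _ _)); rewrite [leRHS]splitr lerD ?rdP// -s1.
    by apply: le_trans Dk; rewrite le_max lexx.
  have -> : w.2 - s * (rd z.2)%:~R = (z.2 - s * (rd z.2)%:~R) - (z.2 - w.2) :> R by ring.
  apply: (le_trans (ler_normB _ _)); rewrite [leRHS]splitr lerD ?rdP// -s1.
  by apply: le_trans Dk; rewrite le_max lexx orbT.
have zwD : D <= cabs (pt z - pt w).
  rewrite ge_max; have := cabs_ge_Re (pt z - pt w); have := cabs_ge_Im (pt z - pt w).
  by rewrite /pt; case: z w {zw D D0 k Dk kD s s0 s1 s2 rd rdP} => ? ? [? ?] /= -> ->.
have -> : 4 / s = (s / 4)^-1 by rewrite invf_div.
rewrite lef_pV2 ?posrE//; last 2 first.
- exact: lt_le_trans zwD.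
- by rewrite divr_gt0.
by apply: le_trans zwD; rewrite -s2 ltW.
Qed.

(** The bilinear form, tested on unit balls, of the positive operator whose kernel
    is the sum over [j] of [A j z / dyadic_scale j] for both points in
    [dyadic_square j]. Half of the commutator is dominated by such an operator, and
    the other half by the transpose of one. *)
Definition dyadic_pairing (A : dyadic_index -> plane R -> R) (p s : R) : Prop :=
  exists2 C : R, 0 < C & forall (f g : plane R -> R) (js : seq dyadic_index),
    measurable_fun setT f -> measurable_fun setT g ->
    (forall z, 0 <= f z) -> (forall z, 0 <= g z) ->
    (\int[area]_z (f z `^ p)%:E <= 1)%E -> (\int[area]_z (g z `^ s)%:E <= 1)%E ->
    uniq js ->
    (\sum_(j <- js) (dyadic_scale j)^-1%:E *
      ((\int[area]_(z in dyadic_square j) (A j z * g z)%:E) *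
       (\int[area]_(z in dyadic_square j) (f z)%:E)) <= C%:E)%E.

Lemma sum_young (J : Type) (js : seq J) (X Y : J -> R) (a b C1 C2 : R) :
  (forall j, 0 <= X j) -> (forall j, 0 <= Y j) -> 1 < a -> 1 < b -> a^-1 + b^-1 = 1 ->
  \sum_(j <- js) X j `^ a <= C1 -> \sum_(j <- js) Y j `^ b <= C2 ->
  \sum_(j <- js) X j * Y j <= C1 + C2.
Proof.
move=> X0 Y0 a1 b1 ab HX HY.
apply: (@le_trans _ _ (\sum_(j <- js) (X j `^ a + Y j `^ b))); last first.
  by rewrite big_split lerD.
apply: ler_sum => j _.
have a0 : 0 < a by lra.
have b0 : 0 < b by lra.
apply: (le_trans (conjugate_powR (X0 j) (Y0 j) a0 b0 ab)); apply: lerD.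
  by rewrite ler_pdivrMr// ler_peMr ?powR_ge0// ltW.
by rewrite ler_pdivrMr// ler_peMr ?powR_ge0// ltW.
Qed.

Let one : plane R -> R := cst 1.

Lemma int_one_powR (t : R) j :
  (\int[area]_(z in dyadic_square j) (one z `^ t)%:E <= (4 * dyadic_scale j `^ 2)%:E)%E.
Proof.
under eq_integral do rewrite /one powR1.
by rewrite integral_cst ?mul1e ?area_dyadic_square//; exact: measurable_dyadic_square.
Qed.

(** As [p < q], the inverses of [s] and [p] add up to more than [1], which leaves
    room for conjugate exponents [rho > s] and [rho' > p]. *)
Lemma pairing_exponents (p q s : R) : 1 < p -> p < q -> q^-1 + s^-1 = 1 ->
  exists p' rho rho' : R, [/\ p^-1 + p'^-1 = 1, 1 < s, rho^-1 + rho'^-1 = 1,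
    1 < rho /\ 1 < rho' & s < rho /\ p < rho'].
Proof.
move=> p1 pq qs; pose p' := (1 - p^-1)^-1.
have p0 : 0 < p by lra.
have q0 : 0 < q by lra.
have q1 : 1 < q by lra.
have pp : p^-1 + p'^-1 = 1 by rewrite /p' invrK; lra.
have sE := conjugate_gt0 q1 qs.
have s1 : 1 < s by rewrite sE ltr_pdivlMr ?mul1r ?subr_gt0//; lra.
have s0 : 0 < s by lra.
have iqp : q^-1 < p^-1 by rewrite ltf_pV2.
have ip1 : p^-1 < 1 by rewrite invf_lt1.
have iq0 : 0 < q^-1 by rewrite invr_gt0.
have is0 : 0 < s^-1 by rewrite invr_gt0.
pose rho := 2 / (s^-1 + p'^-1); pose rho' := 2 / (q^-1 + p^-1).
have irho : rho^-1 = (s^-1 + p'^-1) / 2 by rewrite invf_div.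
have irho' : rho'^-1 = (q^-1 + p^-1) / 2 by rewrite invf_div.
have rho0 : 0 < rho by rewrite divr_gt0//; lra.
have rho'0 : 0 < rho' by rewrite divr_gt0//; lra.
have srho : s < rho by rewrite -ltf_pV2 ?posrE// irho; lra.
have prho : p < rho' by rewrite -ltf_pV2 ?posrE// irho'; lra.
exists p', rho, rho'; split=> //.
- by rewrite irho irho'; lra.
- by split; lra.
Qed.

(** Young's inequality with the exponents [rho] and [rho'] separates the two
    integrals, and [sum_carleson] bounds both sums, with the weight [a] against [g]
    and with the weight [1] against [f]. *)
Lemma dyadic_pairing_morrey (a : plane R -> R) (p q s A : R) :
  measurable_fun setT a -> (forall z, 0 <= a z) ->
  1 < p -> p < 2 -> p < q -> q^-1 + s^-1 = 1 -> 0 < A ->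
  (forall j, (\int[area]_(z in dyadic_square j) (a z `^ q)%:E <=
     (A * dyadic_scale j `^ (q * (2 / p - 1)))%:E)%E) ->
  dyadic_pairing (fun=> a) p s.
Proof.
move=> ma a0 p1 p2 pq qs A0 aS.
have [p' [rho [rho' [pp s1 rr [rho1 rho'1] [srho prho]]]]] := pairing_exponents p1 pq qs.
have p0 : 0 < p by lra.
have q0 : 0 < q by lra.
have dd0 : 0 < q * (2 / p - 1) by rewrite mulr_gt0// subr_gt0 ltr_pdivlMr// mul1r.
have sq : s^-1 + q^-1 = 1 by rewrite addrC.
have [C1 C10 H1] := sum_carleson measurable_dyadic_square dyadic_square_overlap a0 ma s1 sq srho dd0 A0 aS.
have [C2 C20 H2] := @sum_carleson _ _ _ (@area R) _ _ _ _ measurable_dyadic_square dyadic_square_overlap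
  one p p' 2 4 rho' (fun=> ler01) (measurable_cst _) p1 pp prho (ltr0n _ 2) (ltr0n _ 4) (int_one_powR p').
exists (C1 + C2) => [|f g js mf mg f0 g0 f1 g1 ujs]; first by rewrite addr_gt0.
have [fin1 S1] := H1 g js g0 mg g1 ujs.
have [fin2 S2] := H2 f js f0 mf f1 ujs.
pose X j := fine (\int[area]_(z in dyadic_square j) (a z * g z)%:E).
pose Y j := fine (\int[area]_(z in dyadic_square j) (one z * f z)%:E).
have X0 j : 0 <= X j.
  by rewrite fine_ge0// integral_ge0// => z _; rewrite lee_fin mulr_ge0.
have Y0 j : 0 <= Y j.
  by rewrite fine_ge0// integral_ge0// => z _; rewrite lee_fin mulr_ge0// ler01.
have XE j : (\int[area]_(z in dyadic_square j) (a z * g z)%:E = (X j)%:E)%E.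
  rewrite fineK// ge0_fin_numE ?fin1// integral_ge0// => z _; by rewrite lee_fin mulr_ge0.
have YE j : (\int[area]_(z in dyadic_square j) (f z)%:E = (Y j)%:E)%E.
  under eq_integral do rewrite -[f _]mul1r.
  rewrite fineK// ge0_fin_numE ?fin2// integral_ge0// => z _; by rewrite lee_fin mulr_ge0// ler01.
under eq_bigr do rewrite XE YE -!EFinM.
rewrite sumEFin lee_fin.
apply: le_trans (sum_young (X := fun j => dyadic_scale j `^ (- (q * (2 / p - 1) / q)) * X j)
  (Y := fun j => dyadic_scale j `^ (- (2 / p')) * Y j) _ _ _ _ rr S1 S2) => [|j|j||].
- rewrite le_eqVlt; apply/orP; left; apply/eqP; apply: eq_bigr => j _.
  rewrite mulrACA -powRD; last by rewrite (gt_eqF (dyadic_scale_gt0 j)) implybT.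
  have -> : - (q * (2 / p - 1) / q) - 2 / p' = -1.
    rewrite mulrAC divff ?gt_eqF// mul1r.
    have -> : p'^-1 = 1 - p^-1 by move: pp; clear; lra.
    ring.
  by rewrite powR_inv1// ltW// dyadic_scale_gt0.
- by rewrite mulr_ge0 ?powR_ge0.
- by rewrite mulr_ge0 ?powR_ge0.
- exact: rho1.
- exact: rho'1.
Qed.

(** A weight that changes with the square cannot be used in [sum_carleson]. It is
    removed by Hoelder's inequality with the exponent [sigma > q], which leaves the
    integral of a power [sig' < s] of [g]; the embedding with weight [1] then applies
    to [g ^ sig'] in [L^(s / sig')]. *)
Lemma dyadic_pairing_osc (a : dyadic_index -> plane R -> R) (p q s beta sigma A : R) :
  (forall j, measurable_fun setT (a j)) -> (forall j z, 0 <= a j z) ->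
  1 < p -> p < q -> q^-1 + s^-1 = 1 -> q < sigma -> 0 < A ->
  beta / 2 = p^-1 - q^-1 - 2^-1 ->
  (forall j, (\int[area]_(z in dyadic_square j) (a j z `^ sigma)%:E <=
     (A * dyadic_scale j `^ (sigma * beta + 2))%:E)%E) ->
  dyadic_pairing a p s.
Proof.
move=> ma a0 p1 pq qs qsig A0 beta_def aS.
have [p' [rho [rho' [pp s1 rr [rho1 rho'1] [srho prho]]]]] := pairing_exponents p1 pq qs.
have p0 : 0 < p by lra.
have q0 : 0 < q by lra.
have s0 : 0 < s by lra.
have sig0 : 0 < sigma by lra.
have iq1 : q^-1 < 1 by rewrite invf_lt1//; lra.
have pE : p'^-1 = 1 - p^-1 by move: pp; clear; lra.
have qE : s^-1 = 1 - q^-1 by move: qs; clear; lra.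
have isig : sigma^-1 < q^-1 by rewrite ltf_pV2.
have isig0 : 0 < sigma^-1 by rewrite invr_gt0.
pose sig' := (1 - sigma^-1)^-1.
have isig' : sig'^-1 = 1 - sigma^-1 by rewrite invrK.
have sig'0 : 0 < sig' by rewrite invr_gt0; lra.
clearbody sig'.
have ss : sigma^-1 + sig'^-1 = 1 by rewrite isig'; lra.
have sig's : sig' < s by rewrite -ltf_pV2 ?posrE// isig'; lra.
pose u := s / sig'; have u1 : 1 < u by rewrite ltr_pdivlMr ?mul1r.
have u0 : 0 < u by lra.
pose t := (1 - u^-1)^-1; have ut : u^-1 + t^-1 = 1 by rewrite invrK addrC subrK.
have urho : u < rho / sig' by rewrite /u ltr_pM2r ?invr_gt0.
have [C1 C10 H1] := @sum_carleson _ _ _ (@area R) _ _ _ _ measurable_dyadic_square dyadic_square_overlap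
  one u t 2 4 (rho / sig') (fun=> ler01) (measurable_cst _) u1 ut urho (ltr0n _ 2) (ltr0n _ 4) (int_one_powR t).
have [C2 C20 H2] := @sum_carleson _ _ _ (@area R) _ _ _ _ measurable_dyadic_square dyadic_square_overlap
  one p p' 2 4 rho' (fun=> ler01) (measurable_cst _) p1 pp prho (ltr0n _ 2) (ltr0n _ 4) (int_one_powR p').
exists (A `^ sigma^-1 * (C1 + C2)) => [|f g js mf mg f0 g0 f1 g1 ujs].
  by rewrite mulr_gt0 ?powR_gt0// addr_gt0.
pose G z := g z `^ sig'.
have G0 z : 0 <= G z by rewrite powR_ge0.
have mG : measurable_fun setT G by exact: measurable_powRf.
have G1 : (\int[area]_z (G z `^ u)%:E <= 1)%E.
  apply: le_trans g1; rewrite le_eqVlt; apply/orP; left; apply/eqP.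
  apply: eq_integral => z _; rewrite /G -powRrM.
  by have -> : sig' * u = s by rewrite /u mulrCA divff ?mulr1// gt_eqF.
have [fin1 S1] := H1 G js G0 mG G1 ujs.
have [fin2 S2] := H2 f js f0 mf f1 ujs.
pose X j := fine (\int[area]_(z in dyadic_square j) (one z * G z)%:E).
pose Y j := fine (\int[area]_(z in dyadic_square j) (one z * f z)%:E).
have X0 j : 0 <= X j.
  by rewrite fine_ge0// integral_ge0// => z _; rewrite lee_fin mulr_ge0// ler01.
have Y0 j : 0 <= Y j.
  by rewrite fine_ge0// integral_ge0// => z _; rewrite lee_fin mulr_ge0// ler01.
have XE j : (\int[area]_(z in dyadic_square j) (G z)%:E = (X j)%:E)%E.
  under eq_integral do rewrite -[G _]mul1r.
  rewrite fineK// ge0_fin_numE ?fin1// integral_ge0// => z _; by rewrite lee_fin mulr_ge0// ler01.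
have YE j : (\int[area]_(z in dyadic_square j) (f z)%:E = (Y j)%:E)%E.
  under eq_integral do rewrite -[f _]mul1r.
  rewrite fineK// ge0_fin_numE ?fin2// integral_ge0// => z _; by rewrite lee_fin mulr_ge0// ler01.
have AG j : (\int[area]_(z in dyadic_square j) (a j z * g z)%:E <=
    (A `^ sigma^-1 * dyadic_scale j `^ (beta + 2 / sigma) * X j `^ sig'^-1)%:E)%E.
  have h := holder_integral (@area R) (measurable_dyadic_square j) (ma j) mg (a0 j) g0 sig0 sig'0 ss.
  apply: (le_trans h); rewrite EFinM; apply: lee_pmul; rewrite ?poweR_ge0//.
    apply: (@le_trans _ _ ((A * dyadic_scale j `^ (sigma * beta + 2))%:E `^ sigma^-1)%E).
      apply: gt0_ler_poweR; rewrite ?invr_ge0 ?(ltW sig0)// ?in_itv/= ?leey ?andbT//.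
      - by apply: integral_ge0 => z _; rewrite lee_fin powR_ge0.
      - by rewrite lee_fin mulr_ge0 ?powR_ge0 ?ltW.
    rewrite poweR_EFin (powRM sigma^-1 (ltW A0) (powR_ge0 (dyadic_scale j) (sigma * beta + 2))).
    rewrite -(powRrM (dyadic_scale j) (sigma * beta + 2) sigma^-1).
    by have -> : (sigma * beta + 2) / sigma = beta + 2 / sigma by field; rewrite gt_eqF.
  by rewrite XE poweR_EFin.
pose Z j := dyadic_scale j `^ (2 / sigma - 2 / q) * X j `^ sig'^-1.
apply: (@le_trans _ _ (\sum_(j <- js) (A `^ sigma^-1 * (Z j * (dyadic_scale j `^ (- (2 / p')) * Y j)))%:E)%E).
  apply: lee_sum => j _; rewrite YE.
  apply: (@le_trans _ _ ((dyadic_scale j)^-1%:E * ((A `^ sigma^-1 * dyadic_scale j `^ (beta + 2 / sigma) * X j `^ sig'^-1)%:E * (Y j)%:E))%E).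
    by rewrite lee_wpmul2l ?lee_fin ?invr_ge0 ?(ltW (dyadic_scale_gt0 j))// lee_wpmul2r ?lee_fin.
  rewrite -!EFinM lee_fin le_eqVlt; apply/orP; left; apply/eqP.
  rewrite -powR_inv1 ?(ltW (dyadic_scale_gt0 j))// /Z.
  transitivity (A `^ sigma^-1 * ((dyadic_scale j `^ (-1) * dyadic_scale j `^ (beta + 2 / sigma)) * X j `^ sig'^-1 * Y j)); first by ring.
  transitivity (A `^ sigma^-1 * ((dyadic_scale j `^ (2 / sigma - 2 / q) * dyadic_scale j `^ (- (2 / p'))) * X j `^ sig'^-1 * Y j)); last by ring.
  rewrite -!powRD; try by rewrite (gt_eqF (dyadic_scale_gt0 j)) implybT.
  congr (_ * (_ `^ _ * _ * _)); rewrite pE; move: beta_def; clear; lra.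
rewrite sumEFin lee_fin -mulr_sumr ler_pM2l ?powR_gt0//.
apply: (sum_young (X := Z) (Y := fun j => dyadic_scale j `^ (- (2 / p')) * Y j) _ _ _ _ rr _ S2) => [j|j|||].
- by rewrite mulr_ge0 ?powR_ge0.
- by rewrite mulr_ge0 ?powR_ge0.
- exact: rho1.
- exact: rho'1.
apply: le_trans S1; rewrite le_eqVlt; apply/orP; left; apply/eqP; apply: eq_bigr => j _.
have ZE : Z j = (dyadic_scale j `^ (- (2 / t)) * X j) `^ sig'^-1.
  rewrite (powRM sig'^-1 (powR_ge0 (dyadic_scale j) (- (2 / t))) (X0 j)).
  rewrite -(powRrM (dyadic_scale j) (- (2 / t)) sig'^-1) /Z.
  suff -> : 2 / sigma - 2 / q = - (2 / t) / sig' by [].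
  have -> : t^-1 = 1 - u^-1 by rewrite invrK.
  have -> : u^-1 = sig' * s^-1 by rewrite invf_div.
  rewrite qE; have -> : sigma^-1 = 1 - sig'^-1 by rewrite isig' opprB addrC subrK.
  by field; rewrite !gt_eqF.
by rewrite ZE [rho / sig']mulrC (powRrM (dyadic_scale j `^ (- (2 / t)) * X j) sig'^-1 rho).
Qed.

End plane_basics.

(** * The dyadic majorant *)

Section dyadic_operator.
Variable R : realType.
Implicit Types (f g : plane R -> R) (A : dyadic_index -> plane R -> R).

Lemma measurable_cabs d (T : measurableType d) (u : T -> R[i]) :
  measurable_fun setT (fun z => complex.Re (u z)) ->
  measurable_fun setT (fun z => complex.Im (u z)) ->
  measurable_fun setT (fun z => cabs (u z)).
Proof.
move=> mre mim.
have -> : (fun z => cabs (u z)) =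
    (fun z => ((complex.Re (u z)) ^+ 2 + (complex.Im (u z)) ^+ 2) `^ 2^-1).
  apply/funext => z; case: (u z) => a b /=.
  by rewrite powR12_sqrt// addr_ge0// sqr_ge0.
by apply: measurable_powRf; apply: measurable_funD; exact: measurable_funX.
Qed.

Lemma measurable_invf_ge0 d (T : measurableType d) (u : T -> R) :
  (forall z, 0 <= u z) -> measurable_fun setT u -> measurable_fun setT (fun z => (u z)^-1).
Proof.
move=> u0 mu; rewrite (_ : (fun z => _) = (fun z => u z `^ (-1))).
  exact: measurable_powRf.
by apply/funext => z; rewrite powR_inv1.
Qed.

Lemma measurable_dist_inv (z : plane R) :
  measurable_fun setT (fun w : plane R => (cabs (pt z - pt w))^-1).
Proof.
apply: measurable_invf_ge0 => [w|]; first exact: cabs_ge0.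
apply: measurable_cabs => /=.
  by apply: measurable_funB; [exact: measurable_cst|exact: measurable_fst].
by apply: measurable_funB; [exact: measurable_cst|exact: measurable_snd].
Qed.

(** The contribution of the square [j] to the majorant of the operators with
    kernel [kappa z w / |z - w|], [kappa z w <= A j z + A j w]. *)
Definition dyadic_term A f (j : dyadic_index) (z : plane R) : \bar R :=
  ((4 / dyadic_scale R j)%:E * ((\1_(dyadic_square j) z)%:E *
    ((A j z)%:E * \int[area]_(w in dyadic_square j) (f w)%:E +
     \int[area]_(w in dyadic_square j) (A j w * f w)%:E)))%E.

Definition dyadic_op A f (z : plane R) : \bar R :=
  (\sum_(0 <= i <oo) oapp (fun j => dyadic_term A f j z) 0 (pickle_inv i))%E.

Lemma dyadic_term_ge0 A f j z : (forall j z, 0 <= A j z) -> (forall z, 0 <= f z) ->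
  (0 <= dyadic_term A f j z)%E.
Proof.
move=> A0 f0; apply: mule_ge0; first by rewrite lee_fin divr_ge0// ltW// dyadic_scale_gt0.
apply: mule_ge0; first by rewrite lee_fin.
apply: adde_ge0; last by apply: integral_ge0 => w _; rewrite lee_fin mulr_ge0.
by apply: mule_ge0; [rewrite lee_fin|apply: integral_ge0 => w _; rewrite lee_fin].
Qed.

Lemma measurable_dyadic_term A f j : (forall j, measurable_fun setT (A j)) ->
  measurable_fun setT (dyadic_term A f j).
Proof.
move=> mA; apply: emeasurable_funM; first exact: measurable_cst.
apply: emeasurable_funM.
  by apply: measurable_EFinS; apply: measurable_indic; exact: measurable_dyadic_square.
apply: emeasurable_funD; last exact: measurable_cst.
by apply: emeasurable_funM; [exact: measurable_EFinS|exact: measurable_cst].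
Qed.

Section op.
Variables (A : dyadic_index -> plane R -> R) (f : plane R -> R).
Hypothesis mA : forall j, measurable_fun setT (A j).
Hypothesis A0 : forall j z, 0 <= A j z.
Hypothesis mf : measurable_fun setT f.
Hypothesis f0 : forall z, 0 <= f z.

Let term_ge0 i z : (0 <= oapp (fun j => dyadic_term A f j z) 0 (@pickle_inv dyadic_index i))%E.
Proof. by case: (pickle_inv i) => [j|] //=; exact: dyadic_term_ge0. Qed.

Let mterm i : measurable_fun setT (fun z => oapp (fun j => dyadic_term A f j z) 0%E (@pickle_inv dyadic_index i)).
Proof.
by case: (pickle_inv i) => [j|] /=; [exact: measurable_dyadic_term|exact: measurable_cst].
Qed.

Lemma measurable_dyadic_op : measurable_fun setT (dyadic_op A f).
Proof. by apply: (@ge0_emeasurable_sum _ _ _ _ _ xpredT) => [i z _ _|i _]. Qed.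

Lemma dyadic_op_ge0 z : (0 <= dyadic_op A f z)%E.
Proof. by apply: nneseries_ge0 => i _ _. Qed.

Lemma integral_dyadic_term g j : measurable_fun setT g -> (forall z, 0 <= g z) ->
  (\int[area]_z ((g z)%:E * dyadic_term A f j z) =
   4%:E * ((dyadic_scale R j)^-1%:E *
      ((\int[area]_(z in dyadic_square j) (A j z * g z)%:E) *
       (\int[area]_(z in dyadic_square j) (f z)%:E))) +
   4%:E * ((dyadic_scale R j)^-1%:E *
      ((\int[area]_(z in dyadic_square j) (A j z * f z)%:E) *
       (\int[area]_(z in dyadic_square j) (g z)%:E))))%E.
Proof.
move=> mg g0.
set F := (\int[area]_(z in _) (f z)%:E)%E; set G := (\int[area]_(z in _) (A j z * f z)%:E)%E.
have F0 : (0 <= F)%E by apply: integral_ge0 => w _; rewrite lee_fin.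
have G0 : (0 <= G)%E by apply: integral_ge0 => w _; rewrite lee_fin mulr_ge0.
have mS := measurable_dyadic_square j.
have c0 : (0 <= (4 / dyadic_scale R j)%:E)%E by rewrite lee_fin divr_ge0// ltW// dyadic_scale_gt0.
have mAg : measurable_fun setT (fun z => A j z * g z) by exact: measurable_funM.
transitivity (\int[area]_(z in dyadic_square j) ((4 / dyadic_scale R j)%:E * ((A j z * g z)%:E * F + (g z)%:E * G)))%E.
  rewrite [RHS]integral_mkcond; apply: eq_integral => z _.
  rewrite patchE /dyadic_term -/F -/G indicE; case: ifPn => zS; last first.
    by rewrite mul0e !mule0.
  rewrite mul1e muleCA; congr (_ * _)%E.
  by rewrite ge0_muleDr// ?mule_ge0 ?lee_fin// muleA -EFinM [g z * _]mulrC.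
rewrite ge0_integralZl//; last 2 first.
- apply: emeasurable_funD; apply: emeasurable_funM; try exact: measurable_cst; exact: measurable_EFinS.
- by move=> z _; rewrite adde_ge0// mule_ge0// lee_fin// mulr_ge0.
rewrite ge0_integralD//; last 4 first.
- by move=> z _; rewrite mule_ge0// lee_fin// mulr_ge0.
- by apply: emeasurable_funM; [exact: measurable_EFinS|exact: measurable_cst].
- by move=> z _; rewrite mule_ge0// lee_fin.
- by apply: emeasurable_funM; [exact: measurable_EFinS|exact: measurable_cst].
rewrite !ge0_integralZr//; try exact: measurable_EFinS; last 2 first.
- by move=> z _; rewrite lee_fin.
- by move=> z _; rewrite lee_fin mulr_ge0.
rewrite EFinM -muleA ge0_muleDr; last 2 first.
- by rewrite mule_ge0//; apply: integral_ge0 => z _; rewrite lee_fin mulr_ge0.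
- by rewrite mule_ge0//; apply: integral_ge0 => z _; rewrite lee_fin.
rewrite ge0_muleDr; last 2 first.
- rewrite mule_ge0 ?lee_fin ?invr_ge0 ?(ltW (dyadic_scale_gt0 _ _))//.
  by rewrite mule_ge0//; apply: integral_ge0 => z _; rewrite lee_fin mulr_ge0.
- rewrite mule_ge0 ?lee_fin ?invr_ge0 ?(ltW (dyadic_scale_gt0 _ _))//.
  by rewrite mule_ge0//; apply: integral_ge0 => z _; rewrite lee_fin.
by congr (_ + _ * (_ * _))%E; rewrite muleC.
Qed.

(** Any two distinct points share a square [j] of size comparable to their distance,
    where the kernel is at most the term of [j]. *)
Lemma kernel_le_dyadic_op (kappa : plane R -> R) (z : plane R) :
  measurable_fun setT kappa -> (forall w, 0 <= kappa w) ->
  (forall j w, dyadic_square j z -> dyadic_square j w -> kappa w <= A j z + A j w) ->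
  (\int[area]_w (kappa w * f w * (cabs (pt z - pt w))^-1)%:E <= dyadic_op A f z)%E.
Proof.
move=> mk k0 kA.
pose t j w : \bar R := ((4 / dyadic_scale R j)%:E * ((\1_(dyadic_square j) z)%:E *
  ((\1_(dyadic_square j) w)%:E * ((A j z + A j w) * f w)%:E)))%E.
have t0 j w : (0 <= t j w)%E.
  rewrite /t mule_ge0// ?lee_fin ?divr_ge0 ?(ltW (dyadic_scale_gt0 _ _))//.
  by rewrite !mulr_ge0// addr_ge0.
have mt j : measurable_fun setT (t j).
  apply: emeasurable_funM; first exact: measurable_cst.
  apply: emeasurable_funM; first exact: measurable_cst.
  apply: emeasurable_funM.
    by apply: measurable_EFinS; apply: measurable_indic; exact: measurable_dyadic_square.
  apply: measurable_EFinS; apply: measurable_funM => //.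
  by apply: measurable_funD => //; exact: measurable_cst.
have tE j : (\int[area]_w t j w = dyadic_term A f j z)%E.
  have c0 : (0 <= (4 / dyadic_scale R j)%:E)%E by rewrite lee_fin divr_ge0// ltW// dyadic_scale_gt0.
  have mS := measurable_dyadic_square j.
  have mi : measurable_fun setT (fun w : plane R => ((\1_(dyadic_square j) w)%:E * ((A j z + A j w) * f w)%:E)%E).
    apply: emeasurable_funM.
      by apply: measurable_EFinS; apply: measurable_indic.
    apply: measurable_EFinS; apply: measurable_funM => //.
    by apply: measurable_funD => //; exact: measurable_cst.
  rewrite /t ge0_integralZl//; last 2 first.
  - by apply: emeasurable_funM => //; exact: measurable_cst.
  - by move=> w _; rewrite !mule_ge0// lee_fin// mulr_ge0// addr_ge0.
  rewrite ge0_integralZl//; last first.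
    by move=> w _; rewrite mule_ge0// lee_fin// mulr_ge0// addr_ge0.
  rewrite /dyadic_term; congr (_ * (_ * _))%E.
  transitivity (\int[area]_(w in dyadic_square j) ((A j z) * f w + A j w * f w)%:E)%E.
    rewrite [RHS]integral_mkcond; apply: eq_integral => w _.
    by rewrite patchE indicE mulrDl; case: ifPn => _; rewrite ?mul1e ?mul0e.
  rewrite integralD_EFin_ge0//; first last.
  - by move=> w; rewrite mulr_ge0.
  - by move=> w; rewrite mulr_ge0.
  - exact: measurable_funM.
  - by apply: measurable_funM => //; exact: measurable_cst.
  by rewrite integralZ_EFin.
pose T i w := oapp (fun j => t j w) 0%E (@pickle_inv dyadic_index i).
have -> : dyadic_op A f z = (\sum_(0 <= i <oo) \int[area]_w T i w)%E.
  apply: eq_eseriesr => i _; rewrite /T; case: (pickle_inv i) => [j|] /=; first by rewrite tE.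
  by rewrite integral0.
have T0 i w : (0 <= T i w)%E by rewrite /T; case: (pickle_inv i) => [j|] /=.
rewrite -integral_nneseries//; last first.
  by move=> i; rewrite /T; case: (pickle_inv i) => [j|] //=; exact: measurable_cst.
apply: ge0_le_integral => //.
- by move=> w _; rewrite lee_fin !mulr_ge0// invr_ge0 cabs_ge0.
- apply: measurable_EFinS; apply: measurable_funM; last exact: measurable_dist_inv.
  exact: measurable_funM.
- apply: (@ge0_emeasurable_sum _ _ _ _ _ xpredT) => // i _.
  by rewrite /T; case: (pickle_inv i) => [j|] //=; exact: measurable_cst.
move=> w _; have [zw|zw] := pselect (z = w).
  by rewrite zw subrr ComplexField.Normc.normc0 invr0 mulr0 nneseries_ge0.
have [j [zS wS hj]] := dyadic_square_cover zw.
rewrite (@nneseriesD1 _ _ (pickle j) xpredT)//=.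
rewrite -[leLHS]adde0 leeD ?nneseries_ge0// {1}/T pickleK_inv /=.
rewrite /t !indicE !mem_set// !mul1e -EFinM lee_fin mulrC ler_pM//.
- by rewrite mulr_ge0.
- by rewrite ler_wpM2r// kA.
Qed.

End op.

(** By duality; the two terms of [dyadic_term] are the two pairings, the second
    with the roles of [f] and [g] exchanged. *)
Lemma dyadic_op_bounded A (p q s : R) :
  (forall j, measurable_fun setT (A j)) -> (forall j z, 0 <= A j z) ->
  1 < q -> q^-1 + s^-1 = 1 ->
  dyadic_pairing A p s -> dyadic_pairing A s p ->
  exists2 C : R, 0 < C & forall f, measurable_fun setT f -> (forall z, 0 <= f z) ->
    (\int[area]_z (f z `^ p)%:E <= 1)%E ->
    (\int[area]_z (dyadic_op A f z `^ q) <= (C `^ q)%:E)%E.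
Proof.
move=> mA A0 q1 qs [C1 C10 H1] [C2 C20 H2].
exists (4 * (C1 + C2)) => [|f mf f0 f1]; first by rewrite mulr_gt0// addr_gt0.
apply: (@converse_holder _ _ _ _ _ s) => //.
- exact: area_sigma_finite.
- exact: measurable_dyadic_op.
- by move=> z; exact: dyadic_op_ge0.
- by rewrite mulr_ge0// addr_ge0// ltW.
move=> g mg g0 g1.
pose T i z := ((g z)%:E * oapp (fun j => dyadic_term A f j z) 0 (@pickle_inv dyadic_index i))%E.
have T0 i z : (0 <= T i z)%E.
  rewrite /T mule_ge0 ?lee_fin//; case: (pickle_inv i) => [j|] //=.
  exact: dyadic_term_ge0.
have mT i : measurable_fun setT (T i).
  apply: emeasurable_funM; first exact: measurable_EFinS.
  by case: (pickle_inv i) => [j|] /=; [exact: measurable_dyadic_term|exact: measurable_cst].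
have -> : (\int[area]_z (dyadic_op A f z * (g z)%:E) = \sum_(0 <= i <oo) \int[area]_z T i z)%E.
  rewrite -integral_nneseries//; apply: eq_integral => z _.
  rewrite muleC -nneseriesZl// => i _; case: (pickle_inv i) => [j|] //=.
  exact: dyadic_term_ge0.
apply: lime_le.
  by apply: is_cvg_nneseries => i _ _; apply: integral_ge0 => z _.
apply: nearW => n.
pose js := pmap (@pickle_inv dyadic_index) (iota 0 n).
have ujs : uniq js by rewrite (pmap_uniq (@pickle_invK dyadic_index))// iota_uniq.
pose c1 j := ((dyadic_scale R j)^-1%:E *
      ((\int[area]_(z in dyadic_square j) (A j z * g z)%:E) *
       (\int[area]_(z in dyadic_square j) (f z)%:E)))%E.
pose c2 j := ((dyadic_scale R j)^-1%:E *
      ((\int[area]_(z in dyadic_square j) (A j z * f z)%:E) *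
       (\int[area]_(z in dyadic_square j) (g z)%:E)))%E.
have -> : (\sum_(0 <= i < n) \int[area]_z T i z = \sum_(j <- js) (4%:E * c1 j + 4%:E * c2 j))%E.
  rewrite /js big_pmap /index_iota subn0; apply: eq_bigr => i _.
  rewrite /T; case: (pickle_inv i) => [j|] /=.
    exact: integral_dyadic_term.
  by under eq_integral do rewrite mule0; rewrite integral0.
have I0 (h : plane R -> R) (S : set (plane R)) : (forall z, 0 <= h z) ->
    (0 <= \int[area]_(z in S) (h z)%:E)%E.
  by move=> h0; apply: integral_ge0 => z _; rewrite lee_fin.
have c10 j : (0 <= c1 j)%E.
  rewrite /c1 mule_ge0 ?lee_fin ?invr_ge0 ?(ltW (dyadic_scale_gt0 _ _))//.
  by rewrite mule_ge0// I0// => z; rewrite mulr_ge0.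
have c20 j : (0 <= c2 j)%E.
  rewrite /c2 mule_ge0 ?lee_fin ?invr_ge0 ?(ltW (dyadic_scale_gt0 _ _))//.
  by rewrite mule_ge0// I0// => z; rewrite mulr_ge0.
have -> : ((4 * (C1 + C2))%:E = 4%:E * C1%:E + 4%:E * C2%:E)%E.
  by rewrite -!EFinM -EFinD mulrDr.
rewrite big_split /=; apply: leeD.
  rewrite -ge0_sume_distrr// lee_wpmul2l//; exact: H1.
rewrite -ge0_sume_distrr// lee_wpmul2l//; exact: H2.
Qed.

End dyadic_operator.

(** * The commutator below the dyadic majorant *)

(** The same measure as [area], under a name that carries the sigma-finite
    structure needed by Tonelli's theorem. *)
Definition sigma_area (R : realType) (X : set (plane R)) : \bar R := area X.

Section sigma_area_instance.
Variable R : realType.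
Let m0 : sigma_area (set0 : set (plane R)) = 0%E. Proof. exact: measure0. Qed.
Let mge (X : set (plane R)) : (0 <= sigma_area X)%E. Proof. exact: measure_ge0. Qed.
Let msig : semi_sigma_additive (@sigma_area R).
Proof. exact: measure_semi_sigma_additive. Qed.
HB.instance Definition _ := isMeasure.Build _ _ _ (@sigma_area R) m0 mge msig.
HB.instance Definition _ :=
  @Measure_isSigmaFinite.Build _ _ _ (@sigma_area R) (@area_sigma_finite R).
End sigma_area_instance.

Section cauchy_measurability.
Variable R : realType.
Implicit Types (f g b : plane R -> R[i]).

Lemma measurable_Rintegral_section (h : plane R * plane R -> R) :
  measurable_fun setT h ->
  measurable_fun setT (fun z : plane R => \int[area]_w h (z, w)).
Proof.
move=> mh; rewrite /Rintegral.
apply: (measurableT_comp (f := fine)) => //.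
pose hE (zw : plane R * plane R) : \bar R := (h zw)%:E.
have mhE : measurable_fun setT hE by exact/measurable_EFinP.
under eq_fun do rewrite integralE.
have mp := measurable_funepos mhE; have mn := measurable_funeneg mhE.
have p0 zw : (0 <= (hE^\+)%E zw)%E by exact: funepos_ge0.
have n0 zw : (0 <= (hE^\-)%E zw)%E by exact: funeneg_ge0.
have areaE (k : plane R * plane R -> \bar R) z :
    (\int[area]_w k (z, w) = fubini_F (@sigma_area R) k z)%E.
  by apply: eq_measure_integral => A mA _.
apply: emeasurable_funB.
  apply: eq_measurable_fun (@measurable_fun_fubini_tonelli_F _ _ _ _ R (@sigma_area R) (hE^\+)%E mp p0).
  by move=> z _; rewrite -areaE; apply: eq_integral => w _; rewrite !funeposE.
apply: eq_measurable_fun (@measurable_fun_fubini_tonelli_F _ _ _ _ R (@sigma_area R) (hE^\-)%E mn n0).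
by move=> z _; rewrite -areaE; apply: eq_integral => w _; rewrite !funenegE.
Qed.

Lemma cmeasurableM f g : cmeasurable f -> cmeasurable g ->
  cmeasurable (fun z => f z * g z).
Proof.
move=> [f1 f2] [g1 g2]; split.
  rewrite (_ : (fun z => _) = (fun z => complex.Re (f z) * complex.Re (g z) -
     complex.Im (f z) * complex.Im (g z))); last first.
    by apply/funext => z; case: (f z) => ? ?; case: (g z).
  by apply: measurable_funB; exact: measurable_funM.
rewrite (_ : (fun z => _) = (fun z => complex.Re (f z) * complex.Im (g z) +
     complex.Im (f z) * complex.Re (g z))); last first.
  by apply/funext => z; case: (f z) => ? ?; case: (g z).
by apply: measurable_funD; exact: measurable_funM.
Qed.

Lemma cmeasurableB f g : cmeasurable f -> cmeasurable g ->
  cmeasurable (fun z => f z - g z).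
Proof.
move=> [f1 f2] [g1 g2]; split.
  rewrite (_ : (fun z => _) = (fun z => complex.Re (f z) - complex.Re (g z))).
    exact: measurable_funB.
  by apply/funext => z; case: (f z) => ? ?; case: (g z).
rewrite (_ : (fun z => _) = (fun z => complex.Im (f z) - complex.Im (g z))).
  exact: measurable_funB.
by apply/funext => z; case: (f z) => ? ?; case: (g z).
Qed.

Lemma cmeasurable_cst (c : R[i]) : cmeasurable (fun _ : plane R => c).
Proof. by split; exact: measurable_cst. Qed.

Lemma cmeasurable_cabs f : cmeasurable f -> measurable_fun setT (fun z => cabs (f z)).
Proof. by move=> [f1 f2]; exact: measurable_cabs. Qed.

Lemma ReVE (u : R[i]) : complex.Re u^-1 = complex.Re u * (cabs u)^-1 ^+ 2.
Proof. by case: u => x y /=; rewrite exprVn sqr_sqrtr// addr_ge0// sqr_ge0. Qed.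

Lemma ImVE (u : R[i]) : complex.Im u^-1 = - complex.Im u * (cabs u)^-1 ^+ 2.
Proof. by case: u => x y /=; rewrite exprVn sqr_sqrtr ?addr_ge0 ?sqr_ge0// mulNr. Qed.

Lemma measurable_cauchy_kernel :
  measurable_fun setT (fun zw : plane R * plane R => complex.Re (pt zw.1 - pt zw.2)^-1) /\
  measurable_fun setT (fun zw : plane R * plane R => complex.Im (pt zw.1 - pt zw.2)^-1).
Proof.
have mRe : measurable_fun setT (fun zw : plane R * plane R => complex.Re (pt zw.1 - pt zw.2)).
  rewrite /pt /=; apply: measurable_funB.
    exact: (measurableT_comp measurable_fst measurable_fst).
  exact: (measurableT_comp measurable_fst measurable_snd).
have mIm : measurable_fun setT (fun zw : plane R * plane R => complex.Im (pt zw.1 - pt zw.2)).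
  rewrite /pt /=; apply: measurable_funB.
    exact: (measurableT_comp measurable_snd measurable_fst).
  exact: (measurableT_comp measurable_snd measurable_snd).
have mi : measurable_fun setT (fun zw : plane R * plane R => (cabs (pt zw.1 - pt zw.2))^-1).
  by apply: measurable_invf_ge0 => [?|]; [exact: cabs_ge0|exact: measurable_cabs].
split.
  under eq_fun do rewrite ReVE.
  by apply: measurable_funM => //; exact: measurable_funX.
under eq_fun do rewrite ImVE.
by apply: measurable_funM; [exact: measurableT_comp|exact: measurable_funX].
Qed.

Lemma cmeasurable_cauchy f : cmeasurable f -> cmeasurable (cauchy f).
Proof.
move=> [f1 f2]; have [k1 k2] := measurable_cauchy_kernel.
have f1' : measurable_fun setT (fun zw : plane R * plane R => complex.Re (f zw.2)).
  exact: (measurableT_comp f1 measurable_snd).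
have f2' : measurable_fun setT (fun zw : plane R * plane R => complex.Im (f zw.2)).
  exact: (measurableT_comp f2 measurable_snd).
split; rewrite /cauchy /cintegral /=.
  apply: (@measurable_Rintegral_section (fun zw => complex.Re (f zw.2 / (pt zw.1 - pt zw.2)))).
  rewrite (_ : (fun z => _) = (fun zw => complex.Re (f zw.2) * complex.Re (pt zw.1 - pt zw.2)^-1 -
     complex.Im (f zw.2) * complex.Im (pt zw.1 - pt zw.2)^-1)); last first.
    by apply/funext => zw; case: (f zw.2) => ? ?; case: (_^-1).
  by apply: measurable_funB; exact: measurable_funM.
apply: (@measurable_Rintegral_section (fun zw => complex.Im (f zw.2 / (pt zw.1 - pt zw.2)))).
rewrite (_ : (fun z => _) = (fun zw => complex.Re (f zw.2) * complex.Im (pt zw.1 - pt zw.2)^-1 +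
     complex.Im (f zw.2) * complex.Re (pt zw.1 - pt zw.2)^-1)); last first.
  by apply/funext => zw; case: (f zw.2) => ? ?; case: (_^-1).
by apply: measurable_funD; exact: measurable_funM.
Qed.

Lemma cmeasurable_commutator b f : cmeasurable b -> cmeasurable f ->
  cmeasurable (commutator b f).
Proof.
move=> mb mf; rewrite /commutator.
apply: cmeasurableB.
  by apply: cmeasurableM => //; exact: cmeasurable_cauchy.
by apply: cmeasurable_cauchy; exact: cmeasurableM.
Qed.

Lemma cmeasurable_cauchy_integrand f z : cmeasurable f -> cmeasurable (cauchy_integrand f z).
Proof.
move=> mf; rewrite /cauchy_integrand; apply: cmeasurableM => //.
have mRe : measurable_fun setT (fun w : plane R => complex.Re (pt z - pt w)).
  by rewrite /pt /=; apply: measurable_funB; [exact: measurable_cst|exact: measurable_fst].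
have mIm : measurable_fun setT (fun w : plane R => complex.Im (pt z - pt w)).
  by rewrite /pt /=; apply: measurable_funB; [exact: measurable_cst|exact: measurable_snd].
have mi := measurable_dist_inv z.
split.
  under eq_fun do rewrite ReVE.
  by apply: measurable_funM => //; exact: measurable_funX.
under eq_fun do rewrite ImVE.
by apply: measurable_funM; [exact: measurableT_comp|exact: measurable_funX].
Qed.

Lemma cintegrable_cabs (D : set (plane R)) f : measurable D -> cmeasurable f ->
  (\int[area]_(z in D) (cabs (f z))%:E < +oo)%E -> cintegrable D f.
Proof.
move=> mD [f1 f2] fi; have mc := measurable_cabs f1 f2.
split; apply/integrableP; split; try exact: measurable_EFinS.
- apply: le_lt_trans fi; apply: ge0_le_integral => //.
  + by apply: measurableT_comp => //; exact: measurable_EFinS.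
  + exact: measurable_EFinS.
  + by move=> z _; rewrite lee_fin cabs_ge_Re.
- apply: le_lt_trans fi; apply: ge0_le_integral => //.
  + by apply: measurableT_comp => //; exact: measurable_EFinS.
  + exact: measurable_EFinS.
  + by move=> z _; rewrite lee_fin cabs_ge_Im.
Qed.

(** The factor [2] is the cost of bounding the two components separately. *)
Lemma cabs_cintegral_le (D : set (plane R)) f : measurable D -> cmeasurable f ->
  ((cabs (cintegral D f))%:E <= 2%:E * \int[area]_(z in D) (cabs (f z))%:E)%E.
Proof.
move=> mD mf; have [f1 f2] := mf; have mc := measurable_cabs f1 f2.
have [fi|] := ltP (\int[area]_(z in D) (cabs (f z))%:E)%E +oo%E; last first.
  by rewrite leye_eq => /eqP ->; rewrite gt0_muley ?leey// lte_fin.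
have [i1 i2] := cintegrable_cabs mD mf fi.
apply: (@le_trans _ _ (`|complex.Re (cintegral D f)| + `|complex.Im (cintegral D f)|)%:E).
  by rewrite lee_fin cabs_le_ReIm.
have -> x : (2%:E * x = x + x :> \bar R)%E by rewrite mule_natl mule2n.
rewrite EFinD /cintegral /=; apply: leeD.
  rewrite EFin_normr_Rintegral//; apply: (le_trans (le_abse_integral _ _ _)) => //.
    exact: measurable_EFinS.
  apply: ge0_le_integral => //.
  - by apply: measurableT_comp => //; exact: measurable_EFinS.
  - exact: measurable_EFinS.
  - by move=> z _; rewrite lee_fin cabs_ge_Re.
rewrite EFin_normr_Rintegral//; apply: (le_trans (le_abse_integral _ _ _)) => //.
  exact: measurable_EFinS.
apply: ge0_le_integral => //.
- by apply: measurableT_comp => //; exact: measurable_EFinS.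
- exact: measurable_EFinS.
- by move=> z _; rewrite lee_fin cabs_ge_Im.
Qed.

End cauchy_measurability.

Section majorant.
Variable R : realType.
Implicit Types (f b : plane R -> R[i]) (A : dyadic_index -> plane R -> R).

Lemma LpNormE (p : R) f : LpNorm p f = ((\int[area]_z (cabs (f z) `^ p)%:E) `^ p^-1)%E.
Proof.
rewrite /LpNorm unlock; congr (_ `^ _)%E; apply: eq_integral => z _.
by rewrite gee0_abs ?lee_fin ?cabs_ge0.
Qed.

Lemma LpNorm_le_integral (p t : R) f : 0 < p -> 0 <= t -> (LpNorm p f <= t%:E)%E ->
  (\int[area]_z (cabs (f z) `^ p)%:E <= (t `^ p)%:E)%E.
Proof.
move=> p0 t0; rewrite LpNormE => h.
have i0 : (0 <= \int[area]_z (cabs (f z) `^ p)%:E)%E.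
  by apply: integral_ge0 => z _; rewrite lee_fin powR_ge0.
have -> : (\int[area]_z (cabs (f z) `^ p)%:E =
  ((\int[area]_z (cabs (f z) `^ p)%:E) `^ p^-1) `^ p)%E.
  by rewrite -poweRrM mulVf ?gt_eqF// poweRe1.
rewrite -poweR_EFin; apply: gt0_ler_poweR => //; first exact: ltW.
- by rewrite in_itv/= leey poweR_ge0.
- by rewrite in_itv/= leey andbT lee_fin.
Qed.

Lemma integral_le_LpNorm (p t : R) f : 0 < p -> 0 <= t ->
  (\int[area]_z (cabs (f z) `^ p)%:E <= (t `^ p)%:E)%E -> (LpNorm p f <= t%:E)%E.
Proof.
move=> p0 t0 h; rewrite LpNormE.
have -> : (t%:E = (t `^ p)%:E `^ p^-1)%E.
  by rewrite poweR_EFin -powRrM divff ?gt_eqF// powRr1.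
apply: gt0_ler_poweR => //; first by rewrite invr_ge0 ltW.
- by rewrite in_itv/= leey andbT; apply: integral_ge0 => z _; rewrite lee_fin powR_ge0.
- by rewrite in_itv/= leey andbT lee_fin powR_ge0.
Qed.

Lemma dyadic_op_finite_ae A (h : plane R -> R) (q C : R) : 0 < q ->
  (forall j, measurable_fun setT (A j)) -> (forall j z, 0 <= A j z) ->
  measurable_fun setT h -> (forall z, 0 <= h z) ->
  (\int[area]_z (dyadic_op A h z `^ q) <= C%:E)%E ->
  {ae area, forall z, (dyadic_op A h z < +oo)%E}.
Proof.
move=> q0 mA A0 mh h0 hC.
have mH : measurable_fun setT (fun z => dyadic_op A h z `^ q)%E.
  by apply: (measurableT_comp (measurable_poweR q)); exact: measurable_dyadic_op.
have iH : area.-integrable setT (fun z => dyadic_op A h z `^ q)%E.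
  apply/integrableP; split=> //; under eq_integral do rewrite gee0_abs ?poweR_ge0//.
  by apply: le_lt_trans hC _; rewrite ltry.
apply: filterS (integrable_ae measurableT iH) => z /(_ I) hz.
have := dyadic_op_ge0 A0 h0 z.
case E : (dyadic_op A h z) hz => [r| |] //; first by rewrite ltry.
by rewrite poweRyr ?gt_eqF.
Qed.

Definition unit_weight : dyadic_index -> plane R -> R := fun _ _ => 1.

(** With the weight [1] the dyadic operator is comparable to the Riesz potential of
    order one; its
    boundedness makes the Cauchy integral of [f] converge almost everywhere. *)
Lemma fractional_integral_bounded (p : R) : 1 < p -> p < 2 ->
  exists q C : R, [/\ 1 < q, 0 < C & forall f : plane R -> R, measurable_fun setT f ->
    (forall z, 0 <= f z) -> (\int[area]_z (f z `^ p)%:E <= 1)%E ->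
    (\int[area]_z (dyadic_op unit_weight f z `^ q) <= (C `^ q)%:E)%E].
Proof.
(* The Sobolev exponent: the one for which a constant weight has the right growth. *)
move=> p1 p2; pose q := 2 * p / (2 - p).
have p0 : 0 < p by lra.
have q0 : 0 < q by rewrite divr_gt0 ?mulr_gt0// subr_gt0.
have q2 : 2 < q by rewrite ltr_pdivlMr ?subr_gt0//; lra.
have iq : q^-1 = p^-1 - 2^-1.
  by rewrite /q invf_div; field; rewrite gt_eqF.
have pq : p < q by lra.
have q1 : 1 < q by lra.
pose s := (1 - q^-1)^-1; pose p' := (1 - p^-1)^-1.
have qs : q^-1 + s^-1 = 1 by rewrite invrK addrC subrK.
have pp : p'^-1 + p^-1 = 1 by rewrite invrK subrK.
have iq2 : q^-1 < 2^-1 by rewrite ltf_pV2 ?posrE.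
have iq0 : 0 < q^-1 by rewrite invr_gt0.
have ip1 : p^-1 < 1 by rewrite invf_lt1.
have is1 : s^-1 < 1 by lra.
have is2 : 2^-1 < s^-1 by lra.
have s0 : 0 < s by rewrite invr_gt0; lra.
have s1 : 1 < s by rewrite -invf_lt1.
have s2 : s < 2 by rewrite -ltf_pV2 ?posrE.
have p'0 : 0 < p' by rewrite invr_gt0; lra.
have sp' : s < p' by rewrite -ltf_pV2 ?posrE//; lra.
have area1 (t : R) j : (\int[area]_(z in dyadic_square j) ((cst 1 : plane R -> R) z `^ t)%:E <=
    (4 * dyadic_scale R j `^ 2)%:E)%E.
  exact: int_one_powR.
have P1 : dyadic_pairing unit_weight p s.
  apply: (@dyadic_pairing_morrey R (cst 1) p q s 4) => // j.
  have -> : q * (2 / p - 1) = 2.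
    have -> : 2 / p - 1 = 2 / q by move: iq; clear; lra.
    by rewrite mulrCA divff ?mulr1// gt_eqF.
  exact: area1.
have P2 : dyadic_pairing unit_weight s p.
  apply: (@dyadic_pairing_morrey R (cst 1) s p' p 4) => // j.
  have -> : p' * (2 / s - 1) = 2.
    have -> : 2 / s - 1 = 2 / p' by move: iq qs pp; clear; lra.
    by rewrite mulrCA divff ?mulr1// gt_eqF.
  exact: area1.
have [C C0 HC] := dyadic_op_bounded (fun=> measurable_cst _) (fun _ _ => ler01) q1 qs P1 P2.
by exists q, C; split.
Qed.

Lemma cabs_cauchy_integrand f z w :
  cabs (cauchy_integrand f z w) = cabs (f w) * (cabs (pt z - pt w))^-1.
Proof. by rewrite /cauchy_integrand ComplexField.Normc.normcM ComplexField.Normc.normcV. Qed.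

(** The dyadic operator dominates the integral of [|b z - b w| |f w| / |z - w|]. Its
    finiteness almost everywhere, with that of the potential of [f], makes both
    Cauchy integrals in the commutator converge. *)
Theorem commutator_bounded_of_pairing b (p q s : R) A :
  cmeasurable b -> 1 < p -> p < 2 -> 2 < q -> q^-1 + s^-1 = 1 ->
  (forall j, measurable_fun setT (A j)) -> (forall j z, 0 <= A j z) ->
  (forall j z w, dyadic_square j z -> dyadic_square j w -> cabs (b z - b w) <= A j z + A j w) ->
  dyadic_pairing A p s -> dyadic_pairing A s p ->
  commutator_bounded b p q.
Proof.
move=> mb p1 p2 q2 qs mA A0 bA P1 P2.
have p0 : 0 < p by lra.
have q1 : 1 < q by lra.
have q0 : 0 < q by lra.
have [C C0 HC] := dyadic_op_bounded mA A0 q1 qs P1 P2.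
have [q' [C' [q'1 C'0 HC']]] := fractional_integral_bounded p1 p2.
have q'0 : 0 < q' by lra.
exists (2 * C); split=> [|f [mf fp]]; first by rewrite mulr_gt0.
pose F (z : plane R) : R := cabs (f z).
have F0 z : 0 <= F z by exact: cabs_ge0.
have mF : measurable_fun setT F by exact: cmeasurable_cabs.
(* The norm of [f] may be [0], so [f] is scaled by any positive bound [t] of it. *)
have main (t : R) : 0 < t -> (LpNorm p f <= t%:E)%E ->
    {ae area, forall z, cauchy_converges f z /\ cauchy_converges (fun w => b w * f w) z} /\
    (LpNorm q (commutator b f) <= (2 * C * t)%:E)%E.
  move=> t0 ft; pose G (z : plane R) : R := t^-1 * F z.
  have G0 z : 0 <= G z by rewrite mulr_ge0// invr_ge0 ltW.
  have mG : measurable_fun setT G by apply: measurable_funM => //; exact: measurable_cst.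
  have G1 : (\int[area]_z (G z `^ p)%:E <= 1)%E.
    have := LpNorm_le_integral p0 (ltW t0) ft; rewrite -/F => h.
    have -> : (fun z => (G z `^ p)%:E) = (fun z => (t `^ (- p) * F z `^ p)%:E).
      apply/funext => z; rewrite /G powRM ?invr_ge0 ?(ltW t0)//.
      by rewrite -powR_inv1 ?(ltW t0)// -powRrM mulN1r.
    rewrite integralZ_EFin ?powR_ge0//; last 2 first.
    - exact: measurable_powRf.
    - by move=> z; rewrite powR_ge0.
    apply: (le_trans (lee_wpmul2l _ h)); first by rewrite lee_fin powR_ge0.
    by rewrite -EFinM -powRD ?addNr ?powRr0// (gt_eqF t0) implybT.
  have ae1 := dyadic_op_finite_ae q0 mA A0 mG G0 (HC G mG G0 G1).
  have ae2 := dyadic_op_finite_ae q'0 (fun=> measurable_cst _) (fun _ _ => ler01) mG G0 (HC' G mG G0 G1).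
  pose kb (z w : plane R) : R := cabs (b z - b w).
  have mkb z : measurable_fun setT (kb z).
    by apply: cmeasurable_cabs; apply: cmeasurableB => //; exact: cmeasurable_cst.
  have scale (k : plane R -> R) z : measurable_fun setT k -> (forall w, 0 <= k w) ->
      (\int[area]_w (k w * F w * (cabs (pt z - pt w))^-1)%:E =
       t%:E * \int[area]_w (k w * G w * (cabs (pt z - pt w))^-1)%:E)%E.
    move=> mk k0; rewrite -integralZ_EFin ?(ltW t0)//; last 2 first.
    - by apply: measurable_funM; [exact: measurable_funM|exact: measurable_dist_inv].
    - by move=> w; rewrite mulr_ge0 ?invr_ge0 ?cabs_ge0// (mulr_ge0 (k0 w) (G0 w)).
    apply: eq_integral => w _; congr EFin; rewrite /G.
    by rewrite !mulrA [t * _]mulrC -[k w * t / t]mulrA divff ?mulr1// gt_eqF.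
  have bk z : (\int[area]_w (kb z w * F w * (cabs (pt z - pt w))^-1)%:E <= t%:E * dyadic_op A G z)%E.
    rewrite scale//; last by move=> w; exact: cabs_ge0.
    rewrite lee_wpmul2l ?lee_fin ?(ltW t0)//.
    by apply: kernel_le_dyadic_op => // [w|j w]; [exact: cabs_ge0|exact: bA].
  have b1 z : (\int[area]_w (1 * F w * (cabs (pt z - pt w))^-1)%:E <= t%:E * dyadic_op unit_weight G z)%E.
    rewrite (scale (cst 1))//.
    rewrite lee_wpmul2l ?lee_fin ?(ltW t0)//.
    apply: kernel_le_dyadic_op => //; try by move=> *; exact: measurable_cst.
    by move=> j w _ _; rewrite /unit_weight lerDl.
  have conv : {ae area, forall z, (cauchy_converges f z /\ cauchy_converges (fun w => b w * f w) z) /\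
      ((cabs (commutator b f z))%:E <= (2 * t)%:E * dyadic_op A G z)%E}.
    apply: filterS2 ae1 ae2 => z h1 h2.
    have i1 : (\int[area]_w (cabs (cauchy_integrand f z w))%:E < +oo)%E.
      under eq_integral do rewrite cabs_cauchy_integrand -[cabs (f _)]mul1r.
      by apply: le_lt_trans (b1 z) _; rewrite lte_mul_pinfty// lee_fin ltW.
    have c1 : cauchy_converges f z.
      by apply: cintegrable_cabs => //; exact: cmeasurable_cauchy_integrand.
    have mbf : cmeasurable (fun w => b w * f w) by exact: cmeasurableM.
    have mkF : measurable_fun setT (fun w => kb z w * F w * (cabs (pt z - pt w))^-1).
      by apply: measurable_funM; [exact: measurable_funM|exact: measurable_dist_inv].
    (* As [b w = b z - (b z - b w)], both parts of the integrand are controlled. *)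
    have c2 : cauchy_converges (fun w => b w * f w) z.
      apply: cintegrable_cabs => //; first exact: cmeasurable_cauchy_integrand.
      have mci : measurable_fun setT (fun w => cabs (cauchy_integrand f z w)).
        by apply: cmeasurable_cabs; exact: cmeasurable_cauchy_integrand.
      apply: (@le_lt_trans _ _ (\int[area]_w (cabs (b z) * cabs (cauchy_integrand f z w) +
          kb z w * F w * (cabs (pt z - pt w))^-1)%:E)%E).
        apply: le_integral_EFin => //.
        - by apply: cmeasurable_cabs; exact: cmeasurable_cauchy_integrand.
        - apply: measurable_funD => //; apply: measurable_funM => //; exact: measurable_cst.
        - by move=> w _; exact: cabs_ge0.
        move=> w _; rewrite !cabs_cauchy_integrand ComplexField.Normc.normcM mulrA -mulrDl.
        rewrite ler_wpM2r ?invr_ge0 ?cabs_ge0// -?mulrDl ler_wpM2r ?cabs_ge0//.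
        have -> : b w = b z - (b z - b w) by rewrite opprB addrC subrK.
        apply: (le_trans (le_normcD _ _)).
        by rewrite normcN lerD// /kb opprB addrC subrK.
      rewrite integralD_EFin_ge0//; first last.
      - by move=> w; rewrite !mulr_ge0 ?invr_ge0 ?cabs_ge0.
      - by move=> w; rewrite mulr_ge0 ?cabs_ge0.
      - by apply: measurable_funM => //; exact: measurable_cst.
      apply: lte_add_pinfty.
        rewrite integralZ_EFin ?cabs_ge0//; last by move=> w; exact: cabs_ge0.
        by rewrite lte_mul_pinfty// lee_fin cabs_ge0.
      apply: (le_lt_trans (bk z)); apply: lte_mul_pinfty => //.
      by rewrite lee_fin ltW.
    split=> //; rewrite commutatorE//.
    apply: (le_trans (cabs_cintegral_le measurableT _)).
      rewrite (_ : (fun w => _) = (fun w => (b z - b w) * cauchy_integrand f z w)).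
        apply: cmeasurableM; last exact: cmeasurable_cauchy_integrand.
        by apply: cmeasurableB => //; exact: cmeasurable_cst.
      by apply/funext => w; rewrite /cauchy_integrand mulrAC mulrA.
    rewrite EFinM -muleA lee_wpmul2l//.
    apply: le_trans (bk z); rewrite le_eqVlt; apply/orP; left; apply/eqP.
    apply: eq_integral => w _; congr EFin.
    by rewrite !ComplexField.Normc.normcM ComplexField.Normc.normcV mulrAC.
  split; first by apply: filterS conv => z [].
  apply: integral_le_LpNorm => //; first by rewrite !mulr_ge0// ltW.
  have mc : measurable_fun setT (fun z => cabs (commutator b f z) `^ q).
    by apply: measurable_powRf; apply: cmeasurable_cabs; exact: cmeasurable_commutator.
  have mop : measurable_fun setT (fun z => dyadic_op A G z `^ q)%E.
    by apply: (measurableT_comp (measurable_poweR q)); exact: measurable_dyadic_op.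
  apply: (@le_trans _ _ (\int[area]_z (((2 * t) `^ q)%:E * dyadic_op A G z `^ q))%E).
    apply: ae_ge0_le_integral => //.
    - by move=> z _; rewrite lee_fin powR_ge0.
    - exact: measurable_EFinS.
    - by move=> z _; rewrite mule_ge0 ?poweR_ge0// lee_fin powR_ge0.
    - by apply: emeasurable_funM => //; exact: measurable_cst.
    apply: filterS conv => z [_ h] _.
    rewrite -!poweR_EFin -poweRM ?dyadic_op_ge0 ?lee_fin ?mulr_ge0 ?(ltW t0)//.
    apply: gt0_ler_poweR => //; first exact: ltW.
    - by rewrite in_itv/= leey andbT lee_fin cabs_ge0.
    - by rewrite in_itv/= leey andbT mule_ge0 ?dyadic_op_ge0 ?lee_fin ?mulr_ge0 ?(ltW t0).
  rewrite ge0_integralZl//; last 2 first.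
  - by move=> z _; rewrite poweR_ge0.
  - by rewrite lee_fin powR_ge0.
  apply: (le_trans (lee_wpmul2l _ (HC G mG G0 G1))); first by rewrite lee_fin powR_ge0.
  rewrite -EFinM lee_fin -powRM ?mulr_ge0 ?(ltW t0) ?(ltW C0)//.
  by rewrite mulrAC.
have fin : (LpNorm p f \is a fin_num)%E by rewrite ge0_fin_numE// Lnorm_ge0.
set n := fine (LpNorm p f).
have nE : (LpNorm p f = n%:E)%E by rewrite fineK.
have n0 : 0 <= n by rewrite fine_ge0// Lnorm_ge0.
split.
  by have [] := main (n + 1) (ltr_wpDl n0 ltr01); rewrite // nE lee_fin lerDl.
rewrite nE -EFinM; apply/lee_addgt0Pr => e e0.
have e0' : 0 < e / (2 * C) by rewrite divr_gt0// mulr_gt0.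
have nt : (LpNorm p f <= (n + e / (2 * C))%:E)%E by rewrite nE lee_fin lerDl ltW.
have [_ /le_trans] := main (n + e / (2 * C)) (ltr_wpDl n0 e0') nt; apply.
rewrite -EFinD lee_fin mulrDr lerD2l mulrCA divff ?mulr1//.
by rewrite gt_eqF// mulr_gt0.
Qed.

End majorant.

(** * Averages over squares *)

Section limits.
Variable R : realType.

Lemma pow2_gt1 (gamma : R) : 0 < gamma -> 0 < 2 `^ gamma - 1 :> R.
Proof.
move=> g0; have l2 : 0 < ln (2 : R) by rewrite ln_gt0// ltr1n.
by rewrite subr_gt0 powR_ln// expR_gt1 mulr_gt0.
Qed.

(** The increments of [u] are bounded by a geometric progression that tends to
    [0] at [-oo]; the limit there is squeezed between the monotone sequences
    [u k - C r ^ k] and [u k + C r ^ k]. *)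
Lemma int_geometric_limit (u : int -> R) (M gamma : R) : 0 <= M -> 0 < gamma ->
  (forall k, `|u (k + 1) - u k| <= M * 2 `^ (gamma * k%:~R)) ->
  exists l : R, forall k, `|u k - l| <= M / (2 `^ gamma - 1) * 2 `^ (gamma * k%:~R).
Proof.
move=> M0 g0 H; set C := M / _.
have g1 := pow2_gt1 g0.
have C0 : 0 <= C by rewrite divr_ge0// ltW.
pose e k : R := C * 2 `^ (gamma * k%:~R).
have eS k : e (k + 1) - e k = M * 2 `^ (gamma * k%:~R).
  have -> : e (k + 1) = e k * 2 `^ gamma.
    by rewrite /e intrD mulrDr mulr1 powRD ?mulrA// pnatr_eq0 implybT.
  by rewrite /e /C; field; rewrite gt_eqF.
have mono (v : int -> R) : (forall k, v k <= v (k + 1)) -> forall k m, k <= m -> v k <= v m.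
  move=> vS k m km; have -> : m = k + `|m - k|%N by lia.
  elim: `|m - k|%N => [|n IH]; first by rewrite addr0.
  by apply: (le_trans IH); have -> : k + n.+1 = k + n + 1 by lia.
have wS k : u (k + 1) - e (k + 1) <= u k - e k.
  have := H k; rewrite -eS ler_norml => /andP[_]; lra.
have vS k : u k + e k <= u (k + 1) + e (k + 1).
  have := H k; rewrite -eS ler_norml => /andP[+ _]; lra.
have e0 k : 0 <= e k by rewrite mulr_ge0 ?powR_ge0.
have wv k m : u k - e k <= u m + e m.
  have [km|mk] := leP k m.
    apply: (@le_trans _ _ (u k + e k)); first by have := e0 k; lra.
    exact: (mono (fun k => u k + e k)).
  apply: (@le_trans _ _ (u m - e m)); last by have := e0 m; lra.
  rewrite -lerN2; apply: (mono (fun k => - (u k - e k))); last exact: ltW.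
  by move=> j; rewrite lerN2.
pose W := range (fun k => u k - e k).
have hsW : has_sup W.
  by split; [exists (u 0 - e 0); exists 0|exists (u 0 + e 0) => _ [k _ <-]].
exists (sup W) => k; rewrite -/(e k) ler_norml.
have h1 : u k - e k <= sup W by apply: ub_le_sup; [case: hsW|exists k].
have h2 : sup W <= u k + e k by apply: ge_sup; [case: hsW|move=> _ [m _ <-]].
by apply/andP; split; lra.
Qed.

Lemma int_geometric_climit (u : int -> R[i]) (M gamma : R) : 0 <= M -> 0 < gamma ->
  (forall k, cabs (u (k + 1) - u k) <= M * 2 `^ (gamma * k%:~R)) ->
  exists l : R[i], forall k,
    cabs (u k - l) <= 2 * (M / (2 `^ gamma - 1)) * 2 `^ (gamma * k%:~R).
Proof.
move=> M0 g0 H.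
have ReB (v w : R[i]) : complex.Re v - complex.Re w = complex.Re (v - w) by case: v; case: w.
have ImB (v w : R[i]) : complex.Im v - complex.Im w = complex.Im (v - w) by case: v; case: w.
have [k|lr Hr] := @int_geometric_limit (fun k => complex.Re (u k)) M gamma M0 g0.
  by rewrite ReB (le_trans (cabs_ge_Re _)).
have [k|li Hi] := @int_geometric_limit (fun k => complex.Im (u k)) M gamma M0 g0.
  by rewrite ImB (le_trans (cabs_ge_Im _)).
exists (lr +i* li) => k; apply: (le_trans (cabs_le_ReIm _)).
rewrite -mulrA mulr_natl mulr2n; apply: lerD.
  by have := Hr k; case: (u k).
by have := Hi k; case: (u k).
Qed.

End limits.

Section averages.
Variable R : realType.
Implicit Types (f g b : plane R -> R[i]) (x y : plane R).

Lemma cmeasurable_affine a f g : cmeasurable f -> cmeasurable g ->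
  cmeasurable (fun w => a * f w - g w).
Proof. by move=> mf mg; apply: cmeasurableB => //; apply: cmeasurableM => //; exact: cmeasurable_cst. Qed.

Lemma cintegral_affine (D : set (plane R)) (a : R[i]) f g : measurable D ->
  cintegrable D f -> cintegrable D g ->
  cintegral D (fun w => a * f w - g w) = a * cintegral D f - cintegral D g.
Proof.
move=> mD [f1 f2] [g1 g2]; case: a => u v.
have Z (c : R) (k : plane R -> R) : area.-integrable D (fun w => (k w)%:E) ->
    area.-integrable D (fun w => (c * k w)%:E).
  by move=> /(integrableZl mD c).
have ReI : area.-integrable D
    (fun w => (u * complex.Re (f w) - v * complex.Im (f w))%:E).
  exact: (integrableB mD (Z u _ f1) (Z v _ f2)).
have ImI : area.-integrable D
    (fun w => (u * complex.Im (f w) + v * complex.Re (f w))%:E).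
  exact: (integrableD mD (Z u _ f2) (Z v _ f1)).
transitivity (
  (\int[area]_(w in D)
     ((u * complex.Re (f w) - v * complex.Im (f w)) - complex.Re (g w))) +i*
  (\int[area]_(w in D)
     ((u * complex.Im (f w) + v * complex.Re (f w)) - complex.Im (g w)))).
  by congr Complex; apply: eq_Rintegral => w _; case: (f w) => ? ?; case: (g w).
rewrite (RintegralB mD ReI g1) (RintegralB mD ImI g2).
rewrite (RintegralB mD (Z u _ f1) (Z v _ f2)).
rewrite (RintegralD mD (Z u _ f2) (Z v _ f1)).
by rewrite !RintegralZl.
Qed.

Lemma cintegral_cst (D : set (plane R)) (c : R[i]) : measurable D ->
  cintegral D (fun=> c) = (fine (area D))%:C * c.
Proof.
move=> mD; rewrite /cintegral !Rintegral_cst//; case: c => u v /=.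
by congr Complex; rewrite /= ?mul0r ?subr0 ?addr0 mulrC.
Qed.

Lemma L1loc_square b x r : L1loc b ->
  (\int[area]_(y in square x r) (cabs (b y))%:E < +oo)%E.
Proof.
move=> [_]; apply; rewrite squareE; apply: compact_setX; exact: segment_compact.
Qed.

Lemma cintegrable_square b x r : L1loc b -> cintegrable (square x r) b.
Proof.
move=> bL; apply: cintegrable_cabs; first exact: measurable_square.
  by case: bL.
exact: L1loc_square.
Qed.

Lemma cintegrable_square_cst (c : R[i]) x r : 0 < r -> cintegrable (square x r) (fun=> c).
Proof.
move=> r0; apply: cintegrable_cabs; first exact: measurable_square.
  exact: cmeasurable_cst.
rewrite integral_cst ?area_square//; last exact: measurable_square.
by rewrite -EFinM ltry.
Qed.

Lemma average_subE b x r c : L1loc b -> 0 < r ->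
  average (square x r) b - c =
  ((2 * r) ^+ 2)^-1%:C * cintegral (square x r) (fun y => b y - c).
Proof.
move=> bL r0; have mS := @measurable_square R x r.
have -> : (fun y => b y - c) = (fun y => 1 * b y - c).
  by apply/funext => y; rewrite mul1r.
rewrite cintegral_affine//; [|exact: cintegrable_square|exact: cintegrable_square_cst].
rewrite cintegral_cst// mul1r /average area_square//= mulrBr; congr (_ - _).
rewrite mulrA -rmorphM/= mulVf ?mul1r//.
by rewrite gt_eqF// exprn_gt0// mulr_gt0.
Qed.

Lemma cabsC_ge0 (t : R) : 0 <= t -> cabs (t%:C) = t.
Proof. by move=> t0; rewrite /= expr0n /= addr0 sqrtr_sqr ger0_norm. Qed.

Lemma average_sub_le b x r c : L1loc b -> 0 < r ->
  ((cabs (average (square x r) b - c))%:E <= (2 / (2 * r) ^+ 2)%:E *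
    \int[area]_(y in square x r) (cabs (b y - c))%:E)%E.
Proof.
move=> bL r0; rewrite average_subE// ComplexField.Normc.normcM.
have q0 : 0 <= ((2 * r) ^+ 2)^-1 by rewrite invr_ge0 exprn_ge0// mulr_ge0// ltW.
rewrite cabsC_ge0// EFinM [2 / _]mulrC EFinM -muleA lee_wpmul2l ?lee_fin//.
apply: cabs_cintegral_le; first exact: measurable_square.
by apply: cmeasurableB; [case: bL|exact: cmeasurable_cst].
Qed.

Lemma cabs_distC (u v : R[i]) : cabs (u - v) = cabs (v - u).
Proof. by rewrite -normcN opprB. Qed.

Lemma cabs_dist_triangle (u v w : R[i]) : cabs (u - w) <= cabs (u - v) + cabs (v - w).
Proof.
have -> : u - w = (u - v) + (v - w) by rewrite addrA subrK.
exact: le_normcD.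
Qed.

Definition mean_oscillation_le b (beta K : R) : Prop := forall x r, 0 < r ->
  (\int[area]_(y in square x r) (cabs (b y - average (square x r) b))%:E <=
   (K * r `^ (2 + beta))%:E)%E.

Lemma measurable_cabs_sub b c : cmeasurable b -> measurable_fun setT (fun y => cabs (b y - c)).
Proof. by move=> mb; apply: cmeasurable_cabs; apply: cmeasurableB => //; exact: cmeasurable_cst. Qed.

Lemma average_compare b beta K x y r s : L1loc b -> mean_oscillation_le b beta K ->
  0 < r -> 0 < s -> square x r `<=` square y s ->
  cabs (average (square x r) b - average (square y s) b) <=
    2 / (2 * r) ^+ 2 * (K * s `^ (2 + beta)).
Proof.
move=> bL bK r0 s0 xy; rewrite -lee_fin.
apply: (le_trans (average_sub_le _ _ bL r0)).
rewrite [leRHS](EFinM (2 / (2 * r) ^+ 2)); apply: lee_wpmul2l.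
  by rewrite lee_fin divr_ge0// exprn_ge0// mulr_ge0// ltW.
apply: le_trans (bK y s s0); apply: ge0_subset_integral => //.
- exact: measurable_square.
- exact: measurable_square.
- by apply: measurable_EFinS; apply: measurable_cabs_sub; case: bL.
- by move=> z _; rewrite lee_fin cabs_ge0.
Qed.

Lemma sub_square x y r s : `|(x.1 : R) - y.1| <= s - r -> `|(x.2 : R) - y.2| <= s - r ->
  square x r `<=` square y s.
Proof.
move=> h1 h2 z [z1 z2]; split.
  have -> : (z.1 : R) - y.1 = (z.1 - x.1) + (x.1 - y.1) by rewrite addrA subrK.
  by apply: (le_trans (ler_normD _ _)); lra.
have -> : (z.2 : R) - y.2 = (z.2 - x.2) + (x.2 - y.2) by rewrite addrA subrK.
by apply: (le_trans (ler_normD _ _)); lra.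
Qed.

Definition scale2 (k : int) : R := 2 `^ k%:~R.

Lemma scale2_gt0 k : 0 < scale2 k. Proof. by rewrite powR_gt0. Qed.

Lemma scale2S k : scale2 (k + 1) = 2 * scale2 k.
Proof. by rewrite /scale2 intrD powRD ?pnatr_eq0 ?implybT// powRr1// mulrC. Qed.

Lemma scale2_powR k (t : R) : scale2 k `^ t = 2 `^ (t * k%:~R).
Proof. by rewrite /scale2 -powRrM mulrC. Qed.

Lemma average_compare2 b beta K x y k : L1loc b -> mean_oscillation_le b beta K -> 0 <= K ->
  `|(x.1 : R) - y.1| <= scale2 k -> `|(x.2 : R) - y.2| <= scale2 k ->
  cabs (average (square x (scale2 k)) b - average (square y (scale2 (k + 1))) b) <=
    K * 2 `^ (1 + beta) * 2 `^ (beta * k%:~R).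
Proof.
move=> bL bK K0 h1 h2; have s0 := scale2_gt0 k.
have sub : square x (scale2 k) `<=` square y (scale2 (k + 1)).
  by apply: sub_square; rewrite scale2S; lra.
apply: (le_trans (average_compare bL bK s0 (scale2_gt0 _) sub)).
rewrite le_eqVlt; apply/orP; left; apply/eqP.
rewrite scale2S powRM ?(ltW s0)// -scale2_powR.
have -> : scale2 k `^ (2 + beta) = scale2 k ^+ 2 * scale2 k `^ beta.
  by rewrite powRD ?(gt_eqF s0) ?implybT// powR_mulrn// ltW.
have -> : (2 : R) `^ (2 + beta) = 2 * 2 `^ (1 + beta).
  have -> : 2 + beta = 1 + (1 + beta) by lra.
  by rewrite (@powRD _ 2 1) ?pnatr_eq0 ?implybT// powRr1.
by field; rewrite gt_eqF.
Qed.

(** The increments of the averages between consecutive scales are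
    [O(2 ^ (beta k))], which is summable towards [-oo]. *)
Lemma average_limit_small b beta K : L1loc b -> mean_oscillation_le b beta K -> 0 <= K ->
  0 < beta -> exists C : R, exists2 g : plane R -> R[i], 0 <= C & forall x k,
    cabs (average (square x (scale2 k)) b - g x) <= C * 2 `^ (beta * k%:~R).
Proof.
move=> bL bK K0 b0.
have M0 : 0 <= K * 2 `^ (1 + beta) by rewrite mulr_ge0 ?powR_ge0.
have g1 := pow2_gt1 b0.
exists (2 * (K * 2 `^ (1 + beta) / (2 `^ beta - 1))).
have H x : exists l : R[i], forall k, cabs (average (square x (scale2 k)) b - l) <=
    2 * (K * 2 `^ (1 + beta) / (2 `^ beta - 1)) * 2 `^ (beta * k%:~R).
  apply: (@int_geometric_climit _ (fun k => average (square x (scale2 k)) b)) => // k.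
  rewrite cabs_distC; apply: (average_compare2 bL bK K0).
    by rewrite subrr normr0 ltW// scale2_gt0.
  by rewrite subrr normr0 ltW// scale2_gt0.
have [g Hg] := choice H.
by exists g => //; rewrite mulr_ge0// divr_ge0// ltW.
Qed.

Lemma exists_large_scale beta (D e u v : R) : beta < 0 -> 0 <= D -> 0 < e ->
  exists m : int, [/\ u <= scale2 m, v <= scale2 m & D * 2 `^ (beta * m%:~R) <= e].
Proof.
move=> b0 D0 e0; have gb : 0 < - beta by rewrite oppr_gt0.
pose B := `|u| + `|v| + (D / e) `^ (- beta^-1) + 1.
have B0 : 0 < B by rewrite ltr_wpDl// !addr_ge0 ?powR_ge0.
have l2 : 0 < ln (2 : R) by rewrite ln_gt0// ltr1n.
have Bm : B <= scale2 (Num.ceil (ln B / ln 2)).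
  rewrite /scale2 -[leLHS]lnK ?posrE// powR_ln// ler_expR -ler_pdivrMr//.
  exact: ceil_ge.
exists (Num.ceil (ln B / ln 2)).
have p0 : 0 <= (D / e) `^ (- beta^-1) by rewrite powR_ge0.
have a1 := ler_norm u; have a2 := ler_norm v.
have a3 := normr_ge0 u; have a4 := normr_ge0 v.
split; [by rewrite (le_trans _ Bm)// /B; lra|by rewrite (le_trans _ Bm)// /B; lra|].
rewrite -scale2_powR; move: (scale2_gt0 (Num.ceil (ln B / ln 2))) Bm.
move: (scale2 _) => sm sm0 Bm.
have [->|Dn0] := eqVneq D 0; first by rewrite mul0r ltW.
have {}D0 : 0 < D by rewrite lt_neqAle eq_sym Dn0.
have h : (D / e) `^ (- beta^-1) <= sm by apply: le_trans Bm; rewrite /B; lra.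
have := le_powRl (ltW gb) (powR_ge0 _ _) h.
have De0 : 0 < D / e by rewrite divr_gt0.
have -> : ((D / e) `^ (- beta^-1)) `^ (- beta) = D / e.
  by rewrite -powRrM mulrNN mulVf ?lt_eqF// powRr1// ltW.
rewrite ler_pdivrMr// => h'.
have -> : sm `^ beta = (sm `^ (- beta))^-1 by rewrite powRN invrK.
by rewrite ler_pdivrMr ?powR_gt0// mulrC.
Qed.

Lemma pow2S beta k : 2 `^ (beta * (k + 1)%:~R) = 2 `^ beta * 2 `^ (beta * k%:~R) :> R.
Proof.
rewrite intrD mulrDr mulr1 addrC.
by rewrite (@powRD _ 2 beta (beta * k%:~R))// pnatr_eq0 implybT.
Qed.

(** The increments are now summable towards [+oo]. The limit is the same at all
    centres, since two large squares with centres far closer than their size have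
    comparable averages. *)
Lemma average_limit_large b beta K : L1loc b -> mean_oscillation_le b beta K -> 0 <= K ->
  beta < 0 -> exists C : R, exists2 c : R[i], 0 <= C & forall x k,
    cabs (average (square x (scale2 k)) b - c) <= C * 2 `^ (beta * k%:~R).
Proof.
move=> bL bK K0 b0.
have [M [M0 step]] : exists M : R, 0 <= M /\ forall x y k,
    `|(x.1 : R) - y.1| <= scale2 k -> `|(x.2 : R) - y.2| <= scale2 k ->
    cabs (average (square x (scale2 k)) b - average (square y (scale2 (k + 1))) b) <=
    M * 2 `^ (beta * k%:~R).
  exists (K * 2 `^ (1 + beta)); split; first by rewrite mulr_ge0 ?powR_ge0.
  by move=> x y k; exact: average_compare2.
have gb : 0 < - beta by rewrite oppr_gt0.
have g1 := pow2_gt1 gb.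
have M'0 : 0 <= M * 2 `^ (- beta) by rewrite mulr_ge0 ?powR_ge0.
have [C [C0 H]] : exists C : R, 0 <= C /\ forall x, exists l : R[i], forall k,
    cabs (average (square x (scale2 k)) b - l) <= C * 2 `^ (beta * k%:~R).
  exists (2 * (M * 2 `^ (- beta) / (2 `^ (- beta) - 1))); split.
    by rewrite mulr_ge0// divr_ge0// ltW.
  move=> x.
  have incr k : cabs (average (square x (scale2 (- (k + 1)))) b - average (square x (scale2 (- k))) b)
      <= M * 2 `^ (- beta) * 2 `^ (- beta * k%:~R).
    have h0 (t : R) : `|t - t| <= scale2 (- k - 1) by rewrite subrr normr0 ltW// scale2_gt0.
    have := step x x (- k - 1) (h0 _) (h0 _); rewrite subrK.
    have -> : - (k + 1) = - k - 1 by rewrite opprD.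
    move=> h; apply: (le_trans h).
    have := pow2S beta (- k - 1); rewrite subrK intrN mulrN -mulNr => ->.
    by rewrite -mulrA [_ * (2 `^ beta * _)]mulrA powRN mulVf ?mul1r.
  have [l Hl] := @int_geometric_climit R (fun k => average (square x (scale2 (- k))) b)
    _ (- beta) M'0 gb incr.
  exists l => k; have := Hl (- k); rewrite opprK.
  by have -> : - beta * (- k)%:~R = beta * k%:~R by rewrite intrN mulrNN.
have [c Hc] := choice H.
exists C; exists (c (0, 0)) => // x k.
suff -> : c (0, 0) = c x by exact: Hc.
(* The averages over large squares centred at the two points are comparable. *)
apply/eqP; rewrite -subr_eq0; apply/eqP/ComplexField.Normc.eq0_normc/eqP.
rewrite eq_le cabs_ge0 andbT; apply/ler_addgt0Pr => e e0; rewrite add0r.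
have D0 : 0 <= C * 2 `^ beta + M + C by rewrite !addr_ge0// mulr_ge0 ?powR_ge0.
have [m [m1 m2 m3]] := @exists_large_scale beta _ e `|(x.1 : R)| `|(x.2 : R)| b0 D0 e0.
apply: le_trans m3.
apply: (le_trans (cabs_dist_triangle _ (average (square (0, 0) (scale2 (m + 1))) b) _)).
rewrite 2!mulrDl -addrA; apply: lerD.
  by rewrite cabs_distC; apply: (le_trans (Hc _ _)); rewrite pow2S mulrA.
apply: (le_trans (cabs_dist_triangle _ (average (square x (scale2 m)) b) _)).
apply: lerD; last exact: Hc.
by rewrite cabs_distC; apply: step; rewrite /= subr0.
Qed.

End averages.

(** * Division of squares into four *)

Section quadtree.
Variable R : realType.
Implicit Types (x y : plane R) (r s : R) (G H : plane R -> R -> \bar R) (F : plane R -> R).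

Definition child x r (j : bool * bool) : plane R :=
  ((x.1 : R) + (if j.1 then r / 2 else - (r / 2)), (x.2 : R) + (if j.2 then r / 2 else - (r / 2))).

(** The sum of [G] over the cells of the [n]-th generation of the quadtree rooted at
    a square; recursion on the root makes the estimates below inductions on [n]. *)
Fixpoint leaf_sum (n : nat) G x r : \bar R :=
  if n is m.+1 then (\sum_(j : bool * bool) leaf_sum m G (child x r j) (r / 2))%E else G x r.

Lemma leaf_sum_le n G H x r : (forall y, G y (r / 2 ^+ n)%R <= H y (r / 2 ^+ n)%R)%E ->
  (leaf_sum n G x r <= leaf_sum n H x r)%E.
Proof.
elim: n x r => [|n IH] x r GH /=; first by have := GH x; rewrite expr0 divr1.
by apply: lee_sum => j _; apply: IH => y; have := GH y; rewrite exprS invfM mulrA.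
Qed.

Lemma leaf_sumD n G H x r :
  leaf_sum n (fun y s => G y s + H y s)%E x r = (leaf_sum n G x r + leaf_sum n H x r)%E.
Proof. by elim: n x r => [|n IH] x r //=; under eq_bigr do rewrite IH; rewrite big_split. Qed.

Lemma leaf_sum_ge0 n G x r : 0 < r -> (forall y s, (0 < s)%R -> 0 <= G y s)%E -> (0 <= leaf_sum n G x r)%E.
Proof.
move=> + G0; elim: n x r => [|n IH] x r r0 /=; first exact: G0.
by apply: sume_ge0 => j _; apply: IH; rewrite divr_gt0.
Qed.

Lemma leaf_sumZ n (c : R) G x r : 0 <= c -> 0 < r -> (forall y s, (0 < s)%R -> 0 <= G y s)%E ->
  leaf_sum n (fun y s => c%:E * G y s)%E x r = (c%:E * leaf_sum n G x r)%E.
Proof.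
move=> c0 + G0; elim: n x r => [|n IH] x r r0 //=.
have r20 : 0 < r / 2 by rewrite divr_gt0.
rewrite ge0_sume_distrr; first by apply: eq_bigr => j _; exact: IH.
by move=> j _; exact: leaf_sum_ge0.
Qed.

Lemma measurable_child x r j : measurable (square (child x r j) (r / 2)).
Proof. exact: measurable_square. Qed.

Lemma child_sub x r j : 0 < r -> square (child x r j) (r / 2) `<=` square x r.
Proof.
by move=> r0; case: j => [[] []]; apply: sub_square; rewrite /= addrAC subrr add0r ?normrN gtr0_norm ?divr_gt0//; lra.
Qed.

Lemma child_cover x r z : square x r z -> exists j, square (child x r j) (r / 2) z.
Proof.
move=> [z1 z2]; exists ((x.1 : R) <= z.1, (x.2 : R) <= z.2).
have one (c u : R) : `|u - c| <= r -> `|u - (c + (if c <= u then r / 2 else - (r / 2)))| <= r / 2.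
  rewrite !ler_norml; case: (leP c u) => cu /andP[h1 h2]; apply/andP; split; move: cu h1 h2; clear; lra.
by split; exact: one.
Qed.

Lemma null_vertical (a : R) : area [set z : plane R | (z.1 : R) = a] = 0%E.
Proof.
have -> : [set z : plane R | (z.1 : R) = a] = [set a] `*` setT.
  by apply/seteqP; split => z //= [].
rewrite /area /= product_measure1E; [|exact: measurable_set1|exact: measurableT].
have L : lebesgue_measure ([set a] : set (measurableTypeR R)) = 0%E.
  exact: lebesgue_measure_set1.
by rewrite [X in (X * _)%E]L mul0e.
Qed.

Lemma null_horizontal (a : R) : area [set z : plane R | (z.2 : R) = a] = 0%E.
Proof.
have -> : [set z : plane R | (z.2 : R) = a] = setT `*` [set a].
  by apply/seteqP; split => z //= [].
rewrite /area /= product_measure1E; [|exact: measurableT|exact: measurable_set1].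
have L : lebesgue_measure ([set a] : set (measurableTypeR R)) = 0%E.
  exact: lebesgue_measure_set1.
by rewrite [X in (_ * X)%E]L mule0.
Qed.

Lemma ae_off_axes x : {ae area, forall z : plane R, (z.1 : R) != x.1 /\ (z.2 : R) != x.2}.
Proof.
exists ([set z : plane R | (z.1 : R) = x.1] `|` [set z : plane R | (z.2 : R) = x.2]).
have m1 : measurable [set z : plane R | (z.1 : R) = x.1].
  by rewrite -[X in measurable X]setTI; apply: (@measurable_fst _ _ _ _ measurableT [set (x.1 : R)]); exact: measurable_set1.
have m2 : measurable [set z : plane R | (z.2 : R) = x.2].
  by rewrite -[X in measurable X]setTI; apply: (@measurable_snd _ _ _ _ measurableT [set (x.2 : R)]); exact: measurable_set1.
split; first exact: measurableU.
  apply/eqP; rewrite eq_le measure_ge0 andbT.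
  have E : (area [set z : plane R | (z.1 : R) = x.1] + area [set z : plane R | (z.2 : R) = x.2] = 0)%E.
    by rewrite null_vertical null_horizontal adde0.
  apply: (le_trans (measureU2 (@area R) m1 m2)).
  by rewrite le_eqVlt; apply/orP; left; apply/eqP; exact: E.
move=> z /= h; have [e1|n1] := eqVneq (z.1 : R) x.1; first by left.
by right; apply/eqP/negP => /negP n2; apply: h.
Qed.

Lemma integral_le_children x r F : 0 < r -> measurable_fun setT F -> (forall z, 0 <= F z) ->
  (\int[area]_(z in square x r) (F z)%:E <=
   \sum_j \int[area]_(z in square (child x r j) (r / 2)) (F z)%:E)%E.
Proof.
move=> r0 mF F0; under eq_bigr do rewrite integral_mkcond.
rewrite integral_mkcond -ge0_integral_sum//; last 2 first.
- by move=> j; apply/(measurable_restrictT _ (measurable_child _ _ _)); exact: measurable_EFinS.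
- by move=> j z _; rewrite patchE; case: ifP => //; rewrite lee_fin.
apply: ge0_le_integral => //.
- by move=> z _; rewrite patchE; case: ifP => //; rewrite lee_fin.
- by apply/(measurable_restrictT _ (measurable_square _ _)); exact: measurable_EFinS.
- by apply: emeasurable_sum => j; apply/(measurable_restrictT _ (measurable_child _ _ _)); exact: measurable_EFinS.
move=> z _; rewrite patchE; case: ifPn => [|_]; last first.
  by apply: sume_ge0 => j _; rewrite patchE; case: ifP => //; rewrite lee_fin.
rewrite inE => /child_cover[j zj].
rewrite (bigD1 j)//= patchE mem_set// leeDl//.
by apply: sume_ge0 => i _; rewrite patchE; case: ifP => //; rewrite lee_fin.
Qed.

(* The children overlap only along the two axes of the parent. *)
Lemma children_le_integral x r F : 0 < r -> measurable_fun setT F -> (forall z, 0 <= F z) ->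
  (\sum_j \int[area]_(z in square (child x r j) (r / 2)) (F z)%:E <=
   \int[area]_(z in square x r) (F z)%:E)%E.
Proof.
move=> r0 mF F0; under eq_bigr do rewrite integral_mkcond.
rewrite integral_mkcond -ge0_integral_sum//; last 2 first.
- by move=> j; apply/(measurable_restrictT _ (measurable_child _ _ _)); exact: measurable_EFinS.
- by move=> j z _; rewrite patchE; case: ifP => //; rewrite lee_fin.
apply: ae_ge0_le_integral => //.
- by move=> z _; apply: sume_ge0 => j _; rewrite patchE; case: ifP => //; rewrite lee_fin.
- by apply: emeasurable_sum => j; apply/(measurable_restrictT _ (measurable_child _ _ _)); exact: measurable_EFinS.
- by move=> z _; rewrite patchE; case: ifP => //; rewrite lee_fin.
- by apply/(measurable_restrictT _ (measurable_square _ _)); exact: measurable_EFinS.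
apply: filterS (ae_off_axes x) => z [n1 n2] _.
pose j0 := ((x.1 : R) <= z.1, (x.2 : R) <= z.2).
have uniq1 (c u : R) (i : bool) : u != c -> `|u - (c + (if i then r / 2 else - (r / 2)))| <= r / 2 ->
    i = (c <= u).
  move=> uc; rewrite ler_norml; case: i; case: (ltgtP c u) uc; lra.
rewrite (bigD1 j0)//= big1 ?adde0; last first.
  move=> j jj0; rewrite patchE; case: ifPn => //; rewrite inE => -[h1 h2].
  case/negP: jj0; rewrite /j0; case: j h1 h2 => i1 i2 /= h1 h2.
  by rewrite (uniq1 _ _ _ n1 h1) (uniq1 _ _ _ n2 h2).
rewrite !patchE; case: ifPn => [|_]; last by case: ifP => //; rewrite lee_fin.
by rewrite inE => /(child_sub r0) zS; rewrite mem_set.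
Qed.

Lemma integral_le_leaf_sum n x r F : 0 < r -> measurable_fun setT F -> (forall z, 0 <= F z) ->
  (\int[area]_(z in square x r) (F z)%:E <=
   leaf_sum n (fun y s => \int[area]_(z in square y s) (F z)%:E) x r)%E.
Proof.
move=> + mF F0; elim: n x r => [|n IH] x r r0 //=.
apply: (le_trans (integral_le_children x r0 mF F0)).
by apply: lee_sum => j _; apply: IH; rewrite divr_gt0.
Qed.

Lemma leaf_sum_le_integral n x r F : 0 < r -> measurable_fun setT F -> (forall z, 0 <= F z) ->
  (leaf_sum n (fun y s => \int[area]_(z in square y s) (F z)%:E) x r <=
   \int[area]_(z in square x r) (F z)%:E)%E.
Proof.
move=> + mF F0; elim: n x r => [|n IH] x r r0 //=.
apply: le_trans (children_le_integral x r0 mF F0).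
by apply: lee_sum => j _; apply: IH; rewrite divr_gt0.
Qed.

Lemma leaf_sum_area_cst n (k : R) x r : leaf_sum n (fun _ s => (k * (2 * s) ^+ 2)%:E) x r = (k * (2 * r) ^+ 2)%:E.
Proof.
elim: n x r => [|n IH] x r //=; under eq_bigr do rewrite IH.
rewrite sumEFin big_const iter_addr_0 card_prod card_bool; congr EFin.
by rewrite -mulr_natr; field.
Qed.

End quadtree.

(** * Hoelder continuity from mean oscillation *)

Section holder.
Variable R : realType.
Implicit Types (f g b : plane R -> R[i]) (x y : plane R).

Lemma measurable_average b (s : R) : cmeasurable b -> 0 < s ->
  cmeasurable (fun x => average (square x s) b).
Proof.
move=> [b1 b2] s0.
pose E : set (plane R * plane R) := [set u | square u.1 s u.2].
have mE : measurable E.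
  have -> : E = (fun u : plane R * plane R => (u.2.1 : R) - u.1.1) @^-1` `[- s, s]%classic `&`
      ((fun u : plane R * plane R => (u.2.2 : R) - u.1.2) @^-1` `[- s, s]%classic).
    by apply/seteqP; split=> u; rewrite /E /square /= !in_itv/= !ler_norml.
  apply: measurableI; rewrite -[X in measurable X]setTI.
    apply: (measurable_funB (f := fun u : plane R * plane R => u.2.1)
      (g := fun u : plane R * plane R => u.1.1)) => //.
      exact: (measurableT_comp measurable_fst measurable_snd).
    exact: (measurableT_comp measurable_fst measurable_fst).
  apply: (measurable_funB (f := fun u : plane R * plane R => u.2.2)
      (g := fun u : plane R * plane R => u.1.2)) => //.
    exact: (measurableT_comp measurable_snd measurable_snd).
  exact: (measurableT_comp measurable_snd measurable_fst).
have key (k : plane R -> R) : measurable_fun setT k ->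
    measurable_fun setT (fun x : plane R => \int[area]_(w in square x s) k w).
  move=> mk; have -> : (fun x : plane R => \int[area]_(w in square x s) k w) =
     (fun x : plane R => \int[area]_w (k w * \1_E (x, w))).
    apply/funext => x; rewrite Rintegral_mkcond; apply: eq_Rintegral => w _.
    rewrite patchE indicE; have -> : ((x, w) \in E) = (w \in square x s).
      by apply/idP/idP; rewrite !inE.
    by case: ifP => _; rewrite ?mulr1 ?mulr0.
  apply: (@measurable_Rintegral_section _ (fun u => k u.2 * \1_E u)).
  apply: measurable_funM; last exact: measurable_indic.
  exact: (measurableT_comp mk measurable_snd).
rewrite /average; under eq_fun do rewrite area_square//.
apply: cmeasurableM; first exact: cmeasurable_cst.
by split; exact: key.
Qed.

Lemma exists_scale (d : R) : 0 < d -> exists k : int, d <= scale2 R k /\ scale2 R k < 2 * d.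
Proof.
move=> d0; have l2 : 0 < ln (2 : R) by rewrite ln_gt0// ltr1n.
exists (Num.ceil (ln d / ln 2)); split.
  rewrite /scale2 -[leLHS]lnK ?posrE// powR_ln// ler_expR -ler_pdivrMr//.
  exact: ceil_ge.
rewrite -[Num.ceil _](subrK 1) scale2S ltr_pM2l//.
rewrite /scale2 -[ltRHS]lnK ?posrE// powR_ln// ltr_expR -ltr_pdivlMr//.
exact: ceilB1_lt.
Qed.

(** The limit [g] of the averages is Hoelder continuous because two points at
    distance [2 ^ k] share their averages at scale [2 ^ k] up to [O(2 ^ (beta k))];
    it represents [b] because [b - g] is [O(r ^ (2 + beta))] in mean on squares of
    half-side [r], hence has mean [O(r ^ beta)] on a fixed square. *)
Theorem ae_holder_of_mean_oscillation b beta K : L1loc b -> mean_oscillation_le b beta K ->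
  0 <= K -> 0 < beta -> ae_holder beta b.
Proof.
move=> bL bK K0 b0; have mb : cmeasurable b by case: bL.
have [C [g C0 Hg]] := average_limit_small bL bK K0 b0.
pose M := K * 2 `^ (1 + beta).
have M0 : 0 <= M by rewrite mulr_ge0 ?powR_ge0.
pose H := (C + M + C * 2 `^ beta) * 2 `^ beta.
have H0 : 0 <= H by rewrite mulr_ge0 ?powR_ge0// !addr_ge0// mulr_ge0 ?powR_ge0.
have gH x y : cabs (g x - g y) <= H * (cabs (pt x - pt y)) `^ beta.
  have [->|xy] := pselect (x = y).
    by rewrite subrr ComplexField.Normc.normc0 mulr_ge0 ?powR_ge0.
  pose d : R := Num.max `|(x.1 : R) - y.1| `|(x.2 : R) - y.2|.
  have d0 : 0 < d.
    rewrite lt_max !normr_gt0 !subr_eq0; apply/orP.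
    have [e1|e1] := eqVneq (x.1 : R) y.1; [right|by left].
    apply/eqP => e2; apply: xy; case: x y e1 e2 {d} => x1 x2 [y1 y2] /= -> ->//.
  have dxy : d <= cabs (pt x - pt y).
    rewrite ge_max; have := cabs_ge_Re (pt x - pt y); have := cabs_ge_Im (pt x - pt y).
    by rewrite /pt; case: x y {xy d d0} => ? ? [? ?] /= -> ->.
  have [k [dk kd]] := exists_scale d0.
  have e1 : `|(x.1 : R) - y.1| <= scale2 R k by apply: le_trans dk; rewrite le_max lexx.
  have e2 : `|(x.2 : R) - y.2| <= scale2 R k by apply: le_trans dk; rewrite le_max lexx orbT.
  have k0 : 2 `^ (beta * k%:~R) <= 2 `^ beta * (cabs (pt x - pt y)) `^ beta.
    rewrite -scale2_powR -powRM//; last exact: cabs_ge0.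
    apply: le_powRl; [exact: ltW|exact: ltW (scale2_gt0 _ _)|].
    by apply: (le_trans (ltW kd)); rewrite ler_pM2l.
  apply: (@le_trans _ _ ((C + M + C * 2 `^ beta) * 2 `^ (beta * k%:~R))); last first.
    by rewrite /H -mulrA ler_wpM2l// !addr_ge0// mulr_ge0 ?powR_ge0.
  apply: (le_trans (cabs_dist_triangle _ (average (square x (scale2 R k)) b) _)).
  rewrite -addrA mulrDl; apply: lerD; first by rewrite cabs_distC; exact: Hg.
  apply: (le_trans (cabs_dist_triangle _ (average (square y (scale2 R (k + 1))) b) _)).
  rewrite mulrDl; apply: lerD; first exact: average_compare2.
  by apply: (le_trans (Hg _ _)); rewrite pow2S mulrA.
have nb : - beta < 0 by rewrite oppr_lt0.
have mg : cmeasurable g.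
  have lim (P : R[i] -> R) : (forall u v, `|P u - P v| <= cabs (u - v)) ->
      (forall k, measurable_fun setT (fun x => P (average (square x (scale2 R (- k%:Z))) b))) ->
      measurable_fun setT (fun x => P (g x)).
    move=> PL mP; apply: (measurable_fun_cvg mP) => x _.
    apply/cvgrPdist_le => e e0.
    have [m [_ _ m3]] := exists_large_scale 1 1 nb C0 e0.
    near=> n; rewrite distrC; apply: (le_trans (PL _ _)); apply: (le_trans (Hg _ _)).
    apply: le_trans m3; rewrite ler_wpM2l// intrN mulrN -mulNr.
    rewrite ler_powR ?ler1n// ler_wnM2l ?(ltW nb)// ler_int.
    apply: (le_trans (lez_abs m)); rewrite lez_nat.
    by near: n; exact: nbhs_infty_ge.
  split.
    apply: lim => [u v|k].
      have -> : complex.Re u - complex.Re v = complex.Re (u - v) by case: u; case: v.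
      exact: cabs_ge_Re.
    by have [] := measurable_average mb (scale2_gt0 R (- k%:Z)).
  apply: lim => [u v|k].
      have -> : complex.Im u - complex.Im v = complex.Im (u - v) by case: u; case: v.
      exact: cabs_ge_Im.
  by have [] := measurable_average mb (scale2_gt0 R (- k%:Z)).
exists g; split; first by exists H.
have mbg : measurable_fun setT (fun z => cabs (b z - g z)).
  by apply: cmeasurable_cabs; exact: cmeasurableB.
pose D := K + 4 * (C + H * 2 `^ beta).
have D0 : 0 <= D by rewrite addr_ge0// mulr_ge0// addr_ge0// mulr_ge0 ?powR_ge0.
have loc x k : (\int[area]_(z in square x (scale2 R k)) (cabs (b z - g z))%:E <=
    (D * scale2 R k `^ (2 + beta))%:E)%E.
  set r := scale2 R k; have r0 : 0 < r by exact: scale2_gt0.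
  have rb : 2 `^ (beta * k%:~R) = r `^ beta by rewrite /r scale2_powR.
  have E : r `^ (2 + beta) = r ^+ 2 * r `^ beta.
    by rewrite powRD ?(gt_eqF r0) ?implybT// powR_mulrn// ltW.
  pose c := (C + H * 2 `^ beta) * r `^ beta.
  have c0 : 0 <= c by rewrite mulr_ge0 ?powR_ge0// addr_ge0// mulr_ge0 ?powR_ge0.
  have mS : measurable (square x r : set (plane R)) by exact: measurable_square.
  have mbS := measurable_cabs_sub (average (square x r) b) mb.
  apply: (@le_trans _ _ (\int[area]_(z in square x r)
      (cabs (b z - average (square x r) b) + c)%:E)%E).
    apply: le_integral_EFin => //.
    - by apply: measurable_funD => //; exact: measurable_cst.
    - by move=> z _; exact: cabs_ge0.
    move=> z [z1 z2]; apply: (le_trans (cabs_dist_triangle _ (average (square x r) b) _)).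
    rewrite lerD2l; apply: (le_trans (cabs_dist_triangle _ (g x) _)).
    rewrite /c mulrDl; apply: lerD; first by rewrite -rb; exact: Hg.
    apply: (le_trans (gH _ _)); rewrite -mulrA ler_wpM2l//.
    rewrite -powRM ?(ltW r0)//; apply: le_powRl; rewrite ?cabs_ge0 ?(ltW b0)//.
    rewrite cabs_distC; apply: (le_trans (cabs_le_ReIm _)).
    by rewrite mulr_natl mulr2n; apply: lerD; case: z x z1 z2 {mS mbS} => ? ? [? ?].
  rewrite (integralD_EFin_ge0 area mS mbS (measurable_cst c) (fun=> cabs_ge0 _) (fun=> c0)).
  have -> : (\int[area]_(z in square x r) (cst c z)%:E = c%:E * area (square x r))%E.
    exact: (integral_cst area mS c%:E).
  have -> : D * r `^ (2 + beta) = K * r `^ (2 + beta) + c * (2 * r) ^+ 2.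
    by rewrite /D /c E; ring.
  rewrite area_square// -EFinM (EFinD (K * _)).
  by apply: leeD; first exact: bK.
pose o : plane R := (0, 0).
have null n : (\int[area]_(z in square o (scale2 R n%:Z)) (cabs (b z - g z))%:E = 0)%E.
  apply/eqP; rewrite eq_le; apply/andP; split; last first.
    by apply: integral_ge0 => z _; rewrite lee_fin cabs_ge0.
  apply/lee_addgt0Pr => e e0; rewrite add0e.
  set s := scale2 R n; have s0 : 0 < s by exact: scale2_gt0.
  have Ds0 : 0 <= D * s ^+ 2 * s `^ beta by rewrite !mulr_ge0 ?powR_ge0 ?exprn_ge0 ?(ltW s0).
  have [m [_ _ m3]] := exists_large_scale 1 1 nb Ds0 e0.
  pose N := absz m.
  have sm : s / 2 ^+ N = scale2 R (n%:Z - N%:Z).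
    have -> : 2 ^+ N = 2 `^ N%:~R :> R by rewrite -pmulrn powR_mulrn.
    by rewrite /s /scale2 intrB powRB// pnatr_eq0 implybT.
  apply: (le_trans (integral_le_leaf_sum N o s0 mbg (fun z => cabs_ge0 _))).
  pose k := D * scale2 R (n%:Z - N%:Z) `^ beta / 4.
  apply: (@le_trans _ _ (leaf_sum N (fun _ t => (k * (2 * t) ^+ 2)%:E) o s)).
    apply: leaf_sum_le => y; rewrite sm; apply: (le_trans (loc y _)).
    have t0 := scale2_gt0 R (n%:Z - N%:Z); rewrite lee_fin /k; move: (scale2 R _) t0 => t t0.
    rewrite powRD ?(gt_eqF t0) ?implybT// powR_mulrn ?(ltW t0)//.
    by rewrite le_eqVlt; apply/orP; left; apply/eqP; field.
  rewrite leaf_sum_area_cst lee_fin; apply: le_trans m3.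
  have -> : k * (2 * s) ^+ 2 = D * s ^+ 2 * s `^ beta * 2 `^ (- beta * N%:~R).
    have kE : scale2 R (n%:Z - N%:Z) `^ beta = s `^ beta * 2 `^ (- beta * N%:~R) :> R.
      by rewrite !scale2_powR -powRD ?pnatr_eq0 ?implybT//; congr (_ `^ _); rewrite intrB; ring.
    by rewrite /k kE; field.
  by rewrite ler_wpM2l// ler_powR ?ler1n// ler_wnM2l ?ler_int ?lez_abs// ltW.
have aen n : {ae area, forall z, square o (scale2 R n%:Z) z -> b z = g z}.
  have mS : measurable (square o (scale2 R n%:Z) : set (plane R)) by exact: measurable_square.
  have h : (\int[area]_(z in square o (scale2 R n%:Z)) `|(cabs (b z - g z))%:E| = 0)%E.
    by rewrite -[RHS](null n); apply: eq_integral => z _; rewrite gee0_abs// lee_fin cabs_ge0.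
  have := (ae_eq_integral_abs area mS (measurable_EFinS mbg)).1 h.
  apply: filterS => z hz zS; have [/ComplexField.Normc.eq0_normc] := hz zS.
  by move/eqP; rewrite subr_eq0 => /eqP.
have aea : {ae area, forall z, forall n : nat, square o (scale2 R n) z -> b z = g z}.
  exact: ae_foralln.
apply: filterS aea => z hz.
have [m [m1 m2 _]] := exists_large_scale `|(z.1 : R)| `|(z.2 : R)| nb (lexx 0) ltr01.
have mm : scale2 R m <= scale2 R `|m|%N by rewrite /scale2 ler_powR ?ler1n// ler_int lez_abs.
by apply: (hz `|m|%N); split; rewrite /= subr0; apply: le_trans mm.
Unshelve. all: by end_near. Qed.

End holder.

(** * Sets resolved by small squares *)

Section density.
Variable R : realType.
Variables (x0 : plane R) (r0 : R) (r0_gt0 : 0 < r0).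
Implicit Types (x y : plane R) (r s : R) (G H : plane R -> R -> \bar R) (E F D : set (plane R)).

Definition small_on_leaves G := forall e : R, 0 < e -> exists n0 : nat, forall n, (n0 <= n)%N ->
  (leaf_sum n G x0 r0 <= e%:E)%E.

Lemma leaf_scale_gt0 n : 0 < r0 / 2 ^+ n. Proof. by rewrite divr_gt0// exprn_gt0. Qed.

Lemma small_on_leavesD G H : small_on_leaves G -> small_on_leaves H ->
  small_on_leaves (fun y s => G y s + H y s)%E.
Proof.
move=> sG sH e e0; have e20 : 0 < e / 2 by rewrite divr_gt0.
have [n1 h1] := sG _ e20; have [n2 h2] := sH _ e20.
exists (maxn n1 n2) => n; rewrite geq_max => /andP[/h1 {}h1 /h2 {}h2].
by rewrite leaf_sumD [e]splitr EFinD; exact: leeD.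
Qed.

Lemma small_on_leaves_le G H : (forall y s, (0 < s)%R -> G y s <= H y s)%E ->
  small_on_leaves H -> small_on_leaves G.
Proof.
move=> GH sH e /sH[n0 h]; exists n0 => n /h; apply: le_trans.
by apply: leaf_sum_le => y; apply: GH; exact: leaf_scale_gt0.
Qed.

Lemma leaf_sum_area n E : measurable E ->
  (leaf_sum n (fun y s => area (square y s `&` E)) x0 r0 <= area (square x0 r0 `&` E))%E.
Proof.
move=> mE; have mS y s : measurable (square y s : set (plane R)) by exact: measurable_square.
have I y s : (\int[area]_(z in square y s) (\1_E z)%:E)%E = area (square y s `&` E).
  by rewrite integral_indic// setIC.
rewrite -I; have -> : (fun y s => area (square y s `&` E)) =
    (fun y s => (\int[area]_(z in square y s) (\1_E z)%:E)%E).
  by apply/funext => y; apply/funext => s; rewrite I.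
by apply: leaf_sum_le_integral.
Qed.

(** Symmetric in [E] and its complement, and subadditive in [E]: this is what makes
    the resolved sets a sigma-algebra. *)
Definition minority E y s : \bar R := mine (area (square y s `&` E)) (area (square y s `\` E)).

(** The sets that unions of small cells approximate in measure. *)
Definition resolved E := measurable E /\ small_on_leaves (minority E).

Lemma resolvedC E : resolved E -> resolved (~` E).
Proof.
move=> [mE sE]; split; first exact: measurableC.
apply: small_on_leaves_le sE => y s _.
by rewrite /minority setDE setCK -setDE minC.
Qed.

Lemma resolvedU E F : resolved E -> resolved F -> resolved (E `|` F).
Proof.
move=> [mE sE] [mF sF]; split; first exact: measurableU.
apply: small_on_leaves_le (small_on_leavesD sE sF) => y s s0.
have mS : measurable (square y s : set (plane R)) by exact: measurable_square.
have mI A : measurable A -> measurable (square y s `&` A) by move=> mA; exact: measurableI.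
have mD A : measurable A -> measurable (square y s `\` A) by move=> mA; exact: measurableD.
have m0 A : (0 <= minority A y s)%E by rewrite le_min !measure_ge0.
rewrite {1}/minority ge_min; apply/orP.
have sub A : measurable A -> A `<=` E `|` F -> (area (square y s `\` (E `|` F)) <= area (square y s `\` A))%E.
  move=> mA AE; apply: le_measure; rewrite ?inE; [apply: mD; exact: measurableU|exact: mD|].
  by move=> z [zS zn]; split => // /AE.
have [hE|hE] := leP (area (square y s `&` E)) (area (square y s `\` E)); last first.
  right; apply: (le_trans (sub _ mE (@subsetUl _ _ _))).
  by rewrite /minority (min_idPr (ltW hE)) leeDl.
have [hF|hF] := leP (area (square y s `&` F)) (area (square y s `\` F)); last first.
  right; apply: (le_trans (sub _ mF (@subsetUr _ _ _))).
  by rewrite /minority (min_idPr (ltW hF)) leeDr.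
left; rewrite /minority (min_idPl hE) (min_idPl hF) setIUr.
by apply: measureU2; exact: mI.
Qed.

Lemma resolved_limit E : measurable E ->
  (forall e : R, 0 < e -> exists F, [/\ resolved F, F `<=` E &
     (area (square x0 r0 `&` (E `\` F)) <= e%:E)%E]) -> resolved E.
Proof.
move=> mE H; split => // e e0; have e20 : 0 < e / 2 by rewrite divr_gt0.
have [F [[mF sF] FE EF]] := H _ e20; have [n0 hn] := sF _ e20.
exists n0 => n /hn {}hn.
apply: (@le_trans _ _ (leaf_sum n (fun y s => minority F y s + area (square y s `&` (E `\` F)))%E x0 r0)).
  apply: leaf_sum_le => y; move: (r0 / _) => s.
  have mS : measurable (square y s : set (plane R)) by exact: measurable_square.
  have [hF|hF] := leP (area (square y s `&` F)) (area (square y s `\` F)).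
    rewrite /minority (min_idPl hF) ge_min; apply/orP; left.
    have -> : square y s `&` E = (square y s `&` F) `|` (square y s `&` (E `\` F)).
      by rewrite -setIUr setUDr setUidr// setDv setD0.
    apply: measureU2; apply: measurableI => //; exact: measurableD.
  rewrite /minority (min_idPr (ltW hF)) ge_min; apply/orP; right.
  apply: (@le_trans _ _ (area (square y s `\` F))); last by rewrite leeDl.
  apply: le_measure; rewrite ?inE; [exact: measurableD|exact: measurableD|].
  by move=> z [zS zE]; split => // /FE.
rewrite leaf_sumD [e]splitr EFinD; apply: leeD => //.
by apply: le_trans EF; apply: leaf_sum_area; exact: measurableD.
Qed.

Lemma resolved0 : resolved set0.
Proof.
split => // e e0; exists 0%N => n _.
apply: (@le_trans _ _ (leaf_sum n (fun y s => area (square y s `&` set0)) x0 r0)).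
  by apply: leaf_sum_le => y; rewrite /minority ge_min lexx.
by apply: (le_trans (leaf_sum_area _ measurable0)); rewrite setI0 measure0 lee_fin ltW.
Qed.

Lemma area_root_fin D : measurable D -> area (square x0 r0 `&` D) \is a fin_num.
Proof.
move=> mD; have mS : measurable (square x0 r0 : set (plane R)) by exact: measurable_square.
rewrite ge0_fin_numE// (@le_lt_trans _ _ (area (square x0 r0)))//; last by rewrite area_square// ltry.
by apply: le_measure; rewrite ?inE//; exact: measurableI.
Qed.

(** A countable union exceeds its finite subunions by sets of small measure in the
    root square. *)
Lemma sigma_algebra_resolved : sigma_algebra setT resolved.
Proof.
split; first exact: resolved0; first by move=> A; rewrite setTD; exact: resolvedC.
move=> A rA; have mA n : measurable (A n) by have [] := rA n.
have mU : measurable (\bigcup_k A k) by exact: bigcup_measurable.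
apply: resolved_limit => // e e0.
pose B n := \big[setU/set0]_(i < n) A i.
have rB n : resolved (B n).
  elim: n => [|n IH]; first by rewrite /B big_ord0; exact: resolved0.
  have -> : B n.+1 = B n `|` A n by rewrite /B big_ord_recr.
  exact: resolvedU.
have mB n : measurable (B n) by case: (rB n).
have BU n : B n `<=` \bigcup_k A k.
  by move=> z; rewrite /B -bigcup_mkord => -[k _ kz]; exists k.
have mS : measurable (square x0 r0 : set (plane R)) by exact: measurable_square.
have cv : (fun n => area (square x0 r0 `&` B n)) @ \oo --> area (square x0 r0 `&` \bigcup_k A k).
  have -> : square x0 r0 `&` \bigcup_k A k = \bigcup_n (square x0 r0 `&` B n).
    rewrite -setI_bigcupr; congr (_ `&` _); apply/seteqP; split; last first.
      by move=> z [n _ /BU].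
    by move=> z [k _ kz]; exists k.+1 => //; rewrite /B big_ord_recr; right.
  apply: (nondecreasing_cvg_mu (mu := @area R)).
  - by move=> n; exact: measurableI.
  - by apply: bigcup_measurable => n _; exact: measurableI.
  - move=> n m nm; apply/subsetPset => z [zS zB]; split => //; move: zB.
    rewrite /B -!bigcup_mkord => -[k kn kz]; exists k => //=; exact: leq_trans kn nm.
move: cv; rewrite -(fineK (area_root_fin mU)) => /fine_cvgP[_ cv].
have /cvgrPdist_le/(_ _ e0)[N _ HN] := cv.
exists (B N); split => //.
have := HN N (leqnn N); rewrite /=.
have -> : square x0 r0 `&` (\bigcup_k A k `\` B N) = (square x0 r0 `&` \bigcup_k A k) `\` (square x0 r0 `&` B N).
  apply/seteqP; split => z.
    by move=> [zS [zU zn]]; split => // -[].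
  by move=> [[zS zU] zn]; split => //; split => // zB; apply: zn.
have fU := area_root_fin mU; have fB := area_root_fin (mB N).
rewrite measureD; [|exact: measurableI|exact: measurableI|by rewrite ltey_eq fU].
have -> : (square x0 r0 `&` \bigcup_k A k) `&` (square x0 r0 `&` B N) = square x0 r0 `&` B N.
  by rewrite setIACA setIid (setIidr (BU N)).
move=> h; have : (area (square x0 r0 `&` \bigcup_k A k) - area (square x0 r0 `&` B N) <= e%:E)%E.
  by rewrite -(fineK fU) -(fineK fB) -EFinB lee_fin; exact: (le_trans (ler_norm _)).
by [].
Qed.

Definition strip (c : plane R -> R) (a d : R) : set (plane R) := [set z | `|c z - a| <= d].

Lemma area_rectangle (a b c d : R) : a <= b -> c <= d ->
  area (`[a, b]%classic `*` `[c, d]%classic : set (plane R)) = ((b - a) * (d - c))%:E.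
Proof.
move=> ab cd; rewrite /area /= product_measure1E; [|exact: measurable_itv..].
have L (u v : R) : u <= v ->
    lebesgue_measure (`[u, v]%classic : set (measurableTypeR R)) = (v - u)%:E.
  move=> uv; have := @lebesgue_measure_itv R (Interval (BLeft u) (BRight v)).
  rewrite /= lte_fin; case: ltP => [_ ->|vu ->]; first by rewrite EFinB.
  have -> : u = v by apply/eqP; rewrite eq_le uv.
  by rewrite subrr.
by rewrite [X in (X * _)%E]L// [X in (_ * X)%E]L// -EFinM.
Qed.

(** Only the cells along the boundary line are split by a half-plane, and they fill
    a strip of width proportional to their size. *)
Lemma resolved_halfplane (c : plane R -> R) (a : R) : measurable_fun setT c ->
  (forall y s z, square y s z -> `|c z - c y| <= s) ->
  (forall d, (0 < d)%R -> area (square x0 r0 `&` strip c a d) <= (4 * r0 * d)%:E)%E ->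
  resolved (c @^-1` `]a, +oo[%classic).
Proof.
move=> mc cS small_strip.
have mE : measurable (c @^-1` `]a, +oo[%classic : set (plane R)).
  by rewrite -[X in measurable X]setTI; apply: mc => //; exact: measurable_itv.
split => // e e0.
have D0 : 0 < e / (8 * r0 ^+ 2) by rewrite divr_gt0// mulr_gt0// exprn_gt0.
have [n0 hn0] : exists n0 : nat, (e / (8 * r0 ^+ 2))^-1 <= n0%:R.
  exists (Num.truncn (e / (8 * r0 ^+ 2))^-1).+1; exact: ltW (truncnS_gt _).
exists n0 => n n0n.
set s := r0 / 2 ^+ n; have s0 : 0 < s by exact: leaf_scale_gt0.
have ms : measurable (strip c a (2 * s)).
  have -> : (strip c a (2 * s)) = c @^-1` `[a - 2 * s, a + 2 * s]%classic.
    by apply/seteqP; split => z; rewrite /strip /= in_itv/= ler_distl.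
  by rewrite -[X in measurable X]setTI; apply: mc => //; exact: measurable_itv.
apply: (@le_trans _ _ (leaf_sum n (fun y s' => area (square y s' `&` strip c a (2 * s))) x0 r0)).
  apply: leaf_sum_le => y; rewrite -/s.
  have mS : measurable (square y s : set (plane R)) by exact: measurable_square.
  rewrite /minority ge_min; apply/orP.
  have [h|h] := leP (c y) a; [left|right]; (apply: le_measure; rewrite ?inE; [|exact: measurableI|]).
  - exact: measurableI.
  - move=> z [zS]; rewrite /= in_itv/= andbT => az; split => //=.
    have := cS _ _ _ zS; rewrite !ler_norml => /andP[h1 h2].
    by rewrite /strip /= ler_norml; apply/andP; split; move: h h1 h2 az s0; clear; lra.
  - exact: measurableD.
  - move=> z [zS]; rewrite /= in_itv/= andbT => /negP; rewrite -leNgt => az; split => //=.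
    have := cS _ _ _ zS; rewrite !ler_norml => /andP[h1 h2].
    by rewrite /strip /= ler_norml; apply/andP; split; move: h h1 h2 az s0; clear; lra.
apply: (le_trans (leaf_sum_area _ ms)).
apply: (le_trans (small_strip (2 * s) _)); first by rewrite mulr_gt0.
rewrite lee_fin /s.
have -> : 4 * r0 * (2 * (r0 / 2 ^+ n)) = 8 * r0 ^+ 2 / 2 ^+ n by ring.
have n2 : (e / (8 * r0 ^+ 2))^-1 <= 2 ^+ n.
  apply: (le_trans hn0); rewrite -natrX ler_nat; apply: (leq_trans n0n).
  exact: ltnW (ltn_expl _ _).
rewrite ler_pdivrMr ?exprn_gt0// -ler_pdivrMl// mulrC.
by rewrite invf_div in n2.
Qed.

Lemma square_strip1 (a d : R) : 0 < d ->
  (area (square x0 r0 `&` strip fst a d) <= (4 * r0 * d)%:E)%E.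
Proof.
move=> d0; have ad : a - d <= a + d by lra.
have rr : (x0.2 : R) - r0 <= (x0.2 : R) + r0 by move: (ltW r0_gt0); clear; lra.
apply: (@le_trans _ _ (area (`[a - d, a + d]%classic `*` `[(x0.2 : R) - r0, (x0.2 : R) + r0]%classic : set (plane R)))).
  apply: le_measure; rewrite ?inE.
  - apply: measurableI; first exact: measurable_square.
    have -> : strip fst a d = fst @^-1` `[a - d, a + d]%classic.
      by apply/seteqP; split => z; rewrite /strip /= in_itv/= ler_distl.
    by rewrite -[X in measurable X]setTI; apply: measurable_fst => //; exact: measurable_itv.
  - by apply: measurableX; exact: measurable_itv.
  - by move=> z [[_ z2] z1]; split; rewrite /= in_itv/= -ler_distl.
rewrite area_rectangle// lee_fin le_eqVlt; apply/orP; left; apply/eqP; ring.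
Qed.

Lemma square_strip2 (a d : R) : 0 < d ->
  (area (square x0 r0 `&` strip snd a d) <= (4 * r0 * d)%:E)%E.
Proof.
move=> d0; have ad : a - d <= a + d by lra.
have rr : (x0.1 : R) - r0 <= (x0.1 : R) + r0 by move: (ltW r0_gt0); clear; lra.
apply: (@le_trans _ _ (area (`[(x0.1 : R) - r0, (x0.1 : R) + r0]%classic `*` `[a - d, a + d]%classic : set (plane R)))).
  apply: le_measure; rewrite ?inE.
  - apply: measurableI; first exact: measurable_square.
    have -> : strip snd a d = snd @^-1` `[a - d, a + d]%classic.
      by apply/seteqP; split => z; rewrite /strip /= in_itv/= ler_distl.
    by rewrite -[X in measurable X]setTI; apply: measurable_snd => //; exact: measurable_itv.
  - by apply: measurableX; exact: measurable_itv.
  - by move=> z [[z1 _] z2]; split; rewrite /= in_itv/= -ler_distl.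
rewrite area_rectangle// lee_fin le_eqVlt; apply/orP; left; apply/eqP; ring.
Qed.

(** The Borel sets of the plane are generated by half-planes. *)
Lemma resolved_measurable E : measurable E -> resolved E.
Proof.
move=> mE; apply: (smallest_sub sigma_algebra_resolved _ mE).
have gen (c : plane R -> R) : (forall a, resolved (c @^-1` `]a, +oo[%classic)) ->
    forall B : set (measurableTypeR R), measurable B -> resolved (c @^-1` B).
  move=> cr B mB.
  have {mB} : (@RGenOInfty.G R).-sigma.-measurable (B : set R).
    by rewrite -RGenOInfty.measurableE.
  suff sub : <<s @RGenOInfty.G R >> `<=` [set B : set R | resolved (c @^-1` B)] by exact: sub.
  apply: smallest_sub; last first.
    by move=> _ [a ->]; exact: cr.
  have [s0 sC sU] := sigma_algebra_resolved.
  split => /=.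
  - by rewrite preimage_set0.
  - by move=> A /sC; rewrite !setTD preimage_setC.
  - by move=> A /sU; rewrite preimage_bigcup.
move=> A [] [B mB <-]; rewrite setTI.
  apply: gen mB => a; apply: resolved_halfplane; [exact: measurable_fst|by move=> ? ? ? []|].
  exact: square_strip1.
apply: gen mB => a; apply: resolved_halfplane; [exact: measurable_snd|by move=> ? ? ? []|].
exact: square_strip2.
Qed.

End density.

(** * Approximation by functions constant on small squares *)

Section approximation.
Import HBSimple.
Variable R : realType.
Variables (x0 : plane R) (r0 : R) (r0_gt0 : 0 < r0).
Implicit Types (x y : plane R) (r s : R) (f g : plane R -> R) (E : set (plane R)).

Definition leafwise_approximable f := forall e : R, 0 < e ->
  exists c : plane R -> R -> R, exists n0 : nat, forall n, (n0 <= n)%N ->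
  (leaf_sum n (fun y s => \int[area]_(z in square y s) (`|f z - c y s|%R)%:E) x0 r0 <= e%:E)%E.

Lemma measurable_abs_sub f (c : R) : measurable_fun setT f -> measurable_fun setT (fun z => `|f z - c|).
Proof. by move=> mf; apply: measurableT_comp => //; exact: measurable_funB. Qed.

Lemma approximable_indic E : measurable E -> leafwise_approximable (\1_E).
Proof.
move=> mE e /((resolved_measurable x0 r0_gt0 mE).2)[n0 H].
exists (fun y s => if (area (square y s `&` E) <= area (square y s `\` E))%E then 0 else 1).
exists n0 => n /H; apply: le_trans; apply: leaf_sum_le => y; move: (r0 / _) => s.
have mS : measurable (square y s : set (plane R)) by exact: measurable_square.
rewrite /minority; case: (leP (area (square y s `&` E)) (area (square y s `\` E))) => _.
  rewrite le_eqVlt; apply/orP; left; apply/eqP; rewrite setIC -integral_indic//.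
  by apply: eq_integral => z _; rewrite subr0 ger0_norm// indicE.
rewrite le_eqVlt; apply/orP; left; apply/eqP; rewrite setDE setIC -integral_indic//; last exact: measurableC.
by apply: eq_integral => z _; rewrite !indicE in_setC; case: (z \in E); rewrite /= ?subrr ?normr0// sub0r normrN normr1.
Qed.

Lemma approximable_affine (a : R) f g : measurable_fun setT f -> measurable_fun setT g ->
  leafwise_approximable f -> leafwise_approximable g -> leafwise_approximable (fun z => a * f z + g z).
Proof.
move=> mf mg Hf Hg e e0.
have a0 : 0 < 2 * (`|a| + 1) by rewrite mulr_gt0// ltr_wpDl.
have e1 : 0 < e / (2 * (`|a| + 1)) by rewrite divr_gt0.
have e2 : 0 < e / 2 by rewrite divr_gt0.
have [c [n1 H1]] := Hf _ e1; have [c' [n2 H2]] := Hg _ e2.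
exists (fun y s => a * c y s + c' y s), (maxn n1 n2) => n; rewrite geq_max => /andP[/H1 {}H1 /H2 {}H2].
have I0 h (k : plane R -> R -> R) y s : (0 <= \int[area]_(z in square y s) (`|h z - k y s|%R)%:E)%E.
  by apply: integral_ge0 => z _; rewrite lee_fin.
apply: (@le_trans _ _ (leaf_sum n (fun y s => `|a|%:E * \int[area]_(z in square y s) (`|f z - c y s|%R)%:E +
     \int[area]_(z in square y s) (`|g z - c' y s|%R)%:E) x0 r0)%E).
  apply: leaf_sum_le => y; move: (r0 / _) => s.
  have mS : measurable (square y s : set (plane R)) by exact: measurable_square.
  have m1 := measurable_abs_sub (c y s) mf; have m2 := measurable_abs_sub (c' y s) mg.
  rewrite -(integralZ_EFin area mS m1 (fun=> normr_ge0 _) (normr_ge0 a)).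
  rewrite -(integralD_EFin_ge0 area mS _ m2 _ (fun=> normr_ge0 _)); last 2 first.
  - by apply: measurable_funM => //; exact: measurable_cst.
  - by move=> z; rewrite mulr_ge0.
  apply: le_integral_EFin => //.
  - by apply: measurable_abs_sub; apply: measurable_funD => //; apply: measurable_funM => //; exact: measurable_cst.
  - by apply: measurable_funD => //; apply: measurable_funM => //; exact: measurable_cst.
  move=> z _; rewrite opprD addrACA -mulrBr -normrM; exact: ler_normD.
rewrite leaf_sumD leaf_sumZ//.
apply: (@le_trans _ _ (`|a|%:E * (e / (2 * (`|a| + 1)))%:E + (e / 2)%:E)%E).
  by apply: leeD => //; apply: lee_wpmul2l => //; rewrite lee_fin.
rewrite -EFinM -EFinD lee_fin.
have -> : `|a| * (e / (2 * (`|a| + 1))) = e / 2 * (`|a| / (`|a| + 1)).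
  by field; rewrite gt_eqF// ltr_wpDl.
have : `|a| / (`|a| + 1) <= 1 by rewrite ler_pdivrMr ?mul1r ?lerDl// ltr_wpDl.
by move=> h; rewrite [leRHS]splitr lerD2r -[leRHS]mulr1 ler_wpM2l// ltW.
Qed.

Lemma approximable_limit f : measurable_fun setT f ->
  (forall e : R, 0 < e -> exists g, [/\ measurable_fun setT g, leafwise_approximable g &
    (\int[area]_(z in square x0 r0) (`|f z - g z|%R)%:E <= e%:E)%E]) -> leafwise_approximable f.
Proof.
move=> mf H e e0; have e2 : 0 < e / 2 by rewrite divr_gt0.
have [g [mg ag fg]] := H _ e2; have [c [n0 Hc]] := ag _ e2.
have mfg : measurable_fun setT (fun z => `|f z - g z|).
  by apply: measurableT_comp => //; exact: measurable_funB.
exists c, n0 => n /Hc {}Hc.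
apply: (@le_trans _ _ (leaf_sum n (fun y s => \int[area]_(z in square y s) (`|f z - g z|%R)%:E +
     \int[area]_(z in square y s) (`|g z - c y s|%R)%:E) x0 r0)%E).
  apply: leaf_sum_le => y; move: (r0 / _) => s.
  have mS : measurable (square y s : set (plane R)) by exact: measurable_square.
  have m1 := measurable_abs_sub (c y s) mf; have m2 := measurable_abs_sub (c y s) mg.
  rewrite -(integralD_EFin_ge0 area mS mfg m2 (fun=> normr_ge0 _) (fun=> normr_ge0 _)).
  apply: le_integral_EFin => //; first exact: measurable_funD.
  by move=> z _; exact: ler_distD.
rewrite leaf_sumD [e]splitr EFinD; apply: leeD => //.
by apply: le_trans fg; exact: leaf_sum_le_integral.
Qed.

Lemma approximable_sfun (g : {sfun (plane R) >-> R}) : leafwise_approximable (fun z => g z).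
Proof.
have [ys gE] : exists ys : seq R, forall z, g z = \sum_(y <- ys) (y * \1_(g @^-1` [set y]) z).
  exists (finmap.enum_fset (fset_set (range g))) => z; rewrite [LHS]fimfunE.
  by rewrite fsbig_finite.
have mP (y : R) : measurable (g @^-1` [set y]) by exact: measurable_sfunP.
move/funext: gE => ->; elim: ys => [|y ys IH].
  have -> : (fun z => \sum_(y <- [::]) (y * \1_(g @^-1` [set y]) z)) = \1_set0 :> (plane R -> R).
    by apply/funext => z; rewrite big_nil indicE in_set0.
  exact: approximable_indic.
have -> : (fun z => \sum_(k <- y :: ys) (k * \1_(g @^-1` [set k]) z)) =
    (fun z => y * \1_(g @^-1` [set y]) z + \sum_(k <- ys) (k * \1_(g @^-1` [set k]) z)) :> (plane R -> R).
  by apply/funext => z; rewrite big_cons.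
apply: approximable_affine => //.
- by apply: measurable_sum => k; apply: measurable_funM => //; exact: measurable_cst.
- exact: approximable_indic.
Qed.

(** By linearity from indicator functions, and by density of the simple functions in
    [L^1]. This serves instead of the differentiation theorem: only the [L^1]
    distance to the means on small cells is needed below. *)
Lemma approximable_integrable f : measurable_fun setT f ->
  area.-integrable (square x0 r0) (EFin \o f) -> leafwise_approximable f.
Proof.
move=> mf fi; apply: approximable_limit => // e e0.
have mS : measurable (square x0 r0 : set (plane R)) by exact: measurable_square.
have [g [gi _ gf]] := approximation_sfun_integrable mS fi.
have mg n : measurable_fun setT (fun z => g n z) by exact: measurable_funPT.
have mfg n : measurable_fun setT (fun z => `|f z - g n z|).
  by apply: measurableT_comp => //; exact: measurable_funB.
have /(_ _)/cvgrPdist_le/(_ _ e0)[N _ HN] := fine_fcvg gf.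
have fin n : (\int[area]_(z in square x0 r0) (`|f z - g n z|%R)%:E)%E \is a fin_num.
  apply: (integrable_fin_num mS); have := integrable_abse (integrableB mS fi (gi n)).
  by apply: eq_integrable.
exists (fun z => g N z); split => //; first exact: approximable_sfun.
have := HN N (leqnn N); rewrite /= sub0r normrN => h.
by rewrite -(fineK (fin N)) lee_fin (le_trans (ler_norm _)).
Qed.

End approximation.

(** * Powers of the means on small squares *)

Section john_nirenberg.
Variable R : realType.
Implicit Types (x y : plane R) (r s : R) (b : plane R -> R[i]) (c : R[i]).

Lemma powR_le_add (t u v w : R) : 0 <= t -> 0 <= u -> 0 <= v -> 0 <= w -> u <= v + w ->
  u `^ t <= 2 `^ t * (v `^ t + w `^ t).
Proof.
move=> t0 u0 v0 w0 uvw.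
have um : u <= 2 * Num.max v w.
  rewrite (le_trans uvw)// mulr_natl mulr2n; apply: lerD; by rewrite le_max lexx ?orbT.
apply: (le_trans (le_powRl t0 u0 um)).
rewrite powRM//; last by rewrite le_max v0.
rewrite ler_wpM2l ?powR_ge0//.
by case: (leP v w) => _; rewrite ?lerDl ?lerDr powR_ge0.
Qed.

(** One integral bounds [b - c], and twice that integral bounds the distance from [c]
    to the mean. *)
Lemma mean_best_constant b c x r : L1loc b -> 0 < r ->
  (\int[area]_(z in square x r) (cabs (b z - average (square x r) b))%:E <=
   3%:E * \int[area]_(z in square x r) (cabs (b z - c))%:E)%E.
Proof.
move=> bL r0; have mb : cmeasurable b by case: bL.
have mS : measurable (square x r : set (plane R)) by exact: measurable_square.
have m1 := measurable_cabs_sub c mb.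
have q0 : 0 < (2 * r) ^+ 2 by rewrite exprn_gt0// mulr_gt0.
set A := average (square x r) b.
apply: (@le_trans _ _ (\int[area]_(z in square x r) (cabs (b z - c) + cabs (c - A))%:E)%E).
  apply: le_integral_EFin => //.
  - exact: measurable_cabs_sub.
  - by apply: measurable_funD => //; exact: measurable_cst.
  - by move=> z _; exact: cabs_ge0.
  - by move=> z _; exact: cabs_dist_triangle.
rewrite (integralD_EFin_ge0 area mS m1 (measurable_cst _) (fun=> cabs_ge0 _) (fun=> cabs_ge0 _)).
have -> : (\int[area]_(z in square x r) (cst (cabs (c - A)) z)%:E = (cabs (c - A))%:E * area (square x r))%E.
  exact: (integral_cst area mS (cabs (c - A))%:E).
have -> : (3%:E = 1%:E + 2%:E :> \bar R)%E by rewrite -EFinD; congr EFin; lra.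
rewrite ge0_muleDl ?lee_fin// mul1e leeD2l// area_square// cabs_distC.
apply: (@le_trans _ _ ((2 / (2 * r) ^+ 2)%:E * (\int[area]_(z in square x r) (cabs (b z - c))%:E) * ((2 * r) ^+ 2)%:E)%E).
  by apply: lee_wpmul2r; [rewrite lee_fin ltW|exact: average_sub_le].
rewrite muleAC -EFinM divfK// gt_eqF//.
Qed.

Definition osc_mean b y s : \bar R :=
  (\int[area]_(z in square y s) (cabs (b z - average (square y s) b))%:E)%E.

(** By [mean_best_constant] the means do as well as any constants on the cells. *)
Lemma osc_mean_small b x r (e : R) : L1loc b -> 0 < r -> 0 < e ->
  exists n, (leaf_sum n (osc_mean b) x r <= e%:E)%E.
Proof.
move=> bL r0 e0; have e6 : 0 < e / 6 by rewrite divr_gt0.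
have [mr mi] : cmeasurable b by case: bL.
have [ir ii] := cintegrable_square x r bL.
have [cr [n1 H1]] := approximable_integrable r0 mr ir e6.
have [ci [n2 H2]] := approximable_integrable r0 mi ii e6.
exists (maxn n1 n2).
have {}H1 := H1 (maxn n1 n2) (leq_maxl _ _); have {}H2 := H2 (maxn n1 n2) (leq_maxr _ _).
move: (maxn n1 n2) H1 H2 => n H1 H2.
have I0 (h : plane R -> R) (k : plane R -> R -> R) y s :
    (0 <= \int[area]_(z in square y s) (`|h z - k y s|%R)%:E)%E.
  by apply: integral_ge0 => z _; rewrite lee_fin.
apply: (@le_trans _ _ (leaf_sum n (fun y s => 3%:E *
   (\int[area]_(z in square y s) (`|complex.Re (b z) - cr y s|%R)%:E +
    \int[area]_(z in square y s) (`|complex.Im (b z) - ci y s|%R)%:E)) x r)%E).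
  apply: leaf_sum_le => y; have := divr_gt0 r0 (exprn_gt0 n (ltr0Sn R 1)); move: (r / _) => s s0.
  apply: (le_trans (mean_best_constant (Complex (cr y s) (ci y s)) y bL s0)).
  apply: lee_wpmul2l => //.
  have mS : measurable (square y s : set (plane R)) by exact: measurable_square.
  have m1 := measurable_abs_sub (cr y s) mr; have m2 := measurable_abs_sub (ci y s) mi.
  rewrite -(integralD_EFin_ge0 area mS m1 m2 (fun=> normr_ge0 _) (fun=> normr_ge0 _)).
  apply: le_integral_EFin => //.
  - by apply: measurable_cabs_sub; case: bL.
  - exact: measurable_funD.
  - by move=> z _; exact: cabs_ge0.
  - by move=> z _; apply: (le_trans (cabs_le_ReIm _)); case: (b z).
rewrite leaf_sumZ//; last by move=> y s _; apply: adde_ge0.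
rewrite leaf_sumD.
apply: (@le_trans _ _ (3%:E * ((e / 6)%:E + (e / 6)%:E))%E).
  by apply: lee_wpmul2l => //; exact: leeD.
by rewrite -EFinD -EFinM lee_fin; lra.
Qed.

Definition mean_power b c (t : R) y s : \bar R :=
  (cabs (average (square y s) b - c) `^ t * (2 * s) ^+ 2)%:E.

Lemma mean_power_recenter n b c c' (t : R) x r : 0 <= t -> 0 < r ->
  (leaf_sum n (mean_power b c t) x r <=
   (2 `^ t)%:E * (leaf_sum n (mean_power b c' t) x r + (cabs (c' - c) `^ t * (2 * r) ^+ 2)%:E))%E.
Proof.
move=> t0 r0; rewrite -(leaf_sum_area_cst n _ x) -leaf_sumD.
have P0 s : 0 <= (2 * s) ^+ 2 by exact: sqr_ge0.
rewrite -leaf_sumZ ?powR_ge0//; last first.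
  by move=> y s _; apply: adde_ge0; rewrite lee_fin mulr_ge0 ?powR_ge0 ?P0.
apply: leaf_sum_le => y; move: (r / _) => s.
rewrite /mean_power -EFinD -EFinM lee_fin -mulrDl mulrA.
rewrite ler_wpM2r//; apply: powR_le_add; rewrite ?cabs_ge0//.
exact: cabs_dist_triangle.
Qed.

(** Stopping-time argument, as an induction over the generations.  A child on which
    [|b - c|] has mean above [lam] is charged to the mass of [|b - c|] that it
    carries, its own oscillation being controlled by the induction hypothesis
    centred at its own mean; the other children satisfy the hypothesis again. *)
Lemma mean_power_bounded b (t B : R) : L1loc b -> 1 <= t -> 0 < B ->
  (forall x r, (0 < r)%R -> osc_mean b x r <= (B * (2 * r) ^+ 2)%:E)%E ->
  exists C : R, 0 <= C /\ forall n x r, 0 < r ->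
    (leaf_sum n (mean_power b (average (square x r) b) t) x r <= (C * (2 * r) ^+ 2)%:E)%E.
Proof.
move=> bL t1 B0 bB; have t0 : 0 <= t by lra.
(* For this threshold [kap * B] is half of [C + (8 * lam) `^ t], and [C] is then
   chosen so that the induction closes. *)
pose lam := 2 * 2 `^ t * B.
have lam0 : 0 < lam by rewrite !mulr_gt0// powR_gt0.
pose C := 2 * (2 * lam) `^ t + (8 * lam) `^ t.
have C0 : 0 <= C by rewrite addr_ge0 ?mulr_ge0 ?powR_ge0.
pose kap := 2 `^ t * (C + (8 * lam) `^ t) / lam.
have kap0 : 0 <= kap by rewrite divr_ge0 ?(ltW lam0)// mulr_ge0 ?powR_ge0// addr_ge0 ?powR_ge0.
pose I c x r : \bar R := (\int[area]_(z in square x r) (cabs (b z - c))%:E)%E.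
have I0 c x r : (0 <= I c x r)%E by apply: integral_ge0 => z _; rewrite lee_fin cabs_ge0.
have mbc c := measurable_cabs_sub c (proj1 bL).
pose P n := forall x r c, 0 < r -> (I c x r <= (lam * (2 * r) ^+ 2)%:E)%E ->
  (leaf_sum n (mean_power b c t) x r <= ((2 * lam) `^ t * (2 * r) ^+ 2)%:E + kap%:E * I c x r)%E.
have cl n : P n -> forall x r, 0 < r ->
    (leaf_sum n (mean_power b (average (square x r) b) t) x r <= (C * (2 * r) ^+ 2)%:E)%E.
  move=> Pn x r r0; have q0 : 0 < (2 * r) ^+ 2 by rewrite exprn_gt0// mulr_gt0.
  have Blam : B <= lam.
    rewrite /lam -[leLHS]mul1r ler_wpM2r ?(ltW B0)//.
    have : 1 <= 2 `^ t :> R by rewrite -[leLHS](powRr0 2) ler_powR ?ler1n.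
    by move: (2 `^ t) => u; lra.
  apply: (le_trans (Pn x r _ r0 _)).
    by apply: (le_trans (bB x r r0)); rewrite lee_fin ler_wpM2r// ltW.
  apply: (@le_trans _ _ (((2 * lam) `^ t * (2 * r) ^+ 2)%:E + kap%:E * (B * (2 * r) ^+ 2)%:E)%E).
    by apply: leeD => //; apply: lee_wpmul2l; [rewrite lee_fin|exact: bB].
  rewrite -EFinM -EFinD lee_fin (mulrA kap) -mulrDl ler_wpM2r ?(ltW q0)//.
  have -> : kap * B = (C + (8 * lam) `^ t) / 2.
    have l2 : (2 : R) `^ t != 0 by rewrite gt_eqF// powR_gt0.
    have kE (X : R) : 2 `^ t * X / lam * B = X / 2.
      by rewrite /lam; field; rewrite l2 (gt_eqF B0).
    exact: kE.
  rewrite /C; lra.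
suff PP n : P n by exists C; split => // n x r r0; exact: (cl n (PP n)).
elim: n => [|n IH] x r c r0 Ic.
  have q0 : 0 < (2 * r) ^+ 2 by rewrite exprn_gt0// mulr_gt0.
  apply: (@le_trans _ _ ((2 * lam) `^ t * (2 * r) ^+ 2)%:E); last by rewrite leeDl// mule_ge0// lee_fin.
  rewrite /= lee_fin ler_wpM2r ?(ltW q0)//; apply: le_powRl; rewrite ?cabs_ge0//.
  rewrite -lee_fin; apply: (le_trans (average_sub_le x c bL r0)).
  apply: (@le_trans _ _ ((2 / (2 * r) ^+ 2)%:E * (lam * (2 * r) ^+ 2)%:E)%E).
    by apply: lee_wpmul2l => //; rewrite lee_fin divr_ge0// ltW.
  by rewrite -EFinM lee_fin le_eqVlt; apply/orP; left; apply/eqP; field; rewrite gt_eqF.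
have r20 : 0 < r / 2 by rewrite divr_gt0.
have q0 : 0 < (2 * (r / 2)) ^+ 2 by rewrite exprn_gt0// mulr_gt0.
pose G y : \bar R := (((2 * lam) `^ t * (2 * (r / 2)) ^+ 2)%:E + kap%:E * I c y (r / 2)%R)%E.
suff H : (leaf_sum n.+1 (mean_power b c t) x r <= \sum_(j : bool * bool) G (child x r j))%E.
  apply: (le_trans H); rewrite /G big_split /=; apply: leeD.
    rewrite sumEFin big_const iter_addr_0 card_prod card_bool lee_fin.
    by rewrite -mulr_natr le_eqVlt; apply/orP; left; apply/eqP; field.
  rewrite -ge0_sume_distrr//; apply: lee_wpmul2l; rewrite ?lee_fin//.
  by apply: children_le_integral => // z; exact: cabs_ge0.
apply: lee_sum => j _; rewrite /G; set y := child x r j.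
have [h|h] := leP (I c y (r / 2)) (lam * (2 * (r / 2)) ^+ 2)%:E; first exact: IH.
(* A stopped child: its mean differs from [c] by at most [8 lam], since its parent is not stopped. *)
have d8 : cabs (average (square y (r / 2)) b - c) <= 8 * lam.
  rewrite -lee_fin; apply: (le_trans (average_sub_le y c bL r20)).
  apply: (@le_trans _ _ ((2 / (2 * (r / 2)) ^+ 2)%:E * (lam * (2 * r) ^+ 2)%:E)%E).
    apply: lee_wpmul2l; first by rewrite lee_fin divr_ge0// ltW.
    apply: le_trans Ic; apply: ge0_subset_integral => //.
    - exact: measurable_square.
    - exact: measurable_square.
    - exact: measurable_EFinS.
    - by move=> z _; rewrite lee_fin cabs_ge0.
    - exact: child_sub.
  by rewrite -EFinM lee_fin le_eqVlt; apply/orP; left; apply/eqP; field; rewrite gt_eqF.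
apply: (le_trans (mean_power_recenter n b c (average (square y (r / 2)) b) y t0 r20)).
apply: (@le_trans _ _ ((2 `^ t)%:E * ((C * (2 * (r / 2)) ^+ 2)%:E + ((8 * lam) `^ t * (2 * (r / 2)) ^+ 2)%:E))%E).
  apply: lee_wpmul2l; first by rewrite lee_fin powR_ge0.
  apply: leeD; first exact: cl.
  rewrite lee_fin ler_wpM2r ?(ltW q0)//; apply: le_powRl; rewrite ?cabs_ge0//.
apply: (@le_trans _ _ (kap%:E * I c y (r / 2)%R)%E); last first.
  by rewrite leeDr// lee_fin mulr_ge0 ?powR_ge0// ltW.
apply: (@le_trans _ _ (kap%:E * (lam * (2 * (r / 2)) ^+ 2)%:E)%E); last first.
  by apply: lee_wpmul2l; [rewrite lee_fin|exact: ltW].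
rewrite -EFinD -!EFinM lee_fin /kap le_eqVlt; apply/orP; left; apply/eqP.
by field; rewrite gt_eqF.
Qed.

End john_nirenberg.

(** * The John-Nirenberg inequality *)

Section truncation.
Context d (T : measurableType d) (R : realType).
Variable mu : {measure set T -> \bar R}.

Lemma integral_le_truncations (D : set T) (F : T -> R) (A : \bar R) : measurable D ->
  measurable_fun setT F -> (forall x, 0 <= F x) ->
  (forall N : nat, (\int[mu]_(x in D) (Num.min (F x) N%:R)%:E <= A)%E) ->
  (\int[mu]_(x in D) (F x)%:E <= A)%E.
Proof.
move=> mD mF F0 H; pose h n x := (Num.min (F x) n%:R)%:E.
have mh n : measurable_fun D (h n).
  by apply: measurable_EFinS; apply: measurable_minr => //; exact: measurable_cst.
have h0 n x : D x -> (0 <= h n x)%E by move=> _; rewrite lee_fin le_min F0 ler0n.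
have ndh x : D x -> nondecreasing_seq (h ^~ x).
  move=> _ n m nm; rewrite lee_fin le_min ge_min lexx /= ge_min; apply/orP; right.
  by rewrite ler_nat.
have -> : (\int[mu]_(x in D) (F x)%:E = limn (fun n => \int[mu]_(x in D) h n x))%E.
  rewrite -(monotone_convergence mu mD mh h0 ndh).
  apply: eq_integral => x _; apply/esym/cvg_lim => //; apply: cvg_near_cst; near=> n.
  congr EFin; apply/min_idPl; near: n; exact: nbhs_infty_ger.
apply: lime_le; last by apply: nearW => n; exact: H.
apply: ereal_nondecreasing_is_cvgn => n m nm; apply: ge0_le_integral => //.
- by move=> x Dx; exact: h0.
- by move=> x Dx; exact: ndh.
Unshelve. all: by end_near. Qed.

End truncation.

Section bmo_power.
Variable R : realType.
Implicit Types (x y : plane R) (r s : R) (b : plane R -> R[i]).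

Lemma truncated_power (t N w : R) : 1 <= t -> 0 <= w -> 0 <= N ->
  Num.min (w `^ t) N <= N `^ ((t - 1) / t) * w.
Proof.
move=> t1 w0 N0; have t0 : 0 < t by lra.
have NE (u : R) : 0 <= u -> (u `^ t^-1) `^ t = u by move=> u0; rewrite -powRrM mulVf ?gt_eqF// powRr1.
have t10 : 0 <= t - 1 by lra.
pose m := N `^ t^-1; have m0 : 0 <= m by exact: powR_ge0.
have -> : N `^ ((t - 1) / t) = m `^ (t - 1) by rewrite /m -powRrM mulrC.
have mN : N = m `^ (t - 1) * m by rewrite mulrC mulr_powRB1 ?NE.
have [h|h] := leP w m.
  rewrite ge_min; apply/orP; left; rewrite -(mulr_powRB1 w0 t0) mulrC ler_wpM2r//.
  exact: le_powRl.
by rewrite ge_min; apply/orP; right; rewrite [leLHS]mN ler_wpM2l ?powR_ge0// ltW.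
Qed.

Lemma truncated_power_add (t N u v w : R) : 1 <= t -> 0 <= u -> 0 <= v -> 0 <= w -> 0 <= N ->
  u <= v + w -> Num.min (u `^ t) N <= 2 `^ t * (v `^ t + Num.min (w `^ t) N).
Proof.
move=> t1 u0 v0 w0 N0 uvw; have t0 : 0 <= t by lra.
have h := powR_le_add t0 u0 v0 w0 uvw.
have p1 : 1 <= 2 `^ t :> R by rewrite -[leLHS](powRr0 2) ler_powR ?ler1n.
move: (powR_ge0 v t) (powR_ge0 w t) h p1; move: (2 `^ t) (u `^ t) (v `^ t) (w `^ t) => c U V W V0 W0 h c1.
have [WN|NW] := leP W N; first by rewrite ge_min h.
rewrite ge_min; apply/orP; right; move: V0 N0 c1; clear; nra.
Qed.

(** John-Nirenberg: the means on small cells have [t]-th powers bounded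
    uniformly in the generation, and the truncated power of [|b - c|] differs from
    that of the means by a multiple of an [L^1] distance that tends to [0]. *)
Theorem john_nirenberg b (t B : R) : L1loc b -> 1 <= t -> 0 < B ->
  (forall x r, (0 < r)%R -> osc_mean b x r <= (B * (2 * r) ^+ 2)%:E)%E ->
  exists2 A : R, 0 <= A & forall x r, 0 < r ->
    (\int[area]_(z in square x r) (cabs (b z - average (square x r) b) `^ t)%:E <= (A * r ^+ 2)%:E)%E.
Proof.
move=> bL t1 B0 bB; have [C [C0 HC]] := mean_power_bounded bL t1 B0 bB.
have t0 : 0 <= t by lra.
have mb : cmeasurable b by case: bL.
exists (2 `^ t * C * 4) => [|x r r0]; first by rewrite !mulr_ge0 ?powR_ge0.
have mS y s : measurable (square y s : set (plane R)) by exact: measurable_square.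
set c := average _ b.
have m1 c' : measurable_fun setT (fun z => cabs (b z - c')) := measurable_cabs_sub c' mb.
have mp : measurable_fun setT (fun z => cabs (b z - c) `^ t) by exact: measurable_powRf.
apply: integral_le_truncations => // [z|N]; first exact: powR_ge0.
pose L := 2 `^ t * N%:R `^ ((t - 1) / t) : R.
have L0 : 0 <= L by rewrite mulr_ge0 ?powR_ge0.
apply/lee_addgt0Pr => e e0.
have e1 : 0 < e / (L + 1) by rewrite divr_gt0// ltr_wpDl.
have [n Hn] := osc_mean_small x bL r0 e1.
have mmin : measurable_fun setT (fun z => Num.min (cabs (b z - c) `^ t) N%:R).
  by apply: measurable_minr => //; exact: measurable_cst.
have min0 z : 0 <= Num.min (cabs (b z - c) `^ t) N%:R by rewrite le_min powR_ge0 ler0n.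
apply: (le_trans (integral_le_leaf_sum n x r0 mmin min0)).
apply: (@le_trans _ _ (leaf_sum n (fun y s => (2 `^ t)%:E * mean_power b c t y s + L%:E * osc_mean b y s) x r)%E).
  apply: leaf_sum_le => y; have := divr_gt0 r0 (exprn_gt0 n (ltr0Sn R 1)); move: (r / _) => s s0.
  set a := average (square y s) b.
  pose v := 2 `^ t * cabs (a - c) `^ t.
  have v0 : 0 <= v by rewrite mulr_ge0 ?powR_ge0.
  apply: (@le_trans _ _ (\int[area]_(z in square y s) (L * cabs (b z - a) + v)%:E)%E).
    apply: le_integral_EFin => //.
    - by apply: measurable_funD; [apply: measurable_funM => //; exact: measurable_cst|exact: measurable_cst].
    move=> z _.
    have -> : L * cabs (b z - a) + v = 2 `^ t * (cabs (a - c) `^ t + N%:R `^ ((t - 1) / t) * cabs (b z - a)).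
      by rewrite /L /v; ring.
    apply: (@le_trans _ _ (2 `^ t * (cabs (a - c) `^ t + Num.min (cabs (b z - a) `^ t) N%:R))); last first.
      by rewrite ler_wpM2l ?powR_ge0// lerD2l; apply: truncated_power; rewrite ?cabs_ge0.
    apply: truncated_power_add; rewrite ?cabs_ge0//.
    by rewrite (addrC (cabs (a - c))); exact: cabs_dist_triangle.
  have mL : measurable_fun setT (fun z => L * cabs (b z - a)).
    by apply: measurable_funM => //; exact: measurable_cst.
  rewrite (integralD_EFin_ge0 area (mS y s) mL (measurable_cst v) _ (fun=> v0)); last first.
    by move=> z; rewrite mulr_ge0// cabs_ge0.
  rewrite (integralZ_EFin area (mS y s) (m1 a) (fun=> cabs_ge0 _) L0) addeC.
  have -> : (\int[area]_(z in square y s) (cst v z)%:E = v%:E * area (square y s))%E.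
    exact: (integral_cst area (mS y s) v%:E).
  apply: leeD => //; rewrite area_square// /mean_power -!EFinM lee_fin.
  by rewrite (mulrA (2 `^ t)).
have O0 y s : (0 <= osc_mean b y s)%E by apply: integral_ge0 => z _; rewrite lee_fin cabs_ge0.
have P0 y s : (0 <= mean_power b c t y s)%E by rewrite lee_fin mulr_ge0 ?powR_ge0 ?sqr_ge0.
rewrite leaf_sumD !leaf_sumZ ?powR_ge0//; apply: leeD.
  apply: (@le_trans _ _ ((2 `^ t)%:E * (C * (2 * r) ^+ 2)%:E)%E).
    by apply: lee_wpmul2l; [rewrite lee_fin powR_ge0|exact: HC].
  by rewrite -EFinM lee_fin le_eqVlt; apply/orP; left; apply/eqP; ring.
apply: (@le_trans _ _ (L%:E * (e / (L + 1))%:E)%E); first by apply: lee_wpmul2l; rewrite ?lee_fin.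
rewrite -EFinM lee_fin mulrCA -[leRHS]mulr1 ler_wpM2l ?(ltW e0)//.
by rewrite ler_pdivrMr ?mul1r ?lerDl// ltr_wpDl.
Qed.

End bmo_power.

(** * Recovering integrals from the Cauchy transform *)

Section necessity.
Variable R : realType.
Implicit Types (x y z w : plane R) (r s : R) (f g b : plane R -> R[i]).

Lemma power_mean_le (F : plane R -> R) (u t M : R) x r : measurable_fun setT F -> (forall z, 0 <= F z) ->
  0 < u -> u < t -> 0 < r -> 0 <= M ->
  (\int[area]_(z in square x r) (F z `^ t)%:E <= M%:E)%E ->
  (\int[area]_(z in square x r) (F z `^ u)%:E <= (M `^ (u / t) * ((2 * r) ^+ 2) `^ (1 - u / t))%:E)%E.
Proof.
move=> mF F0 u0 ut r0 M0 FM; have t0 : 0 < t by lra.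
have mS : measurable (square x r : set (plane R)) by exact: measurable_square.
have q0 : 0 < (2 * r) ^+ 2 by rewrite exprn_gt0// mulr_gt0.
have ut0 : 0 < u / t by rewrite divr_gt0.
have ut1 : 0 < 1 - u / t by rewrite subr_gt0 ltr_pdivrMr// mul1r.
have tu0 : 0 < t / u by rewrite divr_gt0.
have tuV : (t / u)^-1 = u / t by rewrite invf_div.
have := holder_integral (@area R) mS (measurable_powRf u mF) (@measurable_cst _ _ _ _ setT (1 : R))
  (fun z => powR_ge0 _ _) (fun=> ler01) tu0 (q := (1 - u / t)^-1).
rewrite invr_gt0 ut1 invrK tuV subrKC => /(_ isT erefl).
have E1 : (fun z => (F z `^ u * cst 1 z)%:E) = (fun z => (F z `^ u)%:E).
  by apply/funext => z; rewrite mulr1.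
have E2 : (fun z => ((F z `^ u) `^ (t / u))%:E) = (fun z => (F z `^ t)%:E).
  by apply/funext => z; rewrite -powRrM mulrC divfK// gt_eqF.
have E3 : (fun z : plane R => (cst 1 z `^ (1 - u / t)^-1)%:E) = (cst 1%:E : plane R -> \bar R).
  by apply/funext => z; rewrite /= powR1.
rewrite E1 E2 E3 (integral_cst area mS 1%:E) mul1e area_square// => h.
apply: (le_trans h); rewrite poweR_EFin EFinM; apply: lee_wpmul2r; first by rewrite lee_fin powR_ge0.
rewrite -poweR_EFin; apply: gt0_ler_poweR => //; first exact: ltW.
- by rewrite in_itv/= leey andbT; apply: integral_ge0 => z _; rewrite lee_fin powR_ge0.
- by rewrite in_itv/= leey andbT lee_fin.
Qed.

Lemma ae_exists (P : plane R -> Prop) y r : 0 < r -> {ae area, forall z, P z} ->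
  exists2 z, square y r z & P z.
Proof.
move=> r0 [N [mN N0 PN]]; apply: contrapT => H.
have SN : square y r `<=` N by move=> z zS; apply: PN => Pz; apply: H; exists z.
have : (area (square y r) <= area N)%E.
  by apply: le_measure; rewrite ?inE//; exact: measurable_square.
have N0' : (area N <= 0%:E)%E by rewrite N0.
by move=> /le_trans/(_ N0'); rewrite area_square// lee_fin leNgt exprn_gt0// mulr_gt0.
Qed.

Lemma cintegral_ae_eq f g : cmeasurable f -> cmeasurable g -> {ae area, forall w, f w = g w} ->
  cintegral setT f = cintegral setT g.
Proof.
move=> [f1 f2] [g1 g2] fg; rewrite /cintegral /Rintegral; congr (Complex (fine _) (fine _)).
  apply: ae_eq_integral => //; try exact: measurable_EFinS.
  by apply: filterS fg => w -> _.
apply: ae_eq_integral => //; try exact: measurable_EFinS.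
by apply: filterS fg => w -> _.
Qed.

Lemma null_point z : {ae area, forall w, w <> z}.
Proof. by apply: filterS (ae_off_axes z) => w [/eqP n1 _] E; apply: n1; rewrite E. Qed.

(** Multiplying the Cauchy kernel by [z - w] gives [1]: integrating [f] amounts to
    comparing the transforms of [f] and of [(w - x) f]. *)
Lemma cauchy_shift f x z : cmeasurable f -> cauchy_converges f z ->
  cauchy_converges (fun w => (pt w - pt x) * f w) z ->
  (pt z - pt x) * cauchy f z - cauchy (fun w => (pt w - pt x) * f w) z = cintegral setT f.
Proof.
move=> mf c1 c2; rewrite /cauchy -cintegral_affine//.
have mx : cmeasurable (fun w : plane R => (pt w - pt x) * f w).
  apply: cmeasurableM => //; apply: cmeasurableB; last exact: cmeasurable_cst.
  by split; [exact: measurable_fst|exact: measurable_snd].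
apply: cintegral_ae_eq => //.
  by apply: cmeasurable_affine; exact: cmeasurable_cauchy_integrand.
apply: filterS (null_point z) => w wz; rewrite /cauchy_integrand.
have nz : pt z - pt w != 0.
  apply/eqP => /eqP; rewrite subr_eq0 => /eqP; case: z w wz {c1 c2} => z1 z2 [w1 w2] wz [e1 e2].
  by apply: wz; rewrite e1 e2.
rewrite mulrA -mulrBl -mulrBl; have -> : pt z - pt x - (pt w - pt x) = pt z - pt w by ring.
by rewrite mulrAC divff// mul1r.
Qed.

(** From a point away from the support of [f], the Cauchy kernel is bounded below on
    the support. *)
Lemma integrable_of_converges f x r z : cmeasurable f -> 0 < r ->
  (forall w, ~ square x r w -> f w = 0) -> cauchy_converges f z -> ~ square x r z ->
  cintegrable setT f.
Proof.
move=> mf r0 fS [c1 c2] zS.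
pose M := cabs (pt z - pt x) + 2 * r.
have M0 : 0 <= M by rewrite addr_ge0 ?cabs_ge0// mulr_ge0// ltW.
have mk := cmeasurable_cauchy_integrand z mf; have [k1 k2] := mk.
have le w : cabs (f w) <= M * (`|complex.Re (cauchy_integrand f z w)| + `|complex.Im (cauchy_integrand f z w)|).
  have [wS|wS] := pselect (square x r w); last first.
    by rewrite fS// ComplexField.Normc.normc0 mulr_ge0// addr_ge0.
  have wz : pt z - pt w != 0.
    apply/eqP => /eqP; rewrite subr_eq0 => /eqP E; apply: zS.
    by move: E; rewrite /pt => -[]; case: z w wS {c1 c2 M M0 mk k1 k2} => z1 z2 [w1 w2] wS /= -> ->.
  have -> : f w = (pt z - pt w) * cauchy_integrand f z w.
    by rewrite /cauchy_integrand mulrC divfK.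
  rewrite ComplexField.Normc.normcM; apply: ler_pM; rewrite ?cabs_ge0 ?cabs_le_ReIm//.
  apply: (le_trans (cabs_dist_triangle _ (pt x) _)); rewrite lerD2l cabs_distC.
  apply: (le_trans (cabs_le_ReIm _)); case: wS => w1 w2.
  by rewrite mulr_natl mulr2n; apply: lerD; case: w x w1 w2 {fS zS wz M M0} => ? ? [? ?].
apply: cintegrable_cabs => //.
apply: (@le_lt_trans _ _ (M%:E * (\int[area]_w (`|complex.Re (cauchy_integrand f z w)|)%:E +
   \int[area]_w (`|complex.Im (cauchy_integrand f z w)|)%:E))%E).
  have n1 : measurable_fun setT (fun w => `|complex.Re (cauchy_integrand f z w)|) by exact: measurableT_comp.
  have n2 : measurable_fun setT (fun w => `|complex.Im (cauchy_integrand f z w)|) by exact: measurableT_comp.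
  rewrite -(integralD_EFin_ge0 area measurableT n1 n2 (fun=> normr_ge0 _) (fun=> normr_ge0 _)).
  rewrite -(integralZ_EFin area measurableT (measurable_funD n1 n2)
    (fun w => addr_ge0 (normr_ge0 _) (normr_ge0 _)) M0).
  apply: le_integral_EFin => //.
  - exact: cmeasurable_cabs.
  - by apply: measurable_funM; [exact: measurable_cst|exact: measurable_funD].
  - by move=> w _; exact: cabs_ge0.
apply: lte_mul_pinfty; rewrite ?lee_fin//; apply: lte_add_pinfty.
  by have /integrableP[_] := c1.
by have /integrableP[_] := c2.
Qed.

End necessity.

(** * Test functions in a square *)

Section testing.
Variable R : realType.
Implicit Types (x y z w : plane R) (r s : R) (f g b : plane R -> R[i]).

Lemma cabs_on_square x r z : square x r z -> cabs (pt z - pt x) <= 2 * r.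
Proof.
move=> [z1 z2]; apply: (le_trans (cabs_le_ReIm _)).
by rewrite mulr_natl mulr2n; apply: lerD; case: z x z1 z2 => ? ? [? ?].
Qed.

Definition commutator_bound b (p q K : R) : Prop := forall f, in_Lp p f ->
  {ae area, forall z, cauchy_converges f z /\ cauchy_converges (fun w => b w * f w) z} /\
  (LpNorm q (commutator b f) <= K%:E * LpNorm p f)%E.

(** By [cauchy_shift], applied to [f] and to [b f], the function in the last bound is
    a combination of the commutators of [f] and of [(w - x) f], with a coefficient
    [z - x] that is [O(r)] on the square; both test functions are bounded in [L^p]. *)
Lemma moment_bound b (p q K : R) f x r (m : R) : cmeasurable b -> 1 < p -> 1 < q -> 0 < K ->
  commutator_bound b p q K ->
  cmeasurable f -> 0 < r -> 0 <= m -> (forall w, ~ square x r w -> f w = 0) ->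
  (\int[area]_w (cabs (f w) `^ p)%:E <= (m `^ p)%:E)%E ->
  [/\ cintegrable setT f, cintegrable setT (fun w => b w * f w) &
      (\int[area]_(z in square x r)
         (cabs (b z * cintegral setT f - cintegral setT (fun w => b w * f w)) `^ q)%:E
       <= ((8 * K * r * m) `^ q)%:E)%E].
Proof.
move=> mb p1 q1 K0 Hb mf r0 m0 fS fm.
have p0 : 0 < p by lra.
have q0 : 0 < q by lra.
have r20 : 0 <= 2 * r by rewrite mulr_ge0// ltW.
have L (h : plane R -> R[i]) (t : R) : 0 <= t -> cmeasurable h ->
    (\int[area]_w (cabs (h w) `^ p)%:E <= (t `^ p)%:E)%E ->
    {ae area, forall z, cauchy_converges h z /\ cauchy_converges (fun w => b w * h w) z} /\
    (\int[area]_z (cabs (commutator b h z) `^ q)%:E <= ((K * t) `^ q)%:E)%E.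
  move=> t0 mh ht; have ht' := integral_le_LpNorm p0 t0 ht.
  have [|ae n] := Hb h; first by split=> //; apply: le_lt_trans ht' _; rewrite ltry.
  split=> //; apply: LpNorm_le_integral => //; first by rewrite mulr_ge0// ltW.
  by apply: (le_trans n); rewrite EFinM; apply: lee_wpmul2l => //; rewrite lee_fin ltW.
have [ae1 n1] := L f m m0 mf fm.
pose f2 w := (pt w - pt x) * f w.
have mpt : cmeasurable (fun w : plane R => pt w - pt x).
  apply: cmeasurableB; last exact: cmeasurable_cst.
  by split; [exact: measurable_fst|exact: measurable_snd].
have mf2 : cmeasurable f2 by exact: cmeasurableM.
have mp h : cmeasurable h -> measurable_fun setT (fun w => cabs (h w) `^ p).
  by move=> mh; apply: measurable_powRf; exact: cmeasurable_cabs.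
have mq h : cmeasurable h -> measurable_fun setT (fun w => cabs (h w) `^ q).
  by move=> mh; apply: measurable_powRf; exact: cmeasurable_cabs.
have f2m : (\int[area]_w (cabs (f2 w) `^ p)%:E <= ((2 * r * m) `^ p)%:E)%E.
  apply: (@le_trans _ _ (\int[area]_w ((2 * r) `^ p * cabs (f w) `^ p)%:E)%E).
    apply: le_integral_EFin => //.
    - exact: mp.
    - by apply: measurable_funM; [exact: measurable_cst|exact: mp].
    - by move=> w _; exact: powR_ge0.
    move=> w _; have [wS|wS] := pselect (square x r w); last first.
      by rewrite /f2 fS// mulr0 ComplexField.Normc.normc0 powR0 ?gt_eqF// mulr_ge0 ?powR_ge0.
    rewrite -(powRM p r20 (cabs_ge0 _)); apply: (le_powRl (ltW p0) (cabs_ge0 _)).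
    by rewrite /f2 ComplexField.Normc.normcM ler_wpM2r ?cabs_ge0// cabs_on_square.
  rewrite (integralZ_EFin area measurableT (mp f mf) (fun=> powR_ge0 _ _) (powR_ge0 _ _)).
  rewrite (powRM p r20 m0) EFinM; apply: lee_wpmul2l => //; by rewrite lee_fin powR_ge0.
have [ae2 n2] := L f2 _ (mulr_ge0 r20 m0) mf2 f2m.
(* Any centre whose unit square avoids the support gives a point of convergence. *)
pose y : plane R := ((x.1 : R) + r + 2, x.2).
have ySx w : square y 1 w -> ~ square x r w.
  rewrite /y => -[+ _] [+ _] /=; rewrite !ler_norml => /andP[h1 _] /andP[_ h2].
  by move: h1 h2 => /=; clear; lra.
have [z0 z0y [c01 c02]] := ae_exists y ltr01 ae1.
have if1 : cintegrable setT f by apply: (integrable_of_converges mf r0 fS c01); exact: ySx.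
have mbf : cmeasurable (fun w => b w * f w) by exact: cmeasurableM.
have bfS w : ~ square x r w -> b w * f w = 0 by move=> /fS ->; rewrite mulr0.
have if2 : cintegrable setT (fun w => b w * f w).
  by apply: (integrable_of_converges mbf r0 bfS c02); exact: ySx.
split=> //.
set If := cintegral setT f; set Ibf := cintegral setT _.
have mD : cmeasurable (fun z => b z * If - Ibf).
  by apply: cmeasurableB; [apply: cmeasurableM => //|]; exact: cmeasurable_cst.
have mc1 := cmeasurable_commutator mb mf; have mc2 := cmeasurable_commutator mb mf2.
have mS : measurable (square x r : set (plane R)) by exact: measurable_square.
have key : {ae area, forall z, square x r z -> cabs (b z * If - Ibf) `^ q <=
    2 `^ q * (cabs (commutator b f2 z) `^ q + (2 * r) `^ q * cabs (commutator b f z) `^ q)}.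
  apply: filterS2 ae1 ae2 => z [c1 c1'] [c2 c2'] zS.
  rewrite -(powRM q r20 (cabs_ge0 _)).
  apply: (powR_le_add (ltW q0) (cabs_ge0 _) (cabs_ge0 _) (mulr_ge0 r20 (cabs_ge0 _))).
  have E1 := cauchy_shift mf c1 c2.
  have c2'' : cauchy_converges (fun w => (pt w - pt x) * (b w * f w)) z.
    have -> : (fun w => (pt w - pt x) * (b w * f w)) = (fun w => b w * f2 w) by apply/funext => w; rewrite mulrCA.
    exact: c2'.
  have E2 := cauchy_shift mbf c1' c2''.
  have -> : b z * If - Ibf = (pt z - pt x) * commutator b f z - commutator b f2 z.
    rewrite /If /Ibf -E1 -E2 /commutator.
    have -> : (fun w => b w * f2 w) = (fun w => (pt w - pt x) * (b w * f w)) by apply/funext => w; rewrite mulrCA.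
    by rewrite -/f2; ring.
  apply: (le_trans (le_normcD _ _)); rewrite normcN addrC lerD2l ComplexField.Normc.normcM.
  by rewrite ler_wpM2r ?cabs_ge0// cabs_on_square.
have mR : measurable_fun setT (fun z => 2 `^ q * (cabs (commutator b f2 z) `^ q + (2 * r) `^ q * cabs (commutator b f z) `^ q)).
  apply: measurable_funM; first exact: measurable_cst.
  apply: measurable_funD; first exact: mq.
  by apply: measurable_funM; [exact: measurable_cst|exact: mq].
have R0 z : 0 <= 2 `^ q * (cabs (commutator b f2 z) `^ q + (2 * r) `^ q * cabs (commutator b f z) `^ q).
  by rewrite mulr_ge0 ?powR_ge0// addr_ge0 ?powR_ge0// mulr_ge0 ?powR_ge0.
apply: (@le_trans _ _ (\int[area]_z (2 `^ q * (cabs (commutator b f2 z) `^ q + (2 * r) `^ q * cabs (commutator b f z) `^ q))%:E)%E).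
  apply: (@le_trans _ _ (\int[area]_(z in square x r) (2 `^ q * (cabs (commutator b f2 z) `^ q + (2 * r) `^ q * cabs (commutator b f z) `^ q))%:E)%E).
    apply: ae_ge0_le_integral => //.
    - by move=> z _; rewrite lee_fin powR_ge0.
    - by apply: measurable_EFinS; exact: mq.
    - by move=> z _; rewrite lee_fin.
    - exact: measurable_EFinS.
  apply: ge0_subset_integral => //; first exact: measurable_EFinS.
  by move=> z _; rewrite lee_fin.
have mq1 := mq _ mc1; have mq2 := mq _ mc2.
have mq1r : measurable_fun setT (fun z => (2 * r) `^ q * cabs (commutator b f z) `^ q).
  by apply: measurable_funM; [exact: measurable_cst|exact: mq1].
rewrite (integralZ_EFin area measurableT (measurable_funD mq2 mq1r)
  (fun z => addr_ge0 (powR_ge0 _ _) (mulr_ge0 (powR_ge0 _ _) (powR_ge0 _ _))) (powR_ge0 _ _)).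
rewrite (integralD_EFin_ge0 area measurableT mq2 mq1r (fun=> powR_ge0 _ _)
  (fun=> mulr_ge0 (powR_ge0 _ _) (powR_ge0 _ _))).
rewrite (integralZ_EFin area measurableT mq1 (fun=> powR_ge0 _ _) (powR_ge0 _ _)).
apply: (@le_trans _ _ (2 `^ q * ((K * (2 * r * m)) `^ q + (2 * r) `^ q * (K * m) `^ q))%:E).
  rewrite (EFinM (2 `^ q)) EFinD (EFinM ((2 * r) `^ q)).
  apply: lee_wpmul2l; first by rewrite lee_fin powR_ge0.
  by apply: leeD => //; apply: lee_wpmul2l => //; rewrite lee_fin powR_ge0.
have Km : 0 <= K * m by rewrite mulr_ge0// ltW.
rewrite lee_fin -(powRM q r20 Km).
have -> : 2 * r * (K * m) = K * (2 * r * m) by ring.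
have Km0 : 0 <= K * (2 * r * m) by rewrite !mulr_ge0 ?(ltW K0) ?(ltW r0).
have -> : 8 * K * r * m = 2 * (2 * (K * (2 * r * m))) by ring.
rewrite [leRHS](powRM q (ler0n R 2) (mulr_ge0 (ler0n R 2) Km0)) ler_wpM2l ?powR_ge0//.
rewrite [leRHS](powRM q (ler0n R 2) Km0).
have p2 : 2 <= 2 `^ q :> R by rewrite -[leLHS](@powRr1 _ 2)// ler_powR ?ler1n// ltW.
move: (powR_ge0 (K * (2 * r * m)) q) p2; move: ((K * (2 * r * m)) `^ q) (2 `^ q) => X c X0 c2.
by rewrite -mulr2n -mulr_natl ler_wpM2r.
Qed.

End testing.

(** * Oscillation bounds from the commutator *)

Section oscillation_bounds.
Variable R : realType.
Implicit Types (x y z w : plane R) (r s : R) (f g b : plane R -> R[i]).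

Lemma cintegral_indic f (S : set (plane R)) :
  cintegral setT (fun w => f w * (\1_S w)%:C) = cintegral S f.
Proof.
rewrite /cintegral; congr Complex.
  rewrite [RHS]Rintegral_mkcond; apply: eq_Rintegral => w _; rewrite patchE indicE.
  by case: ifP => _; case: (f w) => u v /=; rewrite ?mulr0 ?subr0 ?mulr1.
rewrite [RHS]Rintegral_mkcond; apply: eq_Rintegral => w _; rewrite patchE indicE.
by case: ifP => _; case: (f w) => u v /=; rewrite ?mulr0 ?mulr1 ?add0r ?addr0.
Qed.

Lemma average_square b x r : 0 < r ->
  average (square x r) b = (((2 * r) ^+ 2)^-1)%:C * cintegral (square x r) b.
Proof. by move=> r0; rewrite /average area_square. Qed.

Lemma moment_indic b x r z : 0 < r ->
  b z * ((2 * r) ^+ 2)%:C - cintegral (square x r) b = ((2 * r) ^+ 2)%:C * (b z - average (square x r) b).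
Proof.
move=> r0; rewrite average_square// mulrBr mulrC; congr (_ - _).
by rewrite mulrA -rmorphM/= divff ?mul1r// gt_eqF// exprn_gt0// mulr_gt0.
Qed.

Lemma mul_conj_phase (u : R[i]) (t : R) :
  u * ((complex.Re u * t) +i* (- complex.Im u * t)) = (cabs u ^+ 2 * t)%:C.
Proof.
case: u => a c /=; apply/eqP; rewrite eq_complex /= sqr_sqrtr ?addr_ge0 ?sqr_ge0//.
by apply/andP; split; apply/eqP; ring.
Qed.

Lemma cintegrable_affine (D : set (plane R)) (a : R[i]) f g : measurable D ->
  cintegrable D f -> cintegrable D g -> cintegrable D (fun w => a * f w - g w).
Proof.
move=> mD [f1 f2] [g1 g2]; case: a => u v.
have Z (c : R) (k : plane R -> R) : area.-integrable D (fun w => (k w)%:E) ->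
    area.-integrable D (fun w => (c * k w)%:E).
  by move=> /(integrableZl mD c).
split.
  have := integrableB mD (integrableB mD (Z u _ f1) (Z v _ f2)) g1.
  by apply: eq_integrable => // w _; case: (f w) => ? ?; case: (g w).
have := integrableB mD (integrableD mD (Z u _ f2) (Z v _ f1)) g2.
by apply: eq_integrable => // w _; case: (f w) => ? ?; case: (g w).
Qed.

(** For the indicator function of a square, the function in [moment_bound] is
    [b] minus its mean, up to the area. *)
Lemma oscillation_le_q b (p q K : R) x r : L1loc b -> 1 < p -> 1 < q -> 0 < K ->
  commutator_bound b p q K -> 0 < r ->
  (\int[area]_(z in square x r) (cabs (b z - average (square x r) b) `^ q)%:E <=
   ((4 * K * (2 * r) `^ (2 / p - 1)) `^ q)%:E)%E.
Proof.
move=> bL p1 q1 K0 Hb r0; have mb : cmeasurable b by case: bL.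
have p0 : 0 < p by lra.
have q0 : 0 < q by lra.
have rho0 : 0 < 2 * r by rewrite mulr_gt0.
have rr0 : 0 < (2 * r) ^+ 2 by rewrite exprn_gt0.
have mS : measurable (square x r : set (plane R)) by exact: measurable_square.
pose f (w : plane R) : R[i] := 1 * (\1_(square x r) w)%:C.
have mi : measurable_fun setT (\1_(square x r) : plane R -> R) by exact: measurable_indic.
have mf : cmeasurable f.
  apply: cmeasurableM; first exact: cmeasurable_cst.
  by split => //=; exact: measurable_cst.
have fS w : ~ square x r w -> f w = 0.
  by move=> wS; rewrite /f indicE memNset// mulr0.
have fm : (\int[area]_w (cabs (f w) `^ p)%:E <= (((2 * r) `^ (2 / p)) `^ p)%:E)%E.
  have -> : (fun w => (cabs (f w) `^ p)%:E) = (fun w => (\1_(square x r) w)%:E).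
    apply/funext => w; rewrite /f mul1r indicE cabsC_ge0//.
    by case: (w \in _); rewrite ?powR1// powR0// gt_eqF.
  rewrite integral_indic// setIT area_square// lee_fin -powRrM divfK ?gt_eqF//.
  by rewrite powR_mulrn// ltW.
have [_ _] := moment_bound mb p1 q1 K0 Hb mf r0 (powR_ge0 _ _) fS fm.
have -> : cintegral setT f = ((2 * r) ^+ 2)%:C.
  by rewrite /f (cintegral_indic (fun=> 1)) cintegral_cst// area_square// mulr1.
have -> : cintegral setT (fun w => b w * f w) = cintegral (square x r) b.
  rewrite -[RHS]cintegral_indic; congr (cintegral _ _); apply/funext => w.
  by rewrite /f mul1r.
have mo : measurable_fun setT (fun z => cabs (b z - average (square x r) b) `^ q).
  by apply: measurable_powRf; exact: measurable_cabs_sub.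
have -> : (\int[area]_(z in square x r) (cabs (b z * ((2 * r) ^+ 2)%:C - cintegral (square x r) b) `^ q)%:E =
   (((2 * r) ^+ 2) `^ q)%:E * \int[area]_(z in square x r) (cabs (b z - average (square x r) b) `^ q)%:E)%E.
  rewrite -(integralZ_EFin area mS mo (fun=> powR_ge0 _ _) (powR_ge0 _ _)).
  apply: eq_integral => z _; rewrite moment_indic// ComplexField.Normc.normcM cabsC_ge0 ?(ltW rr0)//.
  by rewrite (powRM q (ltW rr0) (cabs_ge0 _)).
have -> : 8 * K * r * (2 * r) `^ (2 / p) = (2 * r) ^+ 2 * (4 * K * (2 * r) `^ (2 / p - 1)).
  rewrite powRB ?(gt_eqF rho0) ?implybT// powRr1 ?(ltW rho0)//; field; exact: lt0r_neq0.
rewrite (powRM q (ltW rr0)) ?mulr_ge0 ?powR_ge0 ?(ltW K0)// EFinM.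
by rewrite lee_pmul2l// lte_fin powR_gt0.
Qed.

(** By duality: for [f = u * g], with [u] the conjugate phase of [b] minus its mean
    [A] and [g] nonnegative, the integral of [|b - A| g] is that of [(b - A) f], which
    is, up to the area, the integral over the square of the function in
    [moment_bound]. *)
Lemma oscillation_le_conjugate b (p q p' K : R) x r : L1loc b -> 1 < p -> 1 < q -> 0 < K ->
  p^-1 + p'^-1 = 1 -> commutator_bound b p q K -> 0 < r ->
  (\int[area]_(z in square x r) (cabs (b z - average (square x r) b) `^ p')%:E <=
   ((8 * K * (2 * r) `^ (1 - 2 / q)) `^ p')%:E)%E.
Proof.
move=> bL p1 q1 K0 pp' Hb r0; have mb : cmeasurable b by case: bL.
have p0 : 0 < p by lra.
have q0 : 0 < q by lra.
have p'E := conjugate_gt0 p1 pp'.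
have p'1 : 1 < p' by rewrite p'E ltr_pdivlMr ?subr_gt0//; lra.
have p'0 : 0 < p' by lra.
have rho0 : 0 < 2 * r by rewrite mulr_gt0.
have rr0 : 0 < (2 * r) ^+ 2 by rewrite exprn_gt0.
have mS : measurable (square x r : set (plane R)) by exact: measurable_square.
have mi : measurable_fun setT (\1_(square x r) : plane R -> R) by exact: measurable_indic.
set A := average (square x r) b.
pose v z := b z - A; have mv : cmeasurable v by apply: cmeasurableB => //; exact: cmeasurable_cst.
have mcv : measurable_fun setT (fun z => cabs (v z)) by exact: cmeasurable_cabs.
have H0 (z : plane R) : (0 <= (cabs (v z) * \1_(square x r) z)%:E)%E by rewrite lee_fin mulr_ge0 ?cabs_ge0.
have mH : measurable_fun setT (fun z => (cabs (v z) * \1_(square x r) z)%:E).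
  by apply: measurable_EFinS; exact: measurable_funM.
set C := 8 * K * _; have C0 : 0 <= C by rewrite !mulr_ge0 ?powR_ge0 ?(ltW K0).
have -> : (\int[area]_(z in square x r) (cabs (b z - A) `^ p')%:E =
   \int[area]_z ((cabs (v z) * \1_(square x r) z)%:E `^ p'))%E.
  rewrite integral_mkcond; apply: eq_integral => z _; rewrite patchE indicE poweR_EFin.
  by case: ifP => _; rewrite ?mulr1 ?mulr0 ?powR0 ?gt_eqF.
apply: (@converse_holder _ _ R area _ p p') => //; first exact: area_sigma_finite.
  by rewrite addrC.
move=> g mg g0 g1.
pose W z := (cabs (v z))^-1 * (g z * \1_(square x r) z).
have mW : measurable_fun setT W.
  apply: measurable_funM; last exact: measurable_funM.
  by apply: measurable_invf_ge0 => // z; exact: cabs_ge0.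
have W0 z : 0 <= W z by rewrite mulr_ge0 ?invr_ge0 ?cabs_ge0// mulr_ge0.
pose f z : R[i] := (complex.Re (v z) * W z) +i* (- complex.Im (v z) * W z).
have mf : cmeasurable f.
  case: mv => v1 v2; split => /=; apply: measurable_funM => //.
  exact: measurableT_comp.
have cf z : cabs (f z) = cabs (v z) * W z.
  have -> : f z = (v z)^*%C * (W z)%:C.
    by rewrite /f; case: (v z) => a c; rewrite /=; simpc.
  rewrite ComplexField.Normc.normcM cabsC_ge0//; congr (_ * _).
  by case: (v z) => a c /=; rewrite sqrrN.
have fS w : ~ square x r w -> f w = 0.
  by move=> wS; rewrite /f /W indicE memNset// !mulr0.
have fg z : cabs (f z) <= g z.
  rewrite cf /W indicE; have [->|n0] := eqVneq (cabs (v z)) 0; first by rewrite mul0r.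
  rewrite mulrA divff// mul1r; case: (z \in _); rewrite ?mulr1 ?mulr0//.
have fm : (\int[area]_w (cabs (f w) `^ p)%:E <= (1 `^ p)%:E)%E.
  rewrite powR1; apply: le_trans g1; apply: le_integral_EFin => //.
  - by apply: measurable_powRf; exact: cmeasurable_cabs.
  - exact: measurable_powRf.
  - by move=> z _; exact: powR_ge0.
  - by move=> z _; apply: le_powRl => //; [exact: ltW|exact: cabs_ge0].
have [if1 if2] := moment_bound mb p1 q1 K0 Hb mf r0 ler01 fS fm.
set If := cintegral setT f; set Ibf := cintegral setT _ => DD.
pose h z := cabs (v z) * \1_(square x r) z * g z.
have vf z : v z * f z = (h z)%:C.
  rewrite /f mul_conj_phase /h /W; congr (_%:C).
  have [->|n0] := eqVneq (cabs (v z)) 0; first by rewrite expr0n /= !mul0r.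
  by field.
have hE : (fun w => A * f w - b w * f w) = (fun w => (- h w)%:C).
  by apply/funext => w; rewrite rmorphN /= -vf /v mulrBl opprB.
have h0 z : 0 <= h z by rewrite !mulr_ge0 ?cabs_ge0.
have hi : area.-integrable setT (fun w => (h w)%:E).
  have := cintegrable_affine A measurableT if1 if2; rewrite hE => -[/(integrableZl measurableT (-1)) hi _].
  by apply: eq_integrable hi => // w _; rewrite -EFinM mulN1r opprK.
have AE : A * If - Ibf = (- \int[area]_w h w)%:C.
  rewrite -cintegral_affine// hE /cintegral /= -mulN1r -RintegralZl//.
  congr Complex; first by apply: eq_Rintegral => w _; rewrite mulN1r.
  by rewrite Rintegral_cst// mul0r.
have mD : cmeasurable (fun z => b z * If - Ibf).
  by apply: cmeasurableB; [apply: cmeasurableM => //|]; exact: cmeasurable_cst.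
have SE : cintegral (square x r) (fun z => b z * If - Ibf) = ((2 * r) ^+ 2 * - \int[area]_w h w)%:C.
  have -> : (fun z => b z * If - Ibf) = (fun z => If * b z - Ibf) by apply/funext => z; rewrite mulrC.
  rewrite cintegral_affine//; [|exact: cintegrable_square|exact: cintegrable_square_cst].
  rewrite cintegral_cst// area_square// [RHS]rmorphM /= -AE mulrBr; congr (_ - _).
  rewrite /A average_square// mulrA mulrA -rmorphM /= divff ?mul1r ?gt_eqF//.
  exact: mulrC.
have I0 : 0 <= \int[area]_w h w by apply: Rintegral_ge0.
have := cabs_cintegral_le mS mD; rewrite SE.
have -> : cabs (((2 * r) ^+ 2 * - \int[area]_w h w)%:C) = (2 * r) ^+ 2 * \int[area]_w h w.
  by rewrite mulrN rmorphN normcN cabsC_ge0// mulr_ge0// ltW.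
move=> SD.
have := @power_mean_le _ _ 1 q _ x r (cmeasurable_cabs mD) (fun=> cabs_ge0 _) ltr01 q1 r0 (powR_ge0 _ _) DD.
have -> : (fun z => (cabs (b z * If - Ibf) `^ 1)%:E) = (fun z => (cabs (b z * If - Ibf))%:E).
  by apply/funext => z; rewrite powRr1// cabs_ge0.
have -> : ((8 * K * r * 1) `^ q) `^ (1 / q) = 8 * K * r.
  have K8 : 0 <= 8 * K * r * 1 by rewrite !mulr_ge0// ltW.
  by rewrite -powRrM mul1r divff ?gt_eqF// powRr1// mulr1.
have -> : ((2 * r) ^+ 2) `^ (1 - 1 / q) = (2 * r) ^+ 2 * ((2 * r) `^ (1 - 2 / q) / (2 * r)).
  rewrite -powR_mulrn ?(ltW rho0)// -powRrM.
  have -> : 2 * (1 - 1 / q) = 2 + ((1 - 2 / q) - 1) by ring.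
  rewrite (@powRD _ (2 * r) 2); last by rewrite (gt_eqF rho0) implybT.
  by rewrite (@powRB _ (2 * r) (1 - 2 / q)) ?(gt_eqF rho0) ?implybT// powRr1// ltW.
move=> D1.
have -> : (fun z => (cabs (v z) * \1_(square x r) z)%:E * (g z)%:E)%E = (fun z => (h z)%:E).
  by apply/funext => z; rewrite -EFinM.
have hfin : (\int[area]_w (h w)%:E \is a fin_num)%E by exact: integrable_fin_num.
rewrite -(fineK hfin) lee_fin -(ler_pM2l rr0).
rewrite -lee_fin; apply: (le_trans SD).
apply: (@le_trans _ _ (2%:E * (8 * K * r * ((2 * r) ^+ 2 * ((2 * r) `^ (1 - 2 / q) / (2 * r))))%:E)%E).
  by apply: lee_wpmul2l.
rewrite -EFinM lee_fin /C le_eqVlt; apply/orP; left; apply/eqP.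
by field; exact: lt0r_neq0.
Qed.

End oscillation_bounds.

(** * Mean oscillation conditions *)

Section function_spaces.
Variable R : realType.
Implicit Types (x y z w : plane R) (r s : R) (f g b : plane R -> R[i]).

Definition power_oscillation b (t beta A : R) : Prop := forall x r, 0 < r ->
  (\int[area]_(z in square x r) (cabs (b z - average (square x r) b) `^ t)%:E <=
   (A * r `^ (t * beta + 2))%:E)%E.

(** Hoelder's inequality on squares: the normalisation is the same for all exponents. *)
Lemma power_oscillation_le b (u t beta A : R) : L1loc b -> 0 < u -> u < t -> 0 <= A ->
  power_oscillation b t beta A ->
  power_oscillation b u beta (A `^ (u / t) * 4 `^ (1 - u / t)).
Proof.
move=> bL u0 ut A0 H x r r0; have t0 : 0 < t by lra.
have mo : measurable_fun setT (fun z => cabs (b z - average (square x r) b)).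
  by apply: measurable_cabs_sub; case: bL.
have M0 : 0 <= A * r `^ (t * beta + 2) by rewrite mulr_ge0 ?powR_ge0.
apply: (le_trans (power_mean_le mo (fun=> cabs_ge0 _) u0 ut r0 M0 (H x r r0))).
rewrite lee_fin le_eqVlt; apply/orP; left; apply/eqP.
rewrite (powRM _ A0 (powR_ge0 _ _)) -powRrM.
have -> : (2 * r) ^+ 2 = 4 * r `^ 2 by rewrite powR_mulrn ?(ltW r0)//; ring.
rewrite (@powRM _ 4 _ _ (ler0n R 4) (powR_ge0 _ _)) -powRrM.
have -> : u * beta + 2 = (t * beta + 2) * (u / t) + 2 * (1 - u / t) by field; exact: lt0r_neq0.
rewrite (@powRD _ r ((t * beta + 2) * (u / t))); last by rewrite (gt_eqF r0) implybT.
by rewrite mulrACA.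
Qed.

Lemma mean_oscillation_of_power b (t beta A : R) : L1loc b -> 1 < t -> 0 <= A ->
  power_oscillation b t beta A -> mean_oscillation_le b beta (A `^ (1 / t) * 4 `^ (1 - 1 / t)).
Proof.
move=> bL t1 A0 H x r r0; have := power_oscillation_le bL ltr01 t1 A0 H x r0.
have -> : (fun z => (cabs (b z - average (square x r) b) `^ 1)%:E) =
   (fun z => (cabs (b z - average (square x r) b))%:E).
  by apply/funext => z; rewrite powRr1// cabs_ge0.
by have -> : 1 * beta + 2 = 2 + beta by ring.
Qed.

Lemma campanato_power_oscillation b (phi lambda beta : R) : L1loc b -> 0 < phi ->
  lambda = phi * beta + 2 ->
  campanato phi lambda b <-> exists2 A : R, 0 <= A & power_oscillation b phi beta A.
Proof.
move=> bL phi0 lE.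
have I0 x r : (0 <= \int[area]_(y in square x r) (cabs (b y - average (square x r) b) `^ phi)%:E)%E.
  by apply: integral_ge0 => z _; rewrite lee_fin powR_ge0.
have rl0 r : 0 < r -> 0 < r `^ lambda by exact: powR_gt0.
pose o : plane R := (0, 0).
split=> [[_ fin]|[A A0 H]].
  have s0 : (0 <= campanato_seminorm phi lambda b)%E.
    apply: (@le_trans _ _ (((1 `^ lambda)^-1%:E * \int[area]_(y in square o 1)
       (cabs (b y - average (square o 1) b) `^ phi)%R%:E) `^ phi^-1)%E); first exact: poweR_ge0.
    by apply: ereal_sup_ubound; exists o, 1.
  have sf : campanato_seminorm phi lambda b \is a fin_num by rewrite ge0_fin_numE.
  set M := fine (campanato_seminorm phi lambda b).
  have M0 : 0 <= M by exact: fine_ge0.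
  exists (M `^ phi); first exact: powR_ge0.
  move=> x r r0; rewrite -lE.
  have : (((r `^ lambda)^-1%:E * \int[area]_(y in square x r)
       (cabs (b y - average (square x r) b) `^ phi)%R%:E) `^ phi^-1 <= M%:E)%E.
    by rewrite /M fineK//; apply: ereal_sup_ubound; exists x, r.
  set I := (\int[area]_(y in square x r) _)%E => h.
  have rI0 : (0 <= (r `^ lambda)^-1%:E * I)%E.
    by apply: mule_ge0; [rewrite lee_fin invr_ge0 ltW// rl0|exact: I0].
  have : ((r `^ lambda)^-1%:E * I <= (M `^ phi)%:E)%E.
    have -> : ((r `^ lambda)^-1%:E * I = (((r `^ lambda)^-1%:E * I) `^ phi^-1) `^ phi)%E.
      by rewrite -poweRrM mulVf ?gt_eqF// poweRe1.
    rewrite -poweR_EFin; apply: gt0_ler_poweR => //; first exact: ltW.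
    - by rewrite in_itv/= leey andbT poweR_ge0.
    - by rewrite in_itv/= leey andbT lee_fin.
  by rewrite lee_pdivrMl ?rl0// -EFinM mulrC.
split=> //; apply: (@le_lt_trans _ _ (A `^ phi^-1)%:E); last by rewrite ltry.
apply: ge_ereal_sup => _ [x [r [r0 ->]]].
rewrite -poweR_EFin; apply: gt0_ler_poweR => //.
- by rewrite invr_ge0 ltW.
- by rewrite in_itv/= leey andbT mule_ge0// lee_fin invr_ge0 ltW// rl0.
- by rewrite in_itv/= leey andbT lee_fin.
rewrite lee_pdivrMl ?rl0// -EFinM mulrC lE; exact: H.
Qed.

Lemma bmo_mean_oscillation b : L1loc b ->
  bmo b <-> exists2 K : R, 0 <= K & mean_oscillation_le b 0 K.
Proof.
move=> bL.
have q0 (r : R) : 0 < r -> 0 < (2 * r) ^+ 2 by move=> r0; rewrite exprn_gt0// mulr_gt0.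
have rE (r : R) : 0 < r -> r `^ (2 + 0) = r ^+ 2 by move=> r0; rewrite addr0 powR_mulrn// ltW.
have I0 x r : (0 <= \int[area]_(y in square x r) (cabs (b y - average (square x r) b))%:E)%E.
  by apply: integral_ge0 => z _; rewrite lee_fin cabs_ge0.
pose o : plane R := (0, 0).
split=> [[_ fin]|[K K0 H]].
  have s0 : (0 <= bmo_seminorm b)%E.
    apply: (@le_trans _ _ ((fine (area (square o 1)))^-1%:E * \int[area]_(y in square o 1)
       (cabs (b y - average (square o 1) b))%R%:E)%E).
      by rewrite mule_ge0// lee_fin invr_ge0 area_square//= ltW// q0.
    by apply: ereal_sup_ubound; exists o, 1.
  have sf : bmo_seminorm b \is a fin_num by rewrite ge0_fin_numE.
  set M := fine (bmo_seminorm b).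
  exists (4 * M) => [|x r r0]; first by rewrite mulr_ge0// fine_ge0.
  have : ((fine (area (square x r)))^-1%:E * \int[area]_(y in square x r)
       (cabs (b y - average (square x r) b))%R%:E <= M%:E)%E.
    by rewrite /M fineK//; apply: ereal_sup_ubound; exists x, r.
  rewrite area_square// lee_pdivrMl ?q0// -EFinM rE//.
  by have -> : (2 * r) ^+ 2 * M = 4 * M * r ^+ 2 by ring.
split=> //; apply: (@le_lt_trans _ _ (K / 4)%:E); last by rewrite ltry.
apply: ge_ereal_sup => _ [x [r [r0 ->]]].
rewrite area_square// lee_pdivrMl ?q0// -EFinM.
have -> : (2 * r) ^+ 2 * (K / 4) = K * r `^ (2 + 0) by rewrite rE//; field.
exact: H.
Qed.

End function_spaces.

(** * Sufficiency *)

Section sufficiency.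
Variable R : realType.
Variables (b : plane R -> R[i]) (p q p' s beta : R).
Hypotheses (bL : L1loc b) (p_gt1 : 1 < p) (p_lt2 : p < 2) (q_gt2 : 2 < q)
  (pp' : p^-1 + p'^-1 = 1) (qs : q^-1 + s^-1 = 1) (beta_def : beta / 2 = p^-1 - q^-1 - 2^-1).
Implicit Types (j : dyadic_index).

Lemma conjugate_order : [/\ 1 < s, s < 2, 2 < p' & s < p'].
Proof.
have q1 : 1 < q by move: q_gt2; lra.
have -> := conjugate_gt0 p_gt1 pp'; have -> := conjugate_gt0 q1 qs.
have s1 : 1 < q / (q - 1) by rewrite ltr_pdivlMr ?subr_gt0//; move: q1; lra.
have s2 : q / (q - 1) < 2 by rewrite ltr_pdivrMr ?subr_gt0//; move: q_gt2; lra.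
have p2 : 2 < p / (p - 1) by rewrite ltr_pdivlMr ?subr_gt0//; move: p_lt2; lra.
by split => //; exact: lt_trans p2.
Qed.

Lemma measurable_center (c : dyadic_index -> R[i]) j : measurable_fun setT (fun z => cabs (b z - c j)).
Proof. by apply: measurable_cabs_sub; case: bL. Qed.

Lemma center_triangle (c : R[i]) z w : cabs (b z - b w) <= cabs (b z - c) + cabs (b w - c).
Proof. by rewrite (cabs_distC (b w)); exact: cabs_dist_triangle. Qed.

(** The pairing condition and its transpose are those of the exponents [(p, q)] and
    [(s, p')], and both pairs define the same [beta]. *)
Lemma commutator_bounded_of_centers (c : dyadic_index -> R[i]) (sigma A : R) :
  p' < sigma -> q < sigma -> 0 < A ->
  (forall j, (\int[area]_(z in dyadic_square j) (cabs (b z - c j) `^ sigma)%:E <=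
     (A * dyadic_scale R j `^ (sigma * beta + 2))%:E)%E) ->
  commutator_bounded b p q.
Proof.
move=> ps qsig A0 H; have [s1 s2 p'2 sp'] := conjugate_order.
have pq : p < q by move: p_lt2 q_gt2; lra.
apply: (commutator_bounded_of_pairing (proj1 bL) p_gt1 p_lt2 q_gt2 qs (measurable_center c)).
- by move=> j z; exact: cabs_ge0.
- by move=> j z w _ _; exact: center_triangle.
- apply: (dyadic_pairing_osc (measurable_center c) _ p_gt1 pq qs qsig A0 beta_def H) => j z.
  exact: cabs_ge0.
apply: (dyadic_pairing_osc (measurable_center c) _ s1 sp' _ ps A0 _ H) => [j z||].
- exact: cabs_ge0.
- by rewrite addrC.
- by move: beta_def pp' qs; lra.
Qed.

(** With one constant for all squares the exponents [q] and [p'] themselves suffice: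
    the growth of the weight [|b - c|] is that required by [dyadic_pairing_morrey],
    for the pairing and for its transpose. *)
Lemma commutator_bounded_of_constant (c : R[i]) (A : R) : 0 < A ->
  (forall t, t = q \/ t = p' -> forall j, (\int[area]_(z in dyadic_square j) (cabs (b z - c) `^ t)%:E <=
     (A * dyadic_scale R j `^ (t * beta + 2))%:E)%E) ->
  commutator_bounded b p q.
Proof.
move=> A0 H; have [s1 s2 p'2 sp'] := conjugate_order.
have pq : p < q by move: p_lt2 q_gt2; lra.
have mc := measurable_cabs_sub c (proj1 bL).
have q0 : q != 0 by rewrite gt_eqF//; move: q_gt2; lra.
have p'0 : p' != 0 by rewrite gt_eqF//; move: p'2; lra.
have Eq : q * (2 / p - 1) = q * beta + 2.
  have -> : beta = 2 * (p^-1 - q^-1 - 2^-1) by move: beta_def; lra.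
  by field; rewrite q0 gt_eqF//; move: p_gt1; lra.
have Ep : p' * (2 / s - 1) = p' * beta + 2.
  have -> : beta = 2 * (s^-1 - p'^-1 - 2^-1) by move: beta_def pp' qs; lra.
  by field; rewrite p'0 gt_eqF//; move: s1; lra.
apply: (@commutator_bounded_of_pairing _ b p q s (fun _ z => cabs (b z - c)) (proj1 bL)) => //.
- by move=> j z; exact: cabs_ge0.
- by move=> j z w _ _; exact: center_triangle.
- apply: (dyadic_pairing_morrey mc _ p_gt1 p_lt2 pq qs A0) => [z|j]; first exact: cabs_ge0.
  by rewrite Eq; apply: H; left.
apply: (dyadic_pairing_morrey mc _ s1 s2 sp' _ A0) => [z||j]; first exact: cabs_ge0.
  by rewrite addrC.
by rewrite Ep; apply: H; right.
Qed.

Lemma commutator_bounded_of_holder : 0 < beta -> ae_holder beta b -> commutator_bounded b p q.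
Proof.
move=> b0 [g [[K HK] bg]]; have [s1 s2 p'2 sp'] := conjugate_order.
have q0 : 0 < q by move: q_gt2; lra.
have p'0 : 0 < p' by move: p'2; lra.
pose sigma := p' + q; have sig0 : 0 < sigma by rewrite addr_gt0.
pose K1 := `|K| + 1; have K10 : 0 < K1 by rewrite ltr_wpDl.
pose A := (K1 * 2 `^ beta) `^ sigma * 4.
have A0 : 0 < A by rewrite mulr_gt0// powR_gt0// mulr_gt0// powR_gt0.
apply: (@commutator_bounded_of_centers (fun j => g (dyadic_center R j)) sigma A) => //.
- by rewrite ltrDl.
- by rewrite ltrDr.
move=> j; set r := dyadic_scale R j; have r0 : 0 < r by exact: dyadic_scale_gt0.
have mS := @measurable_dyadic_square R j.
pose M := (K1 * (2 * r) `^ beta) `^ sigma.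
apply: (@le_trans _ _ (\int[area]_(z in dyadic_square j) (cst M z)%:E)%E).
  apply: ae_ge0_le_integral => //.
  - by move=> z _; rewrite lee_fin powR_ge0.
  - by apply: measurable_EFinS; apply: measurable_powRf; exact: (measurable_center (fun j => g (dyadic_center R j))).
  - by move=> z _; rewrite lee_fin powR_ge0.
  - by apply: measurable_EFinS; exact: measurable_cst.
  apply: filterS bg => z -> zS; rewrite lee_fin; apply: le_powRl; rewrite ?cabs_ge0 ?(ltW sig0)//.
  apply: (le_trans (HK _ _)); apply: (@le_trans _ _ (K1 * cabs (pt z - pt (dyadic_center R j)) `^ beta)).
    by apply: ler_wpM2r; rewrite ?powR_ge0// /K1 (le_trans (ler_norm _))// lerDl.
  rewrite ler_wpM2l ?(ltW K10)//; apply: le_powRl; rewrite ?cabs_ge0 ?(ltW b0)//.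
  exact: cabs_on_square.
have -> : (\int[area]_(z in dyadic_square j) (cst M z)%:E = M%:E * area (dyadic_square j))%E.
  exact: (integral_cst area mS M%:E).
rewrite area_square// -EFinM lee_fin le_eqVlt; apply/orP; left; apply/eqP.
rewrite /M /A (powRM _ (ler0n R 2) (ltW r0)) (mulrA K1).
have k0 : 0 <= K1 * 2 `^ beta by rewrite mulr_ge0 ?powR_ge0 ?(ltW K10).
rewrite (powRM _ k0 (powR_ge0 _ _)) -powRrM (mulrC beta) (@powRD _ r); last by rewrite (gt_eqF r0) implybT.
by rewrite powR_mulrn ?(ltW r0)// -/r; ring.
Qed.

Lemma commutator_bounded_of_bmo : beta = 0 -> bmo b -> commutator_bounded b p q.
Proof.
move=> b0 /(bmo_mean_oscillation bL)[K K0 HK]; have [s1 s2 p'2 sp'] := conjugate_order.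
pose sigma := p' + q.
have sig1 : 1 <= sigma by rewrite /sigma; move: p'2 q_gt2; lra.
have K1 : 0 < K + 1 by rewrite ltr_wpDl.
have [x r r0|A A0 HA] := john_nirenberg bL sig1 K1.
  apply: (le_trans (HK x r r0)); rewrite lee_fin addr0 powR_mulrn ?(ltW r0)//.
  have -> : (K + 1) * (2 * r) ^+ 2 = 4 * (K + 1) * r ^+ 2 by ring.
  by rewrite ler_wpM2r ?sqr_ge0//; move: K0; lra.
apply: (@commutator_bounded_of_centers (fun j => average (dyadic_square j) b) sigma (A + 1)).
- by rewrite ltrDl; move: q_gt2; lra.
- by rewrite ltrDr; move: p'2; lra.
- by rewrite ltr_wpDl.
move=> j; have r0 := dyadic_scale_gt0 R j.
apply: (le_trans (HA _ _ r0)); rewrite lee_fin b0 mulr0 add0r powR_mulrn ?(ltW r0)//.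
by rewrite ler_wpM2r ?sqr_ge0// lerDl.
Qed.

(** For negative [beta] the averages of [b] over large squares tend to a constant [c],
    and the average over a square of size [r] differs from [c] by [O(r ^ beta)], the
    size of the oscillation itself. *)
Lemma commutator_bounded_of_power (t A : R) : beta < 0 -> q <= t -> p' <= t -> 0 <= A ->
  power_oscillation b t beta A -> commutator_bounded b p q.
Proof.
move=> b0 qt p't A0 H; have [s1 s2 p'2 sp'] := conjugate_order.
have t1 : 1 < t by move: qt q_gt2; lra.
have mo := mean_oscillation_of_power bL t1 A0 H.
have [C [c C0 HC]] := average_limit_large bL mo (mulr_ge0 (powR_ge0 _ _) (powR_ge0 _ _)) b0.
have low u : u = q \/ u = p' -> exists2 A', 0 <= A' & power_oscillation b u beta A'.
  move=> uE; have u0 : 0 < u by case: uE => ->; move: q_gt2 p'2; lra.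
  have : u <= t by case: uE => ->.
  rewrite le_eqVlt => /orP[/eqP ->|ut]; first by exists A.
  exists (A `^ (u / t) * 4 `^ (1 - u / t)); first by rewrite mulr_ge0 ?powR_ge0.
  exact: power_oscillation_le.
have shift u : u = q \/ u = p' -> exists2 B, 0 <= B & forall j,
    (\int[area]_(z in dyadic_square j) (cabs (b z - c) `^ u)%:E <=
     (B * dyadic_scale R j `^ (u * beta + 2))%:E)%E.
  move=> uE; have u0 : 0 < u by case: uE => ->; move: q_gt2 p'2; lra.
  have [A' A'0 HA'] := low u uE.
  exists (2 `^ u * (A' + C `^ u * 4)) => [|j].
    by rewrite mulr_ge0 ?powR_ge0// addr_ge0// mulr_ge0 ?powR_ge0.
  have r0 := dyadic_scale_gt0 R j; have mS := @measurable_dyadic_square R j.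
  set a := average (dyadic_square j) b.
  have ac : cabs (a - c) <= C * dyadic_scale R j `^ beta.
    by have := HC (dyadic_center R j) j.1; rewrite -scale2_powR.
  have {}HA' := HA' (dyadic_center R j) _ r0.
  set r := dyadic_scale R j; pose M := 2 `^ u * (C * r `^ beta) `^ u.
  have M0 : 0 <= M by rewrite mulr_ge0 ?powR_ge0.
  have Cr0 : 0 <= C * r `^ beta by rewrite mulr_ge0 ?powR_ge0.
  have ma : measurable_fun setT (fun z => cabs (b z - a) `^ u).
    by apply: measurable_powRf; apply: measurable_cabs_sub; case: bL.
  have m2 : measurable_fun setT (fun z => 2 `^ u * cabs (b z - a) `^ u).
    by apply: measurable_funM; [exact: measurable_cst|exact: ma].
  apply: (@le_trans _ _ (\int[area]_(z in dyadic_square j) (2 `^ u * cabs (b z - a) `^ u + cst M z)%:E)%E).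
    apply: le_integral_EFin => //.
    - by apply: measurable_powRf; apply: measurable_cabs_sub; case: bL.
    - by apply: measurable_funD; [exact: m2|exact: measurable_cst].
    - by move=> z _; exact: powR_ge0.
    move=> z _; rewrite /M -mulrDr; apply: (powR_le_add (ltW u0) (cabs_ge0 _) (cabs_ge0 _) Cr0).
    by apply: (le_trans (cabs_dist_triangle _ a _)); rewrite lerD2l.
  rewrite (integralD_EFin_ge0 area mS m2 (measurable_cst M) (fun=> mulr_ge0 (powR_ge0 _ _) (powR_ge0 _ _)) (fun=> M0)).
  rewrite (integralZ_EFin area mS ma (fun=> powR_ge0 _ _) (powR_ge0 _ _)).
  have -> : (\int[area]_(z in dyadic_square j) (cst M z)%:E = M%:E * area (dyadic_square j))%E.
    exact: (integral_cst area mS M%:E).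
  rewrite area_square// -EFinM.
  apply: (@le_trans _ _ (2 `^ u * (A' * r `^ (u * beta + 2)) + M * (2 * r) ^+ 2)%:E).
    rewrite EFinD (EFinM (2 `^ u)); apply: leeD => //.
    by apply: lee_wpmul2l => //; rewrite lee_fin powR_ge0.
  rewrite lee_fin le_eqVlt; apply/orP; left; apply/eqP.
  rewrite /M (powRM _ C0 (powR_ge0 _ _)) -powRrM (mulrC beta) (@powRD _ r); last by rewrite (gt_eqF r0) implybT.
  by rewrite powR_mulrn ?(ltW r0)//; ring.
have [B1 B10 H1] := shift q (or_introl erefl); have [B2 B20 H2] := shift p' (or_intror erefl).
apply: (@commutator_bounded_of_constant c (B1 + B2 + 1)); first by rewrite ltr_wpDl// addr_ge0.
move=> u [] -> j.
  by apply: (le_trans (H1 j)); rewrite lee_fin ler_wpM2r ?powR_ge0//; move: B20; lra.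
by apply: (le_trans (H2 j)); rewrite lee_fin ler_wpM2r ?powR_ge0//; move: B10; lra.
Qed.

End sufficiency.

(** * The characterization *)

Theorem theorem1p1 (R : realType) (b : plane R -> R[i])
    (p q p' beta phi lambda : R)
    (b_L1loc : L1loc b)
    (p_gt1 : 1 < p) (p_lt2 : p < 2) (q_gt2 : 2 < q)
    (p'_conj : p^-1 + p'^-1 = 1) (p'_neq_q : p' <> q)
    (beta_def : beta / 2 = p^-1 - q^-1 - 2^-1)
    (phi_def : phi = Num.max p' q)
    (lambda_def : phi^-1 * (1 - lambda / 2) = - (beta / 2)) :
  commutator_bounded b p q <->
  [\/ 1 < beta /\ ae_constant b,
      0 < beta <= 1 /\ ae_holder beta b,
      beta = 0 /\ bmo b
    | beta < 0 /\ campanato phi lambda b].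
Proof.
have q1 : 1 < q by lra.
have qs : q^-1 + (q / (q - 1))^-1 = 1 by field; apply/andP; split; lra.
have p'E := conjugate_gt0 p_gt1 p'_conj.
have p'2 : 2 < p' by rewrite p'E ltr_pdivlMr ?subr_gt0//; lra.
have phi0 : 0 < phi by rewrite phi_def lt_max; apply/orP; left; lra.
have lE : lambda = phi * beta + 2.
  have : phi * (phi^-1 * (1 - lambda / 2)) = phi * - (beta / 2) by rewrite lambda_def.
  by rewrite mulrA divff ?gt_eqF// mul1r; lra.
have beta1 : beta < 1.
  have : p^-1 < 1 by rewrite invf_lt1//; lra.
  have : 0 < q^-1 by rewrite invr_gt0; lra.
  lra.
split=> [[K [K0 Hb]]|]; last first.
  case=> [[b1 _]|[/andP[b0 _] bH]|[b0 bB]|[b0 bC]].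
  - lra.
  - exact: (commutator_bounded_of_holder b_L1loc p_gt1 p_lt2 q_gt2 p'_conj qs beta_def b0 bH).
  - exact: (commutator_bounded_of_bmo b_L1loc p_gt1 p_lt2 q_gt2 p'_conj qs beta_def b0 bB).
  have [A A0 HA] := (campanato_power_oscillation b_L1loc phi0 lE).1 bC.
  apply: (commutator_bounded_of_power b_L1loc p_gt1 p_lt2 q_gt2 p'_conj qs beta_def b0 _ _ A0 HA).
    by rewrite phi_def le_max lexx orbT.
  by rewrite phi_def le_max lexx.
have power (t c M : R) : 0 < t -> 0 <= M -> t * c = t * beta + 2 ->
    (forall x r, 0 < r -> (\int[area]_(z in square x r) (cabs (b z - average (square x r) b) `^ t)%:E <=
       ((M * (2 * r) `^ c) `^ t)%:E)%E) ->
    power_oscillation b t beta ((M * 2 `^ c) `^ t).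
  move=> t0 M0 tc H x r r0; apply: (le_trans (H x r r0)); rewrite lee_fin le_eqVlt; apply/orP; left.
  have M2 : 0 <= M * 2 `^ c by rewrite mulr_ge0 ?powR_ge0.
  rewrite (powRM c (ler0n R 2) (ltW r0)) mulrA (powRM t M2 (powR_ge0 _ _)) -powRrM.
  by rewrite (mulrC c) tc.
have [q0 p'0] : 0 < q /\ 0 < p' by lra.
have betaE : beta = 2 * (p^-1 - q^-1 - 2^-1) by lra.
have betaE' : beta = 2 * (2^-1 - q^-1 - p'^-1) by lra.
have Hq : power_oscillation b q beta ((4 * K * 2 `^ (2 / p - 1)) `^ q).
  apply: power => //; first by rewrite mulr_ge0// ltW.
    by rewrite betaE; field; apply/andP; split; lra.
  by move=> x r r0; exact: oscillation_le_q.
have Hp' : power_oscillation b p' beta ((8 * K * 2 `^ (1 - 2 / q)) `^ p').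
  apply: power => //; first by rewrite mulr_ge0// ltW.
    by rewrite betaE'; field; apply/andP; split; lra.
  by move=> x r r0; exact: (oscillation_le_conjugate x b_L1loc p_gt1 q1 K0 p'_conj Hb r0).
have mo := mean_oscillation_of_power b_L1loc q1 (powR_ge0 _ _) Hq.
have [b0|b0|b0] := ltgtP beta 0.
- apply: Or44; split=> //; apply/(campanato_power_oscillation b_L1loc phi0 lE).
  rewrite phi_def; case: (leP p' q) => _; [by exists ((4 * K * 2 `^ (2 / p - 1)) `^ q); first exact: powR_ge0|].
  by exists ((8 * K * 2 `^ (1 - 2 / q)) `^ p'); first exact: powR_ge0.
- apply: Or42; split; first by rewrite /= ltW.
  by apply: (ae_holder_of_mean_oscillation b_L1loc mo _ b0); rewrite mulr_ge0 ?powR_ge0.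
- apply: Or43; split=> //; apply/(bmo_mean_oscillation b_L1loc).
  rewrite b0 in mo; eexists; last exact: mo.
  by rewrite mulr_ge0 ?powR_ge0.
Qed.
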